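(* Assume that the local exactness condition and the geometric decomposition condition hold, and that $\mathcal T$ satisfies the local patch condition relative to $\mathcal U$. Then for every $0 \le k \le n$ there are isomorphisms (and equalities, where indicated) of vector spaces $$\mathcal H_{n-k}(\mathcal T,\mathcal U)\simeq \mathfrak C^0(\mathcal T^{n-k}) = \mathfrak C^0_{-1}(\mathcal T^{n-k})\simeq \mathfrak C^0_{-2}(\mathcal T^{n-k})\simeq\dots\simeq \mathfrak C^0_{-k-1}(\mathcal T^{n-k})$$ $$= \mathfrak H^k_{-k-1}(\mathcal T^n)\simeq \mathfrak H^k_{-k}(\mathcal T^n)\simeq\dots\simeq \mathfrak H^k_{-1}(\mathcal T^n)=\mathfrak H^k(\mathcal T^n).$$
   Context: Simplices. Fix $n\in\mathbb N_0$. Simplices are closed simplices in $\mathbb R^n$. $F\trianglelefteq C$ means that $F$ is a subsimplex of $C$ (the vertices of $F$ are among those of $C$); $F\vartriangleleft C$ means $F\trianglelefteq C$ and $F\ne C$. A simplicial complex is a set of simplices that contains all subsimplices of its members and in which every nonempty intersection of two members is a subsimplex of both. It is $p$-dimensional if each member is a subsimplex of some $p$-dimensional member. $\mathcal T$ is a finite $n$-dimensional simplicial complex and $\mathcal U\subseteq\mathcal T$ is a (possibly empty) simplicial subcomplex. $\mathcal T^m,\mathcal U^m$ denote the sets of $m$-dimensional members (empty if there are none). For a complex $\mathcal M$, $\mathcal M^{[m]}$ is its largest $m$-dimensional subcomplex ($m$-skeleton). All simplices carry a fixed orientation (the Euclidean one for $n$-simplices); for a codimension-one subsimplex $F$ of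 $C$, $o(F,C)=1$ if the orientation induced by $C$ on $F$ is that of $F$, and $o(F,C)=-1$ otherwise. $\mathcal C_m(\mathcal T)$ is the real vector space with basis $\mathcal T^m$, with boundary $\partial_m C=\sum_{F\in\mathcal T^{m-1},F\vartriangleleft C}o(F,C)F$; $\mathcal C_m(\mathcal T,\mathcal U)=\mathcal C_m(\mathcal T)/\mathcal C_m(\mathcal U)$ with induced boundary, and $\mathcal H_m(\mathcal T,\mathcal U)$ is the $m$-th homology space of this relative chain complex (real coefficients). Spaces of forms. For each $C\in\mathcal T$ and each $k$ there is a given finite-dimensional subspace $\Lambda^k(C)$ of the space of smooth $k$-forms on $C$ (smooth up to the boundary), with $\Lambda^k(C)=0$ for $k<0$ or $k>\dim C$, such that the exterior derivative $\mathsf d_C^k$ maps $\Lambda^k(C)$ into $\Lambda^{k+1}(C)$ and such that for $F\trianglelefteq C$ the trace $\operatorname{tr}^k_{C,F}$ (pullback along the inclusion $F\subseteq C$) satisfies $\operatorname{tr}^k_{C,F}\Lambda^k(C)=\Lambda^k(F)$. Put $\Lambda^k_{-1}(\mathcal T^m)=\bigoplus_{C\in\mathcal T^m\setminus\mathcal U^m}\Lambda^k(C)$; the component of $\omega$ at $C$ is $\omega_C$. Define $\mathsf D^m_k:\Lambda^k_{-1}(\mathcal T^m)\to\Lambda^{k+1}_{-1}(\mathcal T^m)$, $\mathsf D^m_k\omega=\sum_{C}\mathsf d^k_C\omega_C$, and $\mathsf T^m_k:\Lambda^k_{-1}(\mathcal T^m)\to\Lambda^k_{-1}(\mathcal T^{m-1})$,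 $\mathsf T^m_k\omega=\sum_{C\in\mathcal T^m\setminus\mathcal U^m}\sum_{F\in\mathcal T^{m-1}\setminus\mathcal U^{m-1},F\vartriangleleft C}o(F,C)\operatorname{tr}^k_{C,F}\omega_C$. For $b\ge1$ put $\Lambda^k_{-b}(\mathcal T^m)=\bigoplus_{j=0}^{b-1}\Lambda^{k-j}_{-1}(\mathcal T^{m-j})$ and $\Gamma^k_{-b}(\mathcal T^m)=\bigoplus_{j=0}^{b-1}\Lambda^{k+j}_{-1}(\mathcal T^{m+j})$ (summands that make no sense are zero), and $\Lambda^k_0(\mathcal T^m)=\Lambda^k(\mathcal T^m)=\ker\mathsf T^m_k$, $\Gamma^k_0(\mathcal T^m)=\Gamma^k(\mathcal T^m)=\ker\mathsf D^m_k$. The discrete distributional exterior derivative is the linear map with $\mathsf d^k\omega=(-1)^i\mathsf D^{n-i}_{k-i}\omega-(-1)^i\mathsf T^{n-i}_{k-i}\omega$ for $\omega\in\Lambda^{k-i}_{-1}(\mathcal T^{n-i})$; it maps $\Lambda^k_{-b}(\mathcal T^n)\to\Lambda^{k+1}_{-b-1}(\mathcal T^n)$ and, with $k=n-m$, $\Gamma^0_{-b}(\mathcal T^m)\to\Gamma^0_{-b-1}(\mathcal T^{m-1})$, and $\mathsf d^{k+1}\mathsf d^k=0$. Scalar products. Each $\Lambda^k_{-1}(\mathcal T^m)$ carries a fixed (arbitrary) scalar product; the direct sums above carry the orthogonal direct sum scalar product. Harmonic spaces. $\mathfrak H^k(\mathcal T^n)=\{\omega\in\Lambda^k(\mathcal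 T^n): \mathsf D^n_k\omega=0,\ \omega\perp\mathsf D^n_{k-1}\Lambda^{k-1}(\mathcal T^n)\}$; $\mathfrak C^0(\mathcal T^m)=\{\omega\in\Gamma^0(\mathcal T^m):\mathsf T^m_0\omega=0,\ \omega\perp\mathsf T^{m+1}_0\Gamma^0(\mathcal T^{m+1})\}$; and for $b\ge1$, $\mathfrak H^k_{-b}(\mathcal T^n)=\{\omega\in\Lambda^k_{-b}(\mathcal T^n):\mathsf d^k\omega=0,\ \omega\perp\mathsf d^{k-1}\Lambda^{k-1}_{-b+1}(\mathcal T^n)\}$, $\mathfrak C^0_{-b}(\mathcal T^m)=\{\omega\in\Gamma^0_{-b}(\mathcal T^m):\mathsf d^{n-m}\omega=0,\ \omega\perp\mathsf d^{n-m-1}\Gamma^0_{-b+1}(\mathcal T^{m+1})\}$. Conditions. Local exactness condition: for each $C\in\mathcal T\setminus\mathcal U$ of dimension $m$, the sequence $0\to\ker\mathsf d^0_C\to\Lambda^0(C)\to\dots\to\Lambda^m(C)\to0$ (with the maps $\mathsf d^k_C$) is exact and $\ker\mathsf d^0_C$ is spanned by the constant function $1_C$. Geometric decomposition condition: with $\mathring\Lambda^k(F)=\{\omega\in\Lambda^k(F):\operatorname{tr}^k_{F,G}\omega=0\ \forall G\vartriangleleft F\}$, there are linear maps $\operatorname{ext}^k_{F,C}:\mathring\Lambda^k(F)\to\Lambda^k(C)$ for all $F\trianglelefteq C$ in $\mathcal T$ with $\operatorname{tr}^k_{C,F}\operatorname{ext}^k_{F,C}=\mathrm{Id}$, $\operatorname{ext}^k_{F,G}=\operatorname{tr}^k_{C,G}\operatorname{ext}^k_{F,C}$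 for $F\trianglelefteq G\trianglelefteq C$, and $\operatorname{tr}^k_{C,G}\operatorname{ext}^k_{F,C}=0$ for $G\trianglelefteq C$ with $F\not\trianglelefteq G$. Local patch condition of $\mathcal T$ relative to $\mathcal U$: for all $F\in\mathcal T$, with $\mathcal M_F=\{G\in\mathcal T:\exists C\in\mathcal T^n, F\trianglelefteq C, G\trianglelefteq C\}$ and $\mathcal N_F=\{G\in\mathcal M_F^{[n-1]}:F\not\trianglelefteq G\text{ or }G\in\mathcal U\}$, the relative simplicial chain complex $\mathcal C_\bullet(\mathcal M_F,\mathcal N_F)$ has vanishing homology in degrees $0,\dots,n-1$. *)

(* Defs.v *)
From HB Require Import structures.
From mathcomp Require Import all_boot all_order all_algebra finmap.
From mathcomp Require Import generic_quotient ring_quotient.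
From mathcomp Require Import all_classical all_reals topology normedtype derive.

Set Implicit Arguments.
Unset Strict Implicit.
Unset Printing Implicit Defensive.

Import Order.TTheory GRing.Theory Num.Theory numFieldNormedType.Exports.

Local Open Scope classical_set_scope.
Local Open Scope ring_scope.

(** * Subspaces, linear isomorphisms, quotients and scalar products *)

(* Vector spaces are handled as subsets of ambient [lmodType]s. *)
Section LinearAlgebra.
Context {R : realType}.

Definition is_subspace (V : lmodType R) (S : set V) : Prop :=
  S 0 /\ forall (a : R) u v, S u -> S v -> S (a *: u + v).

Definition fin_dim (V : lmodType R) (S : set V) : Prop :=
  exists (d : nat) (e : 'I_d -> V),
    S = [set v | exists a : 'I_d -> R, v = \sum_i a i *: e i].

Definition linear_on (V W : lmodType R) (S : set V) (f : V -> W) : Prop :=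
  forall (a : R) u v, S u -> S v -> f (a *: u + v) = a *: f u + f v.

Definition lin_iso (V W : lmodType R) (S : set V) (S' : set W) : Prop :=
  exists f : V -> W, linear_on S f /\ set_bij S S' f.

Definition scalar_product (V : lmodType R) (S : set V) (sp : V -> V -> R) :
    Prop :=
  [/\ forall u v, S u -> S v -> sp u v = sp v u,
      forall (a : R) u v w, S u -> S v -> S w ->
        sp (a *: u + v) w = a * sp u w + sp v w
    & forall u, S u -> u != 0 -> 0 < sp u u].

(* The quotient V / S. To get an instance for every set S, without a proof that
   S is a subspace, we quotient by the span of S, which is S itself whenever S
   is a subspace. *)
Definition in_vspan (V : lmodType R) (S : set V) : {pred V} :=
  fun v => `[< forall W : set V, is_subspace W -> S `<=` W -> W v >].

Lemma in_vspan_submod_closed (V : lmodType R) (S : set V) :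
  submod_closed (in_vspan S).
Proof.
split; first by apply/asboolP => W [].
move=> a u v /asboolP uS /asboolP vS; apply/asboolP => W WV SW.
by case: (WV) => _; apply; [exact: uS | exact: vS].
Qed.

HB.instance Definition _ (V : lmodType R) (S : set V) :=
  GRing.isSubmodClosed.Build R V (in_vspan S) (in_vspan_submod_closed S).

Definition quotv (V : lmodType R) (S : set V) := Quotient.quot (in_vspan S).
HB.instance Definition _ (V : lmodType R) (S : set V) :=
  GRing.Zmodule.on (quotv S).

Definition proj_quot (V : lmodType R) (S : set V) (v : V) : quotv S :=
  (\pi_(Quotient.quot (in_vspan S)) v)%qT.

Section QuotLmodule.
Variables (V : lmodType R) (S : set V).

Definition lift_quot (q : quotv S) : V := repr (q : Quotient.quot (in_vspan S)).

Lemma lift_quotK : cancel lift_quot (@proj_quot V S).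
Proof. by move=> q; apply: (@reprK _ (Quotient.quot (in_vspan S))). Qed.

Lemma proj_quot_eq (u v : V) :
  proj_quot S u = proj_quot S v <-> u - v \in in_vspan S.
Proof.
by rewrite Quotient.idealrBE; split=> [eq_uv|/eqP //]; apply/eqP.
Qed.

Lemma proj_quotD (u v : V) :
  proj_quot S (u + v) = proj_quot S u + proj_quot S v.
Proof. exact: (raddfD (\pi_(Quotient.quot (in_vspan S)))%qT). Qed.

Definition scaleq (a : R) (q : quotv S) : quotv S :=
  proj_quot S (a *: lift_quot q).

Lemma proj_quotZ a u : proj_quot S (a *: u) = scaleq a (proj_quot S u).
Proof.
apply/proj_quot_eq; rewrite -scalerBr rpredZ //.
by apply/proj_quot_eq; rewrite lift_quotK.
Qed.

Lemma scaleqA a b q : scaleq a (scaleq b q) = scaleq (a * b) q.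
Proof.
by rewrite -{1}[q]lift_quotK -!proj_quotZ scalerA proj_quotZ lift_quotK.
Qed.
Lemma scale1q : left_id 1 scaleq.
Proof. by move=> q; rewrite -[q]lift_quotK -proj_quotZ scale1r. Qed.
Lemma scaleqDr : right_distributive scaleq +%R.
Proof.
move=> a p q; rewrite -[p]lift_quotK -[q]lift_quotK.
by rewrite -proj_quotD -!proj_quotZ scalerDr proj_quotD.
Qed.
Lemma scaleqDl q : {morph scaleq^~ q : a b / a + b}.
Proof.
by move=> a b; rewrite -[q]lift_quotK -!proj_quotZ scalerDl proj_quotD.
Qed.

HB.instance Definition _ := GRing.Zmodule_isLmodule.Build R (quotv S)
  scaleqA scale1q scaleqDr scaleqDl.
End QuotLmodule.

End LinearAlgebra.

(** * Simplices *)

(* A simplex is given by its set of vertices. *)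
Definition simplex (R : realType) (n : nat) := {fset 'rV[R]_n}.

Section Simplices.
Context {R : realType} {n : nat}.
Implicit Types (C F G : simplex R n) (M N : {fset simplex R n}).

Definition aff_indep C : Prop :=
  forall w : 'rV[R]_n -> R, \sum_(v <- C) w v = 0 ->
    \sum_(v <- C) w v *: v = 0 -> forall v, v \in C -> w v = 0.

Definition is_simplex C : Prop := C != fset0 /\ aff_indep C.

Definition sdim C : int := (#|` C|)%:Z - 1.

Definition hull C : set 'rV[R]_n :=
  [set x | exists w : 'rV[R]_n -> R,
     [/\ forall v, v \in C -> 0 <= w v, \sum_(v <- C) w v = 1
       & x = \sum_(v <- C) w v *: v]].

Definition tangent_space C : set 'rV[R]_n :=
  [set x | exists w : 'rV[R]_n -> R,
     \sum_(v <- C) w v = 0 /\ x = \sum_(v <- C) w v *: v].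

Definition subsimplex F C : bool := (F != fset0) && (F `<=` C)%fset.
Definition psubsimplex F C : bool := subsimplex F C && (F != C).

Definition simplicial_complex M : Prop :=
  [/\ forall C, C \in M -> is_simplex C,
      forall C F, C \in M -> subsimplex F C -> F \in M
    & forall C C', C \in M -> C' \in M -> hull C `&` hull C' !=set0 ->
        exists F, [/\ subsimplex F C, subsimplex F C'
                    & hull C `&` hull C' = hull F]].

Definition dimensional (p : int) M : Prop :=
  forall F, F \in M -> exists C, [/\ C \in M, sdim C = p & subsimplex F C].

(* The union of all p-dimensional subcomplexes of M, i.e. the largest one. *)
Definition simp_skeleton (p : int) M : {fset simplex R n} :=
  [fset G in M | `[< exists K : {fset simplex R n},
     [/\ (K `<=` M)%fset, simplicial_complex K, dimensional p K
       & G \in K] >]]%fset.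

(** * Alternating forms and orientations *)

(* Multilinear forms take a list of vectors. [alternating_on E k f] says that f
   restricts to an alternating k-linear form on the subspace E; the values of f
   on other lists are not constrained. *)
Definition alternating_on (E : set 'rV[R]_n) (k : int) (f : seq 'rV[R]_n -> R) :
    Prop :=
  (forall s i (a : R) u v, (size s)%:Z = k -> (i < size s)%N ->
     (forall x, x \in s -> E x) -> E u -> E v ->
     f (set_nth 0 s i (a *: u + v))
       = a * f (set_nth 0 s i u) + f (set_nth 0 s i v)) /\
  (forall s, (size s)%:Z = k -> (forall x, x \in s -> E x) -> ~~ uniq s ->
     f s = 0).

(* An orientation of C is a nonzero alternating form of top degree on the
   tangent space of C, up to a positive factor (in dimension 0, a sign). *)
Definition orients (f : seq 'rV[R]_n -> R) C : Prop :=
  alternating_on (tangent_space C) (sdim C) f /\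
  exists s, [/\ (size s)%:Z = sdim C, forall x, x \in s -> tangent_space C x
              & f s != 0].

Definition same_orientation C (f g : seq 'rV[R]_n -> R) : Prop :=
  exists2 a : R, 0 < a &
    forall s, (size s)%:Z = sdim C ->
      (forall x, x \in s -> tangent_space C x) -> f s = a * g s.

Definition euclidean_orientation (s : seq 'rV[R]_n) : R :=
  \det (\matrix_(i < n, j < n) (nth 0 s i) 0 j).

Definition barycenter C : 'rV[R]_n := (#|` C|)%:R^-1 *: \sum_(v <- C) v.

(* For F a codimension-one subsimplex of C, barycenter F - barycenter C is an
   outward pointing vector at F. *)
Definition induced_orientation (f : seq 'rV[R]_n -> R) C F :
    seq 'rV[R]_n -> R :=
  fun s => f (barycenter F - barycenter C :: s).

Definition incidence (ori : simplex R n -> seq 'rV[R]_n -> R) F C : R :=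
  if `[< same_orientation F (induced_orientation (ori C) C F) (ori F) >]
  then 1 else -1.

(** * Relative simplicial homology *)

(* All real-valued functions on simplices; for finite M, [simp_chains M m] is
   the space with basis the m-dimensional members of M. *)
Definition rchain := simplex R n -> R^o.

Definition simp_chains M (m : int) : set rchain :=
  [set c | forall C, c C != 0 -> C \in M /\ sdim C = m].

Section Homology.
Unset Implicit Arguments.
Variable ori : simplex R n -> seq 'rV[R]_n -> R.

Definition chain_boundary M (m : int) (c : rchain) : rchain := fun F =>
  if (F \in M) && (sdim F == m - 1) then
    \sum_(C <- M | (sdim C == m) && psubsimplex F C) incidence ori F C * c C
  else 0.

(* C_m(M, N), as a subspace of (all chains) / C_m(N). *)
Definition rel_chains M N (m : int) : set (quotv (simp_chains N m)) :=
  proj_quot (simp_chains N m) @` simp_chains M m.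

(* The induced boundary operator from degree m to degree p = m - 1 (p is a
   separate argument because m + 1 - 1 and m are not convertible). *)
Definition rel_boundary M N (m p : int) (q : quotv (simp_chains N m)) :
    quotv (simp_chains N p) :=
  proj_quot (simp_chains N p) (chain_boundary M m (lift_quot q)).

Definition rel_cycles M N (m : int) : set (quotv (simp_chains N m)) :=
  [set q | rel_chains M N m q /\ rel_boundary M N m (m - 1) q = 0].

Definition rel_boundaries M N (m : int) : set (quotv (simp_chains N m)) :=
  rel_boundary M N (m + 1) m @` rel_chains M N (m + 1).

Definition rel_homology M N (m : int) : set (quotv (rel_boundaries M N m)) :=
  proj_quot (rel_boundaries M N m) @` rel_cycles M N m.

Definition star_patch (T : {fset simplex R n}) F : {fset simplex R n} :=
  [fset G in T | [exists C : T, [&& sdim (val C) == n%:Z, subsimplex F (val C)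
                                 & subsimplex G (val C)]]]%fset.

Definition patch_boundary (T U : {fset simplex R n}) F : {fset simplex R n} :=
  [fset G in simp_skeleton (n%:Z - 1) (star_patch T F)
     | ~~ subsimplex F G || (G \in U)]%fset.

Definition local_patch_condition (T U : {fset simplex R n}) : Prop :=
  forall F, F \in T -> forall m : int, 0 <= m <= n%:Z - 1 ->
    rel_homology (star_patch T F) (patch_boundary T U F) m = [set 0].

End Homology.
Set Implicit Arguments.

(** * Differential forms *)

(* C^infinity: every iterated directional derivative is differentiable. *)
Definition smooth_fun (f : 'rV[R]_n -> R) : Prop :=
  forall (s : seq 'rV[R]_n) x,
    differentiable (foldr (fun v g => 'D_v g) f s) x.

(* Forms of all degrees live in one ambient space: a k-form vanishes on lists
   whose length is not k, and a form on C vanishes at points outside C and on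
   lists with a vector that is not tangent to C. *)
Definition dform := 'rV[R]_n -> seq 'rV[R]_n -> R^o.

Definition restrict_form C (w : dform) : dform := fun x s =>
  if `[< hull C x /\ forall v, v \in s -> tangent_space C v >]
  then w x s else 0.

Definition smooth_form (k : int) (w : dform) : Prop :=
  [/\ forall x, alternating_on setT k (w x),
      forall x s, (size s)%:Z != k -> w x s = 0
    & forall s, smooth_fun (fun x => w x s)].

(* Smooth k-forms on the closed simplex C: those with a smooth extension. *)
Definition smooth_forms (k : int) C : set dform :=
  restrict_form C @` [set w | smooth_form k w].

Definition ext_deriv (w : dform) : dform := fun x s =>
  \sum_(i < size s) (-1) ^+ i *
    'D_(nth 0 s i) (fun y => w y (take i s ++ drop i.+1 s) : R) x.

(* Computed on a smooth extension of w; the restriction to C does not depend on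
   which one. *)
Definition dC (k : int) C (w : dform) : dform :=
  restrict_form C (ext_deriv
    (xget 0 [set e | smooth_form k e /\ restrict_form C e = w])).

(* Pullback along the inclusion of F in C is restriction to the points of F and
   to the vectors tangent to F. *)
Definition trace_form C F (w : dform) : dform := restrict_form F w.

(* The constant function 1 on C, as a 0-form. *)
Definition const1 C : dform := restrict_form C (fun _ s => (s == [::])%:R).

End Simplices.

Arguments dform R n : clear implicits.

(** * Discrete distributional differential forms *)

(* An element of a direct sum of spaces Lambda^k(C) is the family of its
   components. *)
Definition cochain (R : realType) (n : nat) := simplex R n -> dform R n.

Section Distributional.
Context {R : realType} {n : nat}.
Variables (T U : {fset simplex R n}).
Variable ori : simplex R n -> seq 'rV[R]_n -> R.
Variable Lam : int -> simplex R n -> set (dform R n).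
(* sp k m is the scalar product of Lambda^k_{-1}(T^m). *)
Variable sp : int -> int -> cochain R n -> cochain R n -> R.
Implicit Types (k m : int) (b : nat) (C F G : simplex R n).

Definition admissible_spaces : Prop :=
  [/\ forall k C, C \in T -> Lam k C `<=` smooth_forms k C /\ fin_dim (Lam k C),
      forall k C, C \in T -> k < 0 \/ sdim C < k -> Lam k C = [set 0],
      forall k C w, C \in T -> Lam k C w -> Lam (k + 1) C (dC k C w)
    & forall k C F, C \in T -> subsimplex F C ->
        trace_form C F @` Lam k C = Lam k F].

Definition local_exactness_condition : Prop :=
  forall C, C \in T -> C \notin U ->
    [set w | Lam 0 C w /\ dC 0 C w = 0]
      = [set w | exists a : R, w = a *: const1 C] /\
    forall k, 1 <= k <= sdim C ->
      [set w | Lam k C w /\ dC k C w = 0] = dC (k - 1) C @` Lam (k - 1) C.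

Definition Lam_ring k F : set (dform R n) :=
  [set w | Lam k F w /\ forall G, psubsimplex G F -> trace_form F G w = 0].

Definition geometric_decomposition_condition : Prop :=
  exists ext : int -> simplex R n -> simplex R n -> dform R n -> dform R n,
    (forall k F C, C \in T -> subsimplex F C ->
       [/\ linear_on (Lam_ring k F) (ext k F C),
           forall w, Lam_ring k F w -> Lam k C (ext k F C w)
         & forall w, Lam_ring k F w -> trace_form C F (ext k F C w) = w]) /\
    (forall k F G C, C \in T -> subsimplex F G -> subsimplex G C ->
       forall w, Lam_ring k F w ->
         ext k F G w = trace_form C G (ext k F C w)) /\
    (forall k F G C, C \in T -> subsimplex F C -> subsimplex G C ->
       ~~ subsimplex F G ->
       forall w, Lam_ring k F w -> trace_form C G (ext k F C w) = 0).

(* C belongs to T^m minus U^m. *)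
Definition active m C : bool := [&& C \in T, C \notin U & sdim C == m].

Definition Lam1 k m : set (cochain R n) :=
  [set w | forall C, if active m C then Lam k C (w C) else w C = 0].

Definition Dmap k m (w : cochain R n) : cochain R n :=
  fun C => if active m C then dC k C (w C) else 0.

Definition Tmap k m (w : cochain R n) : cochain R n := fun F =>
  if active (m - 1) F then
    \sum_(C <- T | active m C && psubsimplex F C)
      incidence ori F C *: trace_form C F (w C)
  else 0.

Definition comp_at m (w : cochain R n) : cochain R n :=
  fun C => if active m C then w C else 0.

(* [Lam_ k m b] is Lambda^k_{-b}(T^m) and [Gam_ k m b] is Gamma^k_{-b}(T^m); the
   sums are direct since the summands have disjoint supports. *)
Definition Lam_ k m b : set (cochain R n) :=
  if b is 0 then [set w | Lam1 k m w /\ Tmap k m w = 0]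
  else [set w | exists2 e : 'I_b -> cochain R n,
         forall j : 'I_b, Lam1 (k - j%:Z) (m - j%:Z) (e j) & w = \sum_j e j].

Definition Gam_ k m b : set (cochain R n) :=
  if b is 0 then [set w | Lam1 k m w /\ Dmap k m w = 0]
  else [set w | exists2 e : 'I_b -> cochain R n,
         forall j : 'I_b, Lam1 (k + j%:Z) (m + j%:Z) (e j) & w = \sum_j e j].

Definition ddist k (w : cochain R n) : cochain R n :=
  \sum_(i < n.+1) let wi := comp_at (n%:Z - i%:Z) w in
    ((-1) ^+ i *: Dmap (k - i%:Z) (n%:Z - i%:Z) wi
     - (-1) ^+ i *: Tmap (k - i%:Z) (n%:Z - i%:Z) wi).

Definition sp_Lam k m b (v w : cochain R n) : R :=
  \sum_(j < b) sp (k - j%:Z) (m - j%:Z)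
    (comp_at (m - j%:Z) v) (comp_at (m - j%:Z) w).

Definition sp_Gam k m b (v w : cochain R n) : R :=
  \sum_(j < b) sp (k + j%:Z) (m + j%:Z)
    (comp_at (m + j%:Z) v) (comp_at (m + j%:Z) w).

(* In [harm_H] and [harm_C], b = 0 gives the spaces without subscript. *)
Definition harm_H k b : set (cochain R n) :=
  if b is b'.+1 then
    [set w | [/\ Lam_ k n b w, ddist k w = 0
      & forall v, Lam_ (k - 1) n b' v -> sp_Lam k n b w (ddist (k - 1) v) = 0]]
  else
    [set w | [/\ Lam_ k n 0 w, Dmap k n w = 0
      & forall v, Lam_ (k - 1) n 0 v -> sp k n w (Dmap (k - 1) n v) = 0]].

Definition harm_C m b : set (cochain R n) :=
  if b is b'.+1 then
    [set w | [/\ Gam_ 0 m b w, ddist (n%:Z - m) w = 0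
      & forall v, Gam_ 0 (m + 1) b' v ->
          sp_Gam 0 m b w (ddist (n%:Z - m - 1) v) = 0]]
  else
    [set w | [/\ Gam_ 0 m 0 w, Tmap 0 m w = 0
      & forall v, Gam_ 0 (m + 1) 0 v -> sp 0 m w (Tmap 0 (m + 1) v) = 0]].

End Distributional.

(* Main.v *)
Require Import Defs.
From HB Require Import structures.
From mathcomp Require Import all_boot all_order all_algebra finmap.
From mathcomp Require Import all_classical all_reals topology normedtype derive.
From mathcomp Require Import ring lra zify.

Set Implicit Arguments.
Unset Strict Implicit.
Unset Printing Implicit Defensive.

Import Order.TTheory GRing.Theory Num.Theory numFieldNormedType.Exports.

Local Open Scope classical_set_scope.
Local Open Scope ring_scope.

(** The spaces of piecewise forms make up a double complex: the exterior
    derivative [D] raises the degree of the form on a cell, the signed trace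
    operator [T] lowers the dimension of the cell, and the distributional
    derivative is the differential of the total complex. It is filtered in two
    ways, by the cells of highest dimensions and by the cells of lowest
    dimensions, and these filtrations lead from the two ends of the chain of
    isomorphisms to its middle, where all cells that can occur do occur
    ([harm_C_H]).

    Two exactness properties drive the proof. The operator [D] is exact in
    positive degrees by the local exactness condition. The operator [T] is exact
    below the top dimension ([trace_sum_exact]): the traces of a cycle of [T] on a
    simplex [F], if all its traces on proper faces of [F] vanish, make up a
    simplicial cycle of the patch around [F] whose coefficients are forms on [F]
    with vanishing boundary traces. The local patch condition makes it a boundary
    ([patch_exact], [vector_exact]), and the extension operators of the geometric
    decomposition turn the bounding chain into a cochain whose image under [T]
    corrects the given cycle ([clear_traces]). Going through all simplices, faces
    first, exhausts the cycle.

    Exactness in one direction allows pushing a cycle of a level of the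
    corresponding filtration down by one level, modulo boundaries, and likewise
    for chains that bound. So consecutive levels have isomorphic homology
    ([level_iso]). Since the spaces are finite-dimensional, each homology class
    has exactly one harmonic representative, whatever the scalar product
    ([harmonic_iso_image]), and isomorphisms of homology become isomorphisms of
    harmonic spaces. At the lowest level of the filtration by lowest dimensions,
    the closed [0]-forms are locally constant, and there [T] is the relative
    simplicial boundary operator ([Tmap_constant], [homology_iso]).

    That the total differential squares to zero rests on three facts: exact forms
    are closed, which is part of local exactness; traces commute with exterior
    derivatives ([trace_dC]); and the simplicial boundary operator squares to
    zero ([incidence_sum0]). For the last one, with orientations given as
    alternating forms up to positive factors, the two outward vectors at the
    facets between a simplex and a face of codimension two are compared
    ([incidence_diamond]). *)

(** * Subspaces, quotients and orthogonal complements *)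

Section LinearAlgebraFacts.
Context {R : realType}.

Section Subspaces.
Variables (V : lmodType R) (S : set V).
Hypothesis subS : is_subspace S.

Lemma subspace0 : S 0. Proof. by case: subS. Qed.

Lemma subspaceZ (a : R) v : S v -> S (a *: v).
Proof. by move=> Sv; rewrite -[_ *: _]addr0; apply: subS.2 => //; case: subS. Qed.

Lemma subspaceD u v : S u -> S v -> S (u + v).
Proof. by move=> Su Sv; rewrite -[u]scale1r; apply: subS.2. Qed.

Lemma subspaceN v : S v -> S (- v).
Proof. by rewrite -scaleN1r; apply: subspaceZ. Qed.

Lemma subspaceB u v : S u -> S v -> S (u - v).
Proof. by move=> Su Sv; apply: subspaceD => //; apply: subspaceN. Qed.

Lemma subspace_sum I (r : seq I) (P : pred I) (F : I -> V) :
  (forall i, P i -> S (F i)) -> S (\sum_(i <- r | P i) F i).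
Proof. by move=> SF; apply: big_ind => //; [exact: subspace0|exact: subspaceD]. Qed.

Lemma in_vspan_subspace v : v \in in_vspan S <-> S v.
Proof.
split=> [/asboolP|Sv]; first by apply.
by apply/asboolP => W _; apply.
Qed.

Lemma proj_quot_eq0 v : proj_quot S v = 0 <-> S v.
Proof.
have -> : (0 : quotv S) = proj_quot S 0.
  by apply: (addrI (proj_quot S 0)); rewrite -proj_quotD !addr0.
by rewrite proj_quot_eq subr0 in_vspan_subspace.
Qed.

Lemma linear_on0 (W : lmodType R) (f : V -> W) : linear_on S f -> f 0 = 0.
Proof.
move=> fL; have := fL 1 0 0 subspace0 subspace0.
by rewrite !scale1r addr0 => /esym /(canRL (addrK _)); rewrite subrr.
Qed.

Lemma linear_onZ (W : lmodType R) (f : V -> W) a v :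
  linear_on S f -> S v -> f (a *: v) = a *: f v.
Proof.
move=> fL Sv; rewrite -[a *: v]addr0 fL ?(linear_on0 fL) ?addr0 //.
exact: subspace0.
Qed.

Lemma linear_onD (W : lmodType R) (f : V -> W) u v :
  linear_on S f -> S u -> S v -> f (u + v) = f u + f v.
Proof. by move=> fL Su Sv; rewrite -[u]scale1r fL // !scale1r. Qed.

Lemma linear_onB (W : lmodType R) (f : V -> W) u v :
  linear_on S f -> S u -> S v -> f (u - v) = f u - f v.
Proof.
move=> fL Su Sv; rewrite linear_onD //; last exact: subspaceN.
by rewrite -scaleN1r linear_onZ // scaleN1r.
Qed.

Lemma linear_on_sum (W : lmodType R) (f : V -> W) I (r : seq I) (P : pred I)
    (F : I -> V) : linear_on S f -> (forall i, P i -> S (F i)) ->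
  f (\sum_(i <- r | P i) F i) = \sum_(i <- r | P i) f (F i).
Proof.
move=> fL SF.
have [] : S (\sum_(i <- r | P i) F i) /\
  f (\sum_(i <- r | P i) F i) = \sum_(i <- r | P i) f (F i); last by [].
elim/big_rec2: _ => [|i x y Pi [Sy fE]].
  by split; [exact: subspace0|exact: linear_on0].
split; first by apply: subspaceD => //; exact: SF.
by rewrite linear_onD ?fE //; exact: SF.
Qed.

Lemma subspace_image (W : lmodType R) (f : V -> W) :
  linear_on S f -> is_subspace (f @` S).
Proof.
move=> fL; split; first by exists 0; [exact: subspace0|exact: linear_on0].
move=> a _ _ [u Su <-] [v Sv <-]; exists (a *: u + v); last exact: fL.
by apply: subS.2.
Qed.

Lemma subspace_preimage (W : lmodType R) (f : V -> W) (S' : set W) :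
  linear_on S f -> is_subspace S' -> is_subspace [set v | S v /\ S' (f v)].
Proof.
move=> fL S'sub; split.
  by split; [exact: subspace0|rewrite (linear_on0 fL); case: S'sub].
move=> a u v [Su S'u] [Sv S'v]; split; first exact: subS.2.
by rewrite fL //; apply: S'sub.2.
Qed.

End Subspaces.

Lemma linear_on_sub (V W : lmodType R) (S S' : set V) (f : V -> W) :
  S' `<=` S -> linear_on S f -> linear_on S' f.
Proof. by move=> SS fL a u v /SS Su /SS Sv; exact: fL. Qed.

Lemma subspace_set0 (V : lmodType R) : is_subspace [set (0 : V)].
Proof. by split=> // a u v -> ->; rewrite scaler0 addr0. Qed.

Lemma subspaceT (V : lmodType R) : is_subspace [set: V].
Proof. by []. Qed.

Lemma subspaceI (V : lmodType R) (S S' : set V) :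
  is_subspace S -> is_subspace S' -> is_subspace (S `&` S').
Proof.
move=> [S0 SD] [S'0 S'D]; split=> // a u v [? ?] [? ?].
by split; [exact: SD|exact: S'D].
Qed.

Lemma proj_quot_linear (V : lmodType R) (S S' : set V) :
  linear_on S' (proj_quot S).
Proof. by move=> a u v _ _; rewrite proj_quotD proj_quotZ. Qed.

Lemma lin_iso_sym (V W : lmodType R) (S : set V) (S' : set W) :
  is_subspace S -> lin_iso S S' -> lin_iso S' S.
Proof.
move=> Ssub [f [fL [fS fI fO]]].
pose g y := xget 0 [set x | S x /\ f x = y].
have gP y : S' y -> S (g y) /\ f (g y) = y.
  by move=> /fO [x Sx fx]; apply: (@xgetI _ 0 [set x | S x /\ f x = y] x).
have fK x x' : S x -> S x' -> f x = f x' -> x = x'.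
  by move=> Sx Sx'; apply: fI; apply/mem_set.
exists g; split=> [a u v S'u S'v|].
  have [Su fu] := gP _ S'u; have [Sv fv] := gP _ S'v.
  have Sg : S (a *: g u + g v) by apply: Ssub.2.
  have fE : f (a *: g u + g v) = a *: u + v by rewrite fL // fu fv.
  have [|Sw fw] := gP (a *: u + v); first by rewrite -fE; apply: fS.
  by apply: fK; rewrite // fw fE.
split=> [y /gP []//|y y' /set_mem S'y /set_mem S'y' gE|x Sx].
  by have [_ <-] := gP _ S'y; rewrite gE; have [] := gP _ S'y'.
exists (f x); first exact: fS.
have [Sg fg] : S (g (f x)) /\ f (g (f x)) = f x by apply: gP; exact: fS.
exact: fK.
Qed.

Lemma lin_iso_trans (V W X : lmodType R) (S : set V) (S' : set W)
    (S'' : set X) :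
  lin_iso S S' -> lin_iso S' S'' -> lin_iso S S''.
Proof.
move=> [f [fL [fS fI fO]]] [g [gL [gS gI gO]]]; exists (g \o f); split.
  by move=> a u v Su Sv; rewrite /= fL // gL //; apply: fS.
split=> [x Sx|x y Sx Sy /= gE|z /gO [y /fO [x Sx <-] <-]]; last by exists x.
- by apply: gS; apply: fS.
- by apply: fI => //; apply: gI => //; apply/mem_set; apply: fS; apply/set_mem.
Qed.

Fixpoint span_seq (V : lmodType R) (es : seq V) : set V :=
  if es is e :: es' then [set v | exists a : R, span_seq es' (v - a *: e)]
  else [set 0].

(** Finite dimensionality in a form that passes to subsets for trivial
    reasons. *)
Definition fin_spanned (V : lmodType R) (S : set V) : Prop :=
  exists es, S `<=` span_seq es.

Lemma fin_spannedS (V : lmodType R) (S S' : set V) :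
  S' `<=` S -> fin_spanned S -> fin_spanned S'.
Proof. by move=> S'S [es Ses]; exists es => v /S'S /Ses. Qed.

Lemma span_seq_sum (V : lmodType R) (I : Type) (e : I -> V) (a : I -> R)
    (r : seq I) :
  span_seq [seq e i | i <- r] (\sum_(i <- r) a i *: e i).
Proof.
elim: r => [|i r IH]; first by rewrite big_nil.
by rewrite big_cons; exists (a i); rewrite addrC addKr.
Qed.

Lemma fin_dim_spanned (V : lmodType R) (S : set V) :
  fin_dim S -> fin_spanned S.
Proof.
move=> [d [e ->]]; exists [seq e i | i <- index_enum 'I_d] => _ [a ->].
exact: span_seq_sum.
Qed.

Lemma fin_dim_subspace (V : lmodType R) (S : set V) :
  fin_dim S -> is_subspace S.
Proof.
move=> [d [e ->]]; split.
  by exists (fun=> 0); rewrite big1 // => i _; rewrite scale0r.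
move=> a _ _ [b ->] [c ->]; exists (fun i => a * b i + c i).
rewrite scaler_sumr -big_split; apply: eq_bigr => i _ /=.
by rewrite scalerA scalerDl.
Qed.

Lemma span_seq_cat (V : lmodType R) (es es' : seq V) u v :
  span_seq es u -> span_seq es' v -> span_seq (es ++ es') (u + v).
Proof.
elim: es u => [u -> |e es IH u [a ua] es'v]; first by rewrite add0r.
by exists a; rewrite addrAC; apply: IH.
Qed.

Lemma fin_spanned_sum (V : lmodType R) (I : Type) (r : seq I) (S : I -> set V) :
  (forall i, fin_spanned (S i)) ->
  fin_spanned [set v | exists2 e : I -> V, forall i, S i (e i)
                                         & v = \sum_(i <- r) e i].
Proof.
move=> Sfin; elim: r => [|i r [es IH]].
  by exists [::] => v [e _ ->]; rewrite big_nil.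
have [es' Ses'] := Sfin i; exists (es' ++ es) => v [e Se ->].
rewrite big_cons; apply: span_seq_cat; first exact: Ses'.
by apply: IH; exists e.
Qed.

Lemma fin_spanned_image (V W : lmodType R) (f : V -> W) (S : set V) :
  linear_on setT f -> fin_spanned S -> fin_spanned (f @` S).
Proof.
move=> fL [es Ses]; exists [seq f e | e <- es] => _ [v /Ses vS <-].
elim: es v vS {Ses} => [v ->|e es IH v [a vS]] /=.
  exact: (linear_on0 (subspaceT V) fL).
exists a; rewrite -(linear_onZ (subspaceT V)) //.
by rewrite -(linear_onB (subspaceT V)) //; exact: IH.
Qed.

(** Orthogonal projection onto a finite-dimensional space exists for an
    arbitrary scalar product: Gram-Schmidt, by induction on a spanning family.
    The spanning family need not lie in [B]; either no element of [B] involves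
    its first member, or one such element together with the elements of [B]
    spanned by the other members generates [B]. *)
Lemma orthogonal_projection (V : lmodType R) (S B : set V) sp :
  scalar_product S sp -> is_subspace S -> is_subspace B -> B `<=` S ->
  fin_spanned B ->
  forall w, S w -> exists2 b, B b & forall u, B u -> sp (w - b) u = 0.
Proof.
move=> [spC spL sppos] Ssub + + [es].
have sp0 w : S w -> sp w 0 = 0.
  move=> Sw; have S0 := subspace0 Ssub.
  have := spL 1 0 0 w S0 S0 Sw; rewrite scale1r addr0 mul1r spC //.
  by move/esym/(canRL (addrK _)); rewrite subrr.
have spDr a u v w : S u -> S v -> S w -> sp w (a *: u + v) = a * sp w u + sp w v.
  move=> Su Sv Sw; rewrite spC //; last by apply: Ssub.2.
  by rewrite spL // ![sp _ w]spC.
elim: es B => [|e es IH] B Bsub BS Bes w Sw.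
  exists 0; first exact: subspace0.
  by move=> u /Bes ->; rewrite subr0 sp0.
pose B' := B `&` span_seq es.
have spsub : is_subspace (span_seq es).
  elim: (es) => [|f fs [h0 hD]] /=; first exact: subspace_set0.
  split; first by exists 0; rewrite scale0r subr0.
  move=> a u v [b ub] [c vc]; exists (a * b + c).
  have -> : a *: u + v - (a * b + c) *: f = a *: (u - b *: f) + (v - c *: f).
    by rewrite scalerBr scalerA scalerDl opprD !addrA; congr (_ + _); rewrite addrAC.
  exact: hD.
have B'sub : is_subspace B' by apply: subspaceI.
have B'S : B' `<=` S by move=> v [/BS].
have {}IH := IH B' B'sub B'S (fun v => @proj2 _ _).
have [[w0 [Bw0 [a [a0 w0a]]]]|noB] :=
    pselect (exists w0, B w0 /\ exists a, a != 0 /\ span_seq es (w0 - a *: e));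
    last first.
  have [b [Bb _] bP] := IH w Sw.
  exists b => // u Bu; apply: bP; split => //.
  have [c uc] := Bes _ Bu; have [c0|/eqP c0] := pselect (c = 0).
    by move: uc; rewrite c0 scale0r subr0.
  by exfalso; apply: noB; exists u; split => //; exists c.
have [b0 [Bb0 sb0] b0P] := IH w0 (BS _ Bw0).
have [b [Bb sb] bP] := IH w Sw.
set f := w0 - b0; have Bf : B f by apply: subspaceB.
have Sf := BS _ Bf; have Swb : S (w - b) by apply: subspaceB => //; exact: BS.
pose c := sp (w - b) f / sp f f.
exists (b + c *: f); first by rewrite addrC; apply: Bsub.2.
move=> u Bu; have [d ud] := Bes _ Bu.
pose u' := u - (d / a) *: f.
have B'u' : B' u'.
  split; first by apply: subspaceB => //; apply: subspaceZ.
  have -> : u' = (u - d *: e) - (d / a) *: ((w0 - a *: e) - b0).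
    rewrite /u' /f !scalerBr scalerA divfK // [in RHS](addrAC (_ *: w0)).
    by rewrite [X in _ = _ + X]opprB addrA subrK.
  by apply: (subspaceB spsub) => //; apply: (subspaceZ spsub); apply: (subspaceB spsub).
have -> : u = (d / a) *: f + u' by rewrite addrC subrK.
have -> : w - (b + c *: f) = (- c) *: f + (w - b).
  by rewrite opprD addrA addrC scaleNr.
have Su' := B'S _ B'u'.
rewrite spDr // ?spL //; last by apply: Ssub.2.
rewrite (b0P u' B'u') (bP u' B'u') mulr0 !addr0.
have [f0|f0] := eqVneq f 0.
  by rewrite f0 !sp0 ?(mulr0, addr0) //; exact: subspace0.
have spff := sppos _ Sf f0.
by rewrite /c mulNr divfK ?gt_eqF // addNr mulr0.
Qed.

Definition harmonic (V : lmodType R) (sp : V -> V -> R) (K B : set V) : set V :=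
  [set w | K w /\ forall u, B u -> sp w u = 0].

(** Every class of [K / B] has exactly one harmonic representative, so the
    harmonic space is isomorphic to the image of [K] under any linear map that
    has kernel [B] on [K]. *)
Lemma harmonic_iso_image (V W : lmodType R) (S K B : set V) sp (f : V -> W) :
  scalar_product S sp -> is_subspace S ->
  is_subspace K -> is_subspace B -> B `<=` K -> K `<=` S -> fin_spanned B ->
  linear_on K f -> (forall x, K x -> f x = 0 <-> B x) ->
  lin_iso (harmonic sp K B) (f @` K).
Proof.
move=> spS Ssub Ksub Bsub BK KS Bfin fL fker.
have BS : B `<=` S by move=> v /BK /KS.
exists f; split; first by apply: linear_on_sub fL => w [].
split=> [w [Kw _]|w w' /set_mem [Kw wB] /set_mem [Kw' w'B] ff|]; first by exists w.
  have Kd : K (w - w') by apply: subspaceB.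
  have /(fker _ Kd) Bd : f (w - w') = 0 by rewrite (linear_onB Ksub) // ff subrr.
  apply/eqP; rewrite -subr_eq0; apply/negPn/negP => d0.
  have [_ spL sppos] := spS.
  have := sppos _ (KS _ Kd) d0.
  have -> : w - w' = (-1) *: w' + w by rewrite addrC scaleN1r.
  rewrite spL; [|exact: KS..|by rewrite addrC scaleN1r; exact: KS].
  have BE : B (-1 *: w' + w) by rewrite addrC scaleN1r.
  by rewrite wB // w'B // mulr0 addr0 ltxx.
move=> _ [w Kw <-].
have [b Bb bP] := orthogonal_projection spS Ssub Bsub BS Bfin (KS _ Kw).
have Kb := BK _ Bb.
exists (w - b); first by split => //; apply: subspaceB.
by rewrite (linear_onB Ksub) // (fker _ Kb).2 // subr0.
Qed.

Lemma subspace_harmonic (V : lmodType R) (S K B : set V) sp :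
  scalar_product S sp -> is_subspace K -> K `<=` S -> B `<=` S ->
  is_subspace (harmonic sp K B).
Proof.
move=> [spC spL _] Ksub KS BS; have K0 := subspace0 Ksub; split.
  split=> // u /BS Su; have := spL 1 0 0 u (KS _ K0) (KS _ K0) Su.
  by rewrite scale1r addr0 mul1r => /esym/(canRL (addrK _)); rewrite subrr.
move=> a u v [Ku uB] [Kv vB]; split; first exact: Ksub.2.
move=> x Bx; rewrite spL ?uB ?vB ?mulr0 ?addr0 //; last exact: BS.
all: exact: KS.
Qed.

(** An inclusion of cycle and boundary spaces that induces an isomorphism
    [K1 / B1 = K2 / B2] yields an isomorphism of harmonic spaces, also when
    these are taken with respect to unrelated scalar products. *)
Lemma harmonic_iso (V : lmodType R) (S1 S2 K1 K2 B1 B2 : set V) sp1 sp2 :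
  scalar_product S1 sp1 -> is_subspace S1 ->
  scalar_product S2 sp2 -> is_subspace S2 ->
  is_subspace K1 -> is_subspace B1 -> B1 `<=` K1 -> K1 `<=` S1 -> fin_spanned B1 ->
  is_subspace K2 -> is_subspace B2 -> B2 `<=` K2 -> K2 `<=` S2 -> fin_spanned B2 ->
  K1 `<=` K2 -> B1 `<=` B2 ->
  (forall x, K2 x -> exists2 y, B2 y & K1 (x - y)) ->
  (forall x, K1 x -> B2 x -> B1 x) ->
  lin_iso (harmonic sp1 K1 B1) (harmonic sp2 K2 B2).
Proof.
move=> spS1 S1sub spS2 S2sub K1sub B1sub BK1 KS1 B1f K2sub B2sub BK2 KS2 B2f
       K12 B12 onto inj.
have iso1 : lin_iso (harmonic sp1 K1 B1) (proj_quot B2 @` K1).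
  apply: harmonic_iso_image spS1 _ _ _ _ _ _ _ _ => //.
    exact: proj_quot_linear.
  move=> x K1x; rewrite proj_quot_eq0 //; split=> [|/B12 //].
  exact: inj.
have iso2 : lin_iso (harmonic sp2 K2 B2) (proj_quot B2 @` K2).
  apply: harmonic_iso_image spS2 _ _ _ _ _ _ _ _ => //.
    exact: proj_quot_linear.
  by move=> x K2x; rewrite proj_quot_eq0.
apply: lin_iso_trans iso1 _; have -> : proj_quot B2 @` K1 = proj_quot B2 @` K2.
  apply/seteqP; split=> _ [x Kx <-]; first by exists x => //; exact: K12.
  have [y B2y K1xy] := onto _ Kx; exists (x - y) => //.
  by apply/proj_quot_eq; rewrite addrC addKr; apply/in_vspan_subspace => //;
     apply: subspaceN.
apply: lin_iso_sym iso2; apply: (subspace_harmonic spS2) => //.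
by move=> x /BK2 /KS2.
Qed.

(** A filtered family of complexes, with [d q] raising both the degree [q] and
    the level [b] by one. If cycles modulo lower levels can be pushed down one
    level (the hypothesis [d_exact]), then consecutive levels have isomorphic
    harmonic spaces. At level [0] the chains are those of level [1] whose
    differential stays at level [1]. *)
Section Filtration.
Variables (V : lmodType R) (F : int -> nat -> set V) (d : int -> V -> V).
Hypothesis F_sub : forall q b, is_subspace (F q b).
Hypothesis F_fin : forall q b, fin_spanned (F q b).
Hypothesis F_mono : forall q b, F q b `<=` F q b.+1.
Hypothesis d_linear : forall q b, linear_on (F q b) (d q).
Hypothesis d_level : forall q b x, F q b x -> F (q + 1) b.+1 (d q x).
Hypothesis d_d : forall q b x, F q b x -> d (q + 1) (d q x) = 0.
Hypothesis d_exact : forall q b x, F q b.+2 x -> F (q + 1) b.+2 (d q x) ->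
  exists2 y, F (q - 1) b.+1 y & F q b.+1 (x - d (q - 1) y).

Definition level_chains q b : set V :=
  if b is b'.+1 then F q b else [set x | F q 1 x /\ F (q + 1) 1 (d q x)].

Definition level_cycles q b : set V := [set x | F q b x /\ d q x = 0].

Definition level_boundaries q b : set V := d (q - 1) @` level_chains (q - 1) b.

Lemma level_chains_sub q b : is_subspace (level_chains q b).
Proof.
case: b => [|b] /=; last exact: F_sub.
by have := subspace_preimage (F_sub q 1) (@d_linear q 1) (F_sub (q + 1) 1); apply.
Qed.

Lemma level_chains_linear q b : linear_on (level_chains q b) (d q).
Proof.
case: b => [|b] /=; last exact: d_linear.
by move=> a u v [Fu _] [Fv _]; apply: (@d_linear q 1).
Qed.

Lemma level_cycles_sub q b : is_subspace (level_cycles q b).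
Proof.
have := subspace_preimage (F_sub q b) (@d_linear q b) (subspace_set0 V).
by apply.
Qed.

Lemma level_boundaries_sub q b : is_subspace (level_boundaries q b).
Proof.
by apply: subspace_image; [exact: level_chains_sub|exact: level_chains_linear].
Qed.

Lemma level_boundaries_cycles q b : level_boundaries q b `<=` level_cycles q b.+1.
Proof.
move=> _ [x xF <-]; split.
  have := @d_level (q - 1) b x; rewrite subrK.
  case: b xF => [[_ dx] _|b xF]; last by apply.
  by move: dx; rewrite subrK.
by case: b xF => [[xF _]|b xF]; have := d_d xF; rewrite subrK.
Qed.

Lemma level_boundaries_fin q b : fin_spanned (level_boundaries q b).
Proof.
by apply: fin_spannedS (F_fin q b.+1) => x /level_boundaries_cycles [].
Qed.

Lemma level_iso q b sp1 sp2 :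
  scalar_product (F q b.+1) sp1 -> scalar_product (F q b.+2) sp2 ->
  lin_iso (harmonic sp1 (level_cycles q b.+1) (level_boundaries q b))
          (harmonic sp2 (level_cycles q b.+2) (level_boundaries q b.+1)).
Proof.
move=> sp1P sp2P.
apply: (harmonic_iso sp1P (F_sub _ _) sp2P (F_sub _ _)).
- exact: level_cycles_sub.
- exact: level_boundaries_sub.
- exact: level_boundaries_cycles.
- by move=> x [].
- exact: level_boundaries_fin.
- exact: level_cycles_sub.
- exact: level_boundaries_sub.
- exact: level_boundaries_cycles.
- by move=> x [].
- exact: level_boundaries_fin.
- by move=> x [xF dx]; split=> //; exact: F_mono.
- move=> _ [x xF <-]; exists x => //.
  by case: b xF {sp1P sp2P} => [[]//|b xF]; exact: F_mono.
- move=> x [xF dx].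
  have [|y yF xy] := d_exact xF; first by rewrite dx; exact: subspace0.
  exists (d (q - 1) y); first by exists y.
  split=> //; have := d_level yF; rewrite subrK => dyF.
  rewrite (linear_onB (F_sub q b.+2)) // dx; have := d_d yF; rewrite subrK => ->.
  by rewrite subrr.
- move=> x [xF dx] [y yF yx]; case: b xF yF {sp1P sp2P} => [|b] xF yF.
    by exists y => //; split=> //; rewrite subrK yx.
  have [|z zF yz] := d_exact yF; first by rewrite subrK yx.
  exists (y - d (q - 1 - 1) z) => //=.
  have := d_level zF; rewrite subrK => dzF.
  rewrite (linear_onB (F_sub (q - 1) b.+2)) // yx.
  by have := d_d zF; rewrite subrK => ->; rewrite subr0.
Qed.

Lemma level_harmonic_sub q b sp :
  scalar_product (F q b.+1) sp ->
  is_subspace (harmonic sp (level_cycles q b.+1) (level_boundaries q b)).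
Proof.
move=> spP; apply: (subspace_harmonic spP).
- exact: level_cycles_sub.
- by move=> x [].
- by move=> x /level_boundaries_cycles [].
Qed.

End Filtration.

End LinearAlgebraFacts.

(** * Orientations and incidence numbers *)

Section Alternating.
Context {R : realType} {n : nat}.
Implicit Types (E : set 'rV[R]_n) (f g : seq 'rV[R]_n -> R)
  (s t e : seq 'rV[R]_n) (k : int).

Lemma set_nth_size_cat s t (u v : 'rV[R]_n) :
  set_nth 0 (s ++ u :: t) (size s) v = s ++ v :: t.
Proof. by elim: s => //= x s ->. Qed.

Section AlternatingForm.
Variables (E : set 'rV[R]_n) (k : int) (f : seq 'rV[R]_n -> R).
Hypotheses (Esub : is_subspace E) (altf : alternating_on E k f).

Lemma alternating_linear s t (a : R) u v :
  (size (s ++ u :: t))%:Z = k ->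
  (forall x, x \in s ++ t -> E x) -> E u -> E v ->
  f (s ++ (a *: u + v) :: t) = a * f (s ++ u :: t) + f (s ++ v :: t).
Proof.
move=> sz stE Eu Ev.
have := altf.1 (s ++ u :: t) (size s) a u v sz.
rewrite !set_nth_size_cat; apply=> //; first by rewrite size_cat /= -addSnnS leq_addr.
move=> x; rewrite mem_cat inE => /or3P[xs|/eqP -> //|xt]; apply: stE;
  by rewrite mem_cat ?xs ?xt ?orbT.
Qed.

Lemma alternating_zero s t :
  (size (s ++ 0 :: t))%:Z = k -> (forall x, x \in s ++ t -> E x) ->
  f (s ++ 0 :: t) = 0.
Proof.
move=> sz stE; have E0 := subspace0 Esub.
have := alternating_linear (-1) sz stE E0 E0.
by rewrite scaler0 addr0 mulN1r addNr.
Qed.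

Lemma alternating_swap s x t y r :
  (size (s ++ x :: t ++ y :: r))%:Z = k ->
  (forall z, z \in s ++ x :: t ++ y :: r -> E z) ->
  f (s ++ x :: t ++ y :: r) = - f (s ++ y :: t ++ x :: r).
Proof.
move=> sz sE.
have mE z : z \in s ++ x :: y :: t ++ r -> E z.
  move=> zs; apply: sE; move: zs.
  by rewrite !(mem_cat, inE) => /or4P[->|->|->|/orP[->|->]]; rewrite ?orbT.
have Ex : E x by apply: mE; rewrite !(mem_cat, inE) eqxx !orbT.
have Ey : E y by apply: mE; rewrite !(mem_cat, inE) eqxx !orbT.
have szz u v : (size (s ++ u :: t ++ v :: r))%:Z = k.
  by move: sz; rewrite !(size_cat, size_cat, size_cat) /= !(size_cat) /=.
have [_ alt0] := altf.
have f0 u : E u -> f (s ++ u :: t ++ u :: r) = 0.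
  move=> Eu; apply: alt0; first exact: szz.
    move=> z; rewrite !(mem_cat, inE) => /or4P[zs|/eqP -> //|zt|/orP[/eqP -> //|zr]];
    by apply: mE; rewrite !(mem_cat, inE) ?zs ?zt ?zr ?orbT.
  by rewrite cat_uniq /= mem_cat inE eqxx orbT !andbF.
have stE u v : E u -> (forall z, z \in s ++ t ++ v :: r -> z = v \/ E z).
  move=> _ z; rewrite !(mem_cat, inE) => /or4P[zs|zt|/eqP|zr]; [right|right|by left|right];
  by apply: mE; rewrite !(mem_cat, inE) ?zs ?zt ?zr ?orbT.
have lin1 u v w : E u -> E v -> E w -> f (s ++ (u + v) :: t ++ w :: r) =
    f (s ++ u :: t ++ w :: r) + f (s ++ v :: t ++ w :: r).
  move=> Eu Ev Ew; have := @alternating_linear s (t ++ w :: r) 1 u v (szz u w).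
  rewrite scale1r mul1r; apply=> // z zs.
  by have [->|] := stE u w Eu z zs.
have lin2 u v w : E u -> E v -> E w -> f (s ++ w :: t ++ (u + v) :: r) =
    f (s ++ w :: t ++ u :: r) + f (s ++ w :: t ++ v :: r).
  move=> Eu Ev Ew; have := @alternating_linear (s ++ w :: t) r 1 u v.
  rewrite -!catA !cat_cons scale1r mul1r; apply=> // z.
  rewrite !(mem_cat, inE) => /or4P[zs|/eqP -> //|zt|zr];
  by apply: mE; rewrite !(mem_cat, inE) ?zs ?zt ?zr ?orbT.
have Exy : E (x + y) by apply: subspaceD.
have := f0 _ Exy; rewrite lin1 // !lin2 // f0 // f0 // add0r addr0 => /eqP.
by rewrite addr_eq0 => /eqP.
Qed.

End AlternatingForm.

Lemma alternating_cons E k f x :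
  E x -> alternating_on E k f -> alternating_on E (k - 1) (fun s => f (x :: s)).
Proof.
move=> Ex [lin alt]; split=> [s i a u v sz ilt sE Eu Ev|s sz sE nu].
  apply: (lin (x :: s) i.+1) => //; first by rewrite /= intS addrC sz subrK.
  by move=> z; rewrite inE => /orP[/eqP -> //|/sE].
apply: alt; first by rewrite /= intS addrC sz subrK.
  by move=> z; rewrite inE => /orP[/eqP -> //|/sE].
by rewrite /= negb_and nu orbT.
Qed.

Lemma alternating_sub E E' k f :
  E' `<=` E -> alternating_on E k f -> alternating_on E' k f.
Proof.
move=> EE [lin alt]; split=> [s i a u v sz ilt sE /EE Eu /EE Ev|s sz sE].
  by apply: lin => // x /sE /EE.
by apply: alt => // x /sE /EE.
Qed.

(** By induction on [e]: move its first member to the front of [s] by one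
    transposition, and contract with it. *)
Lemma alternating_perm E k f e s :
  is_subspace E -> alternating_on E k f ->
  (size e)%:Z = k -> (forall x, x \in e -> E x) ->
  perm_eq s e -> f e = 0 -> f s = 0.
Proof.
move=> Esub; elim: e k f s => [|e0 e IH] k f s altf sz eE se fe.
  by move/perm_nilP: se => ->.
have Ee0 : E e0 by apply: eE; rewrite inE eqxx.
have altf' := alternating_cons Ee0 altf.
have sz' : (size e)%:Z = k - 1 by rewrite -sz /= intS [1 + _]addrC addrK.
have eE' x : x \in e -> E x by move=> xe; apply: eE; rewrite inE xe orbT.
have e0s : e0 \in s by rewrite (perm_mem se) inE eqxx.
have fcons t : perm_eq (e0 :: t) (e0 :: e) -> f (e0 :: t) = 0.
  by rewrite perm_cons => /(IH _ _ _ altf' sz' eE'); apply.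
case/splitPr: e0s se => [[|x s1] s2] se; first exact: fcons.
have := @alternating_swap _ _ _ Esub altf [::] x s1 e0 s2.
rewrite /= => ->; last 2 first.
- by rewrite -sz -(perm_size se).
- by move=> z; rewrite -/((x :: s1) ++ e0 :: s2) (perm_mem se); apply: eE.
rewrite fcons ?oppr0 //; apply: perm_trans se.
rewrite -!cat_cons perm_sym perm_catC /= perm_cons /=.
rewrite perm_catC /= -cat1s -[x :: s2]cat1s perm_catCA /= .
by rewrite perm_refl.
Qed.

(** Expanding every argument in the spanning family [e] leaves terms that either
    have a repeated argument or permute [e]. *)
Lemma alternating_spanning_eq0 E k f e s :
  is_subspace E -> alternating_on E k f ->
  (size e)%:Z = k -> (forall x, x \in e -> E x) -> E `<=` span_seq e ->
  f e = 0 -> (size s)%:Z = k -> (forall x, x \in s -> E x) -> f s = 0.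
Proof.
move=> Esub altf sze eE Espan fe; have [_ alt0] := altf.
suff H s2 s1 : {subset s1 <= e} -> (forall x, x \in s2 -> E x) ->
    (size (s1 ++ s2))%:Z = k -> f (s1 ++ s2) = 0.
  by move=> szs sE; apply: (H s [::]).
elim: s2 s1 => [|v s2 IH] s1 s1e s2E sz.
  rewrite cats0; rewrite cats0 in sz.
  have [us|nus] := boolP (uniq s1); last by apply: alt0 => // x /s1e /eE.
  apply: (@alternating_perm E k f e) => //.
  have szle : (size e <= size s1)%N by move: sz; rewrite -sze => -[->].
  have [ee szE] := uniq_min_size us s1e szle.
  apply: uniq_perm => //.
  by rewrite -(eq_uniq ee szE).
have Es x : x \in s1 ++ s2 -> E x.
  by rewrite mem_cat => /orP[/s1e/eE //|xs]; apply: s2E; rewrite inE xs orbT.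
have Ev : E v by apply: s2E; rewrite inE eqxx.
suff H es w : {subset es <= e} -> E w -> span_seq es w -> f (s1 ++ w :: s2) = 0.
  by apply: (H e) => //; exact: Espan.
have szy y : (size (s1 ++ y :: s2))%:Z = k by move: sz; rewrite !size_cat.
elim: es w => [w _ _ ->|x es IHes w ese Ew [a wa]].
  exact: (alternating_zero Esub altf).
have xe : x \in e by apply: ese; rewrite inE eqxx.
have Ex := eE _ xe; have Ewx : E (w - a *: x).
  by apply: subspaceB => //; apply: subspaceZ.
have -> : w = a *: x + (w - a *: x) by rewrite addrC subrK.
rewrite (alternating_linear altf) //.
rewrite (IHes _ _ Ewx wa) => [|y ye]; last by apply: ese; rewrite inE ye orbT.
rewrite -cat_rcons IH ?mulr0 ?addr0 //.
- by move=> y; rewrite mem_rcons inE => /orP[/eqP -> //|/s1e].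
- by move=> y ys; apply: s2E; rewrite inE ys orbT.
- by rewrite cat_rcons.
Qed.

Lemma alternating_comb E k f g (c : R) :
  alternating_on E k f -> alternating_on E k g ->
  alternating_on E k (fun s => f s - c * g s).
Proof.
move=> [linf altf] [ling altg]; split=> [s i a u v sz ilt sE Eu Ev|s sz sE nu].
  by rewrite linf // ling //; ring.
by rewrite altf // altg // mulr0 subrr.
Qed.

(** Two orientations of a simplex are therefore proportional, which is what gives
    incidence numbers a meaning. *)
Lemma alternating_top_unique E k f g e :
  is_subspace E -> alternating_on E k f -> alternating_on E k g ->
  (size e)%:Z = k -> (forall x, x \in e -> E x) -> E `<=` span_seq e ->
  (exists s, [/\ (size s)%:Z = k, forall x, x \in s -> E x & g s != 0]) ->
  forall s, (size s)%:Z = k -> (forall x, x \in s -> E x) ->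
    f s = (f e / g e) * g s.
Proof.
move=> Esub altf altg sze eE Espan [s0 [sz0 s0E gs0]] s szs sE.
have ge0 : g e != 0.
  apply: contraNneq gs0 => ge0; apply/eqP.
  exact: (alternating_spanning_eq0 Esub altg sze eE Espan ge0).
have altc := alternating_comb (f e / g e) altf altg.
have he : f e - f e / g e * g e = 0 by rewrite divfK // subrr.
have /eqP := alternating_spanning_eq0 Esub altc sze eE Espan he szs sE.
by rewrite subr_eq0 => /eqP.
Qed.

End Alternating.

Section SimplexFacts.
Context {R : realType} {n : nat}.
Implicit Types (C F G : simplex R n) (M N : {fset simplex R n}).

Lemma sum_fsub (K : choiceType) (W : nmodType) (F C : {fset K}) (h : K -> W) :
  (F `<=` C)%fset ->
  \sum_(v <- F) h v = \sum_(v <- C) (if v \in F then h v else 0).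
Proof.
move=> FC; rewrite (eq_big_seq (fun v => if v \in F then h v else 0)).
  by apply: big_fset_incl => // v _ /negbTE ->.
by move=> v ->.
Qed.

Lemma sum_comb C (a : R) (w w' : 'rV[R]_n -> R) :
  \sum_(v <- C) (a * w v + w' v) *: v =
  a *: (\sum_(v <- C) w v *: v) + \sum_(v <- C) w' v *: v.
Proof.
rewrite scaler_sumr -big_split; apply: eq_bigr => v _.
by rewrite scalerDl scalerA.
Qed.

Lemma tangent_subspace C : is_subspace (tangent_space C).
Proof.
split; first by exists (fun=> 0); rewrite !big1 // => v _; rewrite scale0r.
move=> a _ _ [w [w0 ->]] [w' [w'0 ->]]; exists (fun v => a * w v + w' v).
by rewrite sum_comb big_split /= -mulr_sumr w0 w'0 mulr0 addr0.
Qed.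

Lemma tangent_spaceS F C : (F `<=` C)%fset -> tangent_space F `<=` tangent_space C.
Proof.
move=> FC _ [w [w0 ->]]; exists (fun v => if v \in F then w v else 0); split.
  by rewrite -sum_fsub.
rewrite (sum_fsub _ FC); apply: eq_bigr => v _.
by case: ifP => // _; rewrite scale0r.
Qed.

Lemma tangent_spanning C : C != fset0 ->
  exists e, [/\ (size e)%:Z = sdim C, forall x, x \in e -> tangent_space C x
    & tangent_space C `<=` span_seq e].
Proof.
move=> /fset0Pn [v0 v0C].
exists [seq v - v0 | v <- (C `\ v0)%fset]; split.
- by rewrite size_map /sdim (cardfsD1 v0 C) v0C add1n intS addrC addKr.
- move=> _ /mapP [v /[!inE] /andP[vv0 vC] ->].
  exists (fun u => (u == v)%:R - (u == v0)%:R); rewrite sumrB.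
  have sum1 u : u \in C -> \sum_(x <- C) (x == u)%:R = 1 :> R.
    move=> uC; rewrite (big_fsetD1 u) //= eqxx big_seq big1 ?addr0 // => x.
    by rewrite !inE => /andP[/negbTE ->].
  have sum2 u : u \in C -> \sum_(x <- C) (x == u)%:R *: x = u.
    move=> uC; rewrite (big_fsetD1 u) //= eqxx scale1r big_seq big1 ?addr0 // => x.
    by rewrite !inE => /andP[/negbTE -> _]; rewrite scale0r.
  rewrite !sum1 // subrr; split => //.
  under eq_bigr do rewrite scalerBl.
  by rewrite sumrB !sum2.
- move=> _ [w [w0 ->]].
  have -> : \sum_(v <- C) w v *: v = \sum_(v <- C) w v *: (v - v0).
    under [RHS]eq_bigr do rewrite scalerBr.
    by rewrite sumrB -scaler_suml w0 scale0r subr0.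
  rewrite (big_fsetD1 v0) //= subrr scaler0 add0r.
  exact: span_seq_sum.
Qed.

Lemma subsimplex_refl C : C != fset0 -> subsimplex C C.
Proof. by rewrite /subsimplex => ->; rewrite fsubset_refl. Qed.

Lemma subsimplex_trans F G C :
  subsimplex F G -> subsimplex G C -> subsimplex F C.
Proof.
move=> /andP[F0 FG] /andP[_ GC]; rewrite /subsimplex F0.
exact: fsubset_trans FG GC.
Qed.

Lemma facetP G C : psubsimplex G C -> sdim G = sdim C - 1 ->
  exists2 a, a \in C & G = (C `\ a)%fset.
Proof.
move=> /andP[/andP[G0 GC] _]; rewrite /sdim => /(addIr _) GE.
have c1 : #|` (C `\` G)%fset| == 1%N by rewrite cardfsDS //; apply/eqP; lia.
have /cardfs1P [a CG] := c1.
have aCG : a \in (C `\` G)%fset by rewrite CG inE.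
exists a; first by move: aCG; rewrite inE => /andP[].
by rewrite -CG fsetDK.
Qed.

Lemma facetI a C : a \in C -> (C `\ a)%fset != fset0 ->
  psubsimplex (C `\ a)%fset C /\ sdim (C `\ a)%fset = sdim C - 1.
Proof.
move=> aC Ca0; split; last by rewrite /sdim (cardfsD1 a C) aC add1n; lia.
rewrite /psubsimplex /subsimplex Ca0 fsubsetDl /=.
by apply/eqP => /fsetP /(_ a); rewrite !inE eqxx aC.
Qed.

Lemma card_natr_neq0 C : C != fset0 -> (#|` C|)%:R != 0 :> R.
Proof. by rewrite -cardfs_gt0 lt0n pnatr_eq0. Qed.

Lemma sum_const_fset C (a : R) : \sum_(v <- C) a = (#|` C|)%:R * a.
Proof. by rewrite big_const_seq count_predT iter_addr_0 mulr_natl. Qed.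

Lemma barycenterE C : barycenter C = \sum_(v <- C) (#|` C|)%:R^-1 *: v.
Proof. by rewrite /barycenter scaler_sumr. Qed.

Let outward_weight G C v : R := (if v \in G then (#|` G|)%:R^-1 else 0) - (#|` C|)%:R^-1.

Lemma outward_weights G C : (G `<=` C)%fset -> G != fset0 ->
  \sum_(v <- C) outward_weight G C v = 0 /\
  barycenter G - barycenter C = \sum_(v <- C) outward_weight G C v *: v.
Proof.
move=> GC G0.
have C0 : C != fset0.
  by apply: contra_neq G0 => C0; apply/eqP; rewrite -fsubset0 -C0.
split.
  rewrite sumrB -sum_fsub // !sum_const_fset !divff ?subrr //; exact: card_natr_neq0.
rewrite !barycenterE (sum_fsub _ GC) -sumrB; apply: eq_bigr => v _.
by rewrite /outward_weight; case: ifP => _; rewrite scalerBl ?scale0r.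
Qed.

Lemma outward_tangent G C : (G `<=` C)%fset -> G != fset0 ->
  tangent_space C (barycenter G - barycenter C).
Proof. by move=> GC G0; have [? ?] := outward_weights GC G0; exists (outward_weight G C). Qed.

Lemma outward_spanning a C (e : seq 'rV[R]_n) :
  a \in C -> (C `\ a)%fset != fset0 ->
  tangent_space (C `\ a)%fset `<=` span_seq e ->
  tangent_space C `<=`
    span_seq (barycenter (C `\ a)%fset - barycenter C :: e).
Proof.
move=> aC; set G := (C `\ a)%fset => G0 Ge _ [w [w0 ->]].
have GC : (G `<=` C)%fset by apply/fsubsetP => x; rewrite !inE => /andP[].
have [s0 sE] := outward_weights GC G0.
exists (- (#|` C|)%:R * w a); apply: Ge; rewrite sE.
exists (fun v => (#|` C|)%:R * w a * outward_weight G C v + w v); split; last first.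
  rewrite mulNr scaleNr opprK addrC -sum_comb.
  rewrite (big_fsetD1 a) //= /outward_weight !inE eqxx /= sub0r mulrN mulrAC.
  rewrite divff ?mul1r ?addNr ?scale0r ?add0r //; apply: card_natr_neq0.
  by apply/fset0Pn; exists a.
have : \sum_(v <- C) ((#|` C|)%:R * w a * outward_weight G C v + w v) = 0.
  by rewrite big_split /= -mulr_sumr s0 w0 mulr0 addr0.
rewrite (big_fsetD1 a) //= {1}/outward_weight !inE eqxx /= sub0r mulrN mulrAC.
rewrite divff ?mul1r ?addNr ?add0r //; apply: card_natr_neq0.
by apply/fset0Pn; exists a.
Qed.

Variable ori : simplex R n -> seq 'rV[R]_n -> R.

(** The outward vector at [G] and a family that spans the tangent space of [G]
    together span the tangent space of [C], so contraction with this vector does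
    not kill the orientation of [C]. It gives a form of top degree on [G], which
    is proportional to the orientation of [G]; the incidence number is the sign
    of the factor. *)
Lemma incidenceP G C : psubsimplex G C -> sdim G = sdim C - 1 ->
  orients (ori C) C -> orients (ori G) G ->
  exists c : R, [/\ c != 0, incidence ori G C = Num.sg c &
    forall s, (size s)%:Z = sdim G -> (forall x, x \in s -> tangent_space G x) ->
      ori C (barycenter G - barycenter C :: s) = c * ori G s].
Proof.
move=> GC dG [altC [sC [szC sCE fC0]]] [altG [sG [szG sGE fG0]]].
have /andP[/andP[G0 GCs] _] := GC.
have [e [sze eE espan]] := tangent_spanning G0.
set x := barycenter G - barycenter C.
have Tx : tangent_space C x by apply: outward_tangent.
have altx : alternating_on (tangent_space G) (sdim G) (fun s => ori C (x :: s)).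
  rewrite dG; apply: alternating_sub (alternating_cons Tx altC).
  exact: tangent_spaceS.
have uniq := alternating_top_unique (tangent_subspace G) altx altG sze eE espan
  (ex_intro _ sG (And3 szG sGE fG0)).
have fe0 : ori C (x :: e) != 0.
  apply: contraNneq fC0 => fe; apply/eqP.
  apply: (alternating_spanning_eq0 (tangent_subspace C) altC _ _ _ fe) => //.
  - by rewrite /= intS sze dG addrC subrK.
  - by move=> y; rewrite inE => /orP[/eqP -> //|/eE]; apply: tangent_spaceS.
  - have [a aC GE] := facetP GC dG.
    by rewrite /x GE; apply: outward_spanning; rewrite -?GE.
have ge0 : ori G e != 0.
  apply: contraNneq fG0 => ge; apply/eqP.
  exact: (alternating_spanning_eq0 (tangent_subspace G) altG sze eE espan ge).
move: uniq => /=; set c := ori C (x :: e) / ori G e => uniq.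
have c0 : c != 0 by rewrite mulf_neq0 ?invr_neq0.
exists c; split => //.
rewrite /incidence; case: asboolP => [[b b_gt0 bE]|no].
  have := bE sG szG sGE; rewrite /induced_orientation uniq //.
  move/(congr1 (fun z => z / ori G sG)); rewrite !mulfK // => ->.
  by rewrite gtr0_sg.
have [cpos|cneg|c00] := ltgtP 0 c.
- by exfalso; apply: no; exists c.
- by rewrite ltr0_sg.
- by rewrite -c00 eqxx in c0.
Qed.

Lemma weights_eq (N bA bB bC bF a b : R) :
  (N + 1) * bA = b + N * bF -> (N + 1) * bB = a + N * bF ->
  (N + 1 + 1) * bC = a + (b + N * bF) ->
  (N + 1) * (bA - bC + (bB - bC)) = N * (bF - bC).
Proof. lra. Qed.

(** Let [x] and [x'] be the outward vectors of [C] at its two facets, and let [z]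
    point from [C] to the common face [F]. Passing to [F] through one of the
    facets contracts the orientation of [C] with [x] and [z], through the other
    one with [x'] and [z]. Since [x + x'] is a multiple of [z], the results are
    opposite. *)
Lemma incidence_diamond C a b : a \in C -> b \in C -> a != b ->
  (C `\ a `\ b)%fset != fset0 ->
  orients (ori C) C -> orients (ori (C `\ a)%fset) (C `\ a)%fset ->
  orients (ori (C `\ b)%fset) (C `\ b)%fset ->
  orients (ori (C `\ a `\ b)%fset) (C `\ a `\ b)%fset ->
  incidence ori (C `\ a `\ b)%fset (C `\ a)%fset * incidence ori (C `\ a)%fset C
  + incidence ori (C `\ a `\ b)%fset (C `\ b)%fset * incidence ori (C `\ b)%fset C
  = 0.
Proof.
move=> aC bC ab F0 oC oA oB oF.
have FE : (C `\ a `\ b = C `\ b `\ a)%fset by rewrite fsetDDl fsetUC -fsetDDl.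
set F := (C `\ a `\ b)%fset in FE F0 oF *; set A := (C `\ a)%fset in oA *.
set B := (C `\ b)%fset in oB FE *.
have bA : b \in A by rewrite !inE eq_sym ab bC.
have aB : a \in B by rewrite !inE ab aC.
have FA : (F `<=` A)%fset by apply: fsubsetDl.
have AC : (A `<=` C)%fset by apply: fsubsetDl.
have FB : (F `<=` B)%fset by rewrite FE; apply: fsubsetDl.
have BC : (B `<=` C)%fset by apply: fsubsetDl.
have A0 : A != fset0 by apply/fset0Pn; exists b.
have B0 : B != fset0 by apply/fset0Pn; exists a.
have [pA dA] : psubsimplex A C /\ sdim A = sdim C - 1 by apply: facetI.
have [pB dB] : psubsimplex B C /\ sdim B = sdim C - 1 by apply: facetI.
have [pFA dFA] : psubsimplex F A /\ sdim F = sdim A - 1 by apply: facetI.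
have [pFB dFB] : psubsimplex F B /\ sdim F = sdim B - 1.
  by rewrite FE; apply: facetI; rewrite -?FE.
have FAE : F = (A `\ b)%fset by [].
have AE : A = (C `\ a)%fset by [].
clearbody F A B.
have [cA [cA0 -> cAE]] := incidenceP pA dA oC oA.
have [cB [cB0 -> cBE]] := incidenceP pB dB oC oB.
have [cFA [cFA0 -> cFAE]] := incidenceP pFA dFA oA oF.
have [cFB [cFB0 -> cFBE]] := incidenceP pFB dFB oB oF.
have [_ [s [szs sF fs0]]] := oF; have [altC _] := oC.
set x := barycenter A - barycenter C in cAE.
set x' := barycenter B - barycenter C in cBE.
set y := barycenter F - barycenter A in cFAE.
set y' := barycenter F - barycenter B in cFBE.
pose z := barycenter F - barycenter C.
have Tsub := tangent_subspace C.
have FC : (F `<=` C)%fset by apply: fsubset_trans AC.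
have Tx : tangent_space C x by apply: outward_tangent.
have Tx' : tangent_space C x' by apply: outward_tangent.
have Tz : tangent_space C z by apply: outward_tangent.
have Ty : tangent_space A y by apply: outward_tangent.
have Ty' : tangent_space B y' by apply: outward_tangent.
have sC t : t \in s -> tangent_space C t by move=> /sF; apply: tangent_spaceS.
have szC u v : (size (u :: v :: s))%:Z = sdim C.
  by rewrite /= !intS szs dFA dA; ring.
have sC2 u : tangent_space C u -> forall t, t \in u :: s -> tangent_space C t.
  by move=> Tu t; rewrite inE => /orP[/eqP -> //|/sC].
have fuu u : tangent_space C u -> ori C (u :: u :: s) = 0.
  move=> Tu; apply: altC.2; [exact: szC| |by rewrite /= inE eqxx].
  by move=> t; rewrite inE => /orP[/eqP -> //|]; apply: sC2.
have fyz u v : tangent_space C u -> tangent_space C v ->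
    ori C (u :: (v - u) :: s) = ori C (u :: v :: s).
  move=> Tu Tv.
  have := @alternating_linear _ _ _ _ _ altC [:: u] s (-1) u v (szC _ _) (sC2 _ Tu) Tu Tv.
  by rewrite /= fuu // scaleN1r addrC mulr0 add0r.
have EA : ori C (x :: z :: s) = cA * cFA * ori F s.
  have yE : y = z - x by rewrite /y /z /x; rewrite opprB addrA subrK.
  rewrite -fyz // -yE cAE ?cFAE ?mulrA //.
    by rewrite /= intS szs dFA; ring.
  move=> t; rewrite inE => /orP[/eqP -> //|/sF]; exact: tangent_spaceS.
have EB : ori C (x' :: z :: s) = cB * cFB * ori F s.
  have yE : y' = z - x' by rewrite /y' /z /x'; rewrite opprB addrA subrK.
  rewrite -fyz // -yE cBE ?cFBE ?mulrA //.
    by rewrite /= intS szs dFB; ring.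
  move=> t; rewrite inE => /orP[/eqP -> //|/sF]; exact: tangent_spaceS.
have [c xx'] : exists c, x + x' = c *: z.
  have cF : (#|` F|)%:R != 0 :> R by apply: card_natr_neq0.
  have bary (D : simplex R n) : D != fset0 -> (#|` D|)%:R *: barycenter D = \sum_(v <- D) v.
    by move=> D0; rewrite /barycenter scalerA divff ?scale1r //; apply: card_natr_neq0.
  have nA : #|` A| = #|` F|.+1 by rewrite (cardfsD1 b A) bA -FAE.
  have nB : #|` B| = #|` F|.+1 by rewrite (cardfsD1 a B) aB -FE.
  have nC : #|` C| = #|` F|.+2 by rewrite (cardfsD1 a C) aC -AE nA.
  have C0 : C != fset0 by apply/fset0Pn; exists a.
  have bA' := bary A A0; have bB' := bary B B0.
  have bC' := bary C C0; have bF' := bary F F0.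
  have sA : \sum_(v <- A) v = b + \sum_(v <- F) v by rewrite (big_fsetD1 b) //= -FAE.
  have sB : \sum_(v <- B) v = a + \sum_(v <- F) v by rewrite (big_fsetD1 a) //= -FE.
  have sC' : \sum_(v <- C) v = a + \sum_(v <- A) v by rewrite (big_fsetD1 a) //= -AE.
  rewrite -bF' in sA sB; rewrite -bA' in sC' sA; rewrite -bB' in sB; rewrite -bC' in sC'.
  rewrite sA nC in sC'; rewrite nA in sA; rewrite nB in sB.
  move: (cF) sA sB sC'; rewrite -natr1 -[_.+2%:R]natr1 -natr1.
  have : 0 <= #|` F|%:R :> R by apply: ler0n.
  move: (#|` F|%:R : R) => N N0 cN sA sB sC'.
  have N1 : N + 1 != 0 by rewrite gt_eqF // ltr_wpDl.
  exists (N / (N + 1)); apply: (scalerI N1); rewrite scalerA mulrCA divff // mulr1.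
  apply/matrixP => i j.
  move/matrixP: sA => /(_ i j); move/matrixP: sB => /(_ i j).
  move/matrixP: sC' => /(_ i j); rewrite /x /x' /z !mxE.
  by move=> eC eB eA; apply: weights_eq eA eB eC.
have fz0 u : tangent_space C u -> ori C (0 :: u :: s) = 0.
  move=> Tu; exact: (alternating_zero Tsub altC (s := [::]) (szC 0 u) (sC2 u Tu)).
have lin1 d u v : tangent_space C u -> tangent_space C v ->
    ori C ((d *: u + v) :: z :: s) = d * ori C (u :: z :: s) + ori C (v :: z :: s).
  move=> Tu Tv.
  exact: (@alternating_linear _ _ _ _ _ altC [::] (z :: s) d u v (szC _ _) (sC2 _ Tz) Tu Tv).
have E0 : cA * cFA = - (cB * cFB).
  apply: (mulIf fs0); rewrite mulNr -EA -EB; apply/eqP; rewrite -addr_eq0.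
  rewrite -[X in X + _]mul1r -lin1 // scale1r xx' -[c *: z]addr0 lin1 //.
    by rewrite fuu // fz0 // mulr0 addr0.
  exact: subspace0.
rewrite -!sgrM [cFA * _]mulrC E0 sgrN [cFB * _]mulrC; exact: addNr.
Qed.

Lemma psubsimplexE F C : psubsimplex F C -> subsimplex F C.
Proof. by case/andP. Qed.

(** Exactly two simplices lie between a simplex and a face of codimension two;
    this is why boundaries of boundaries vanish. *)
Lemma incidence_sum0 M F C (m : int) :
  (forall D, D \in M -> orients (ori D) D) ->
  (forall D E, D \in M -> subsimplex E D -> E \in M) ->
  C \in M -> sdim C = m -> sdim F = m - 1 - 1 ->
  \sum_(G <- M | [&& sdim G == m - 1, psubsimplex F G & psubsimplex G C])
    incidence ori F G * incidence ori G C = 0.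
Proof.
move=> oM Mclosed CM dC dF.
have [FC|nFC] := boolP (subsimplex F C); last first.
  rewrite big1 // => G /and3P[_ /psubsimplexE FG /psubsimplexE GC].
  by case/negP: nFC; apply: subsimplex_trans FG GC.
have /andP[F0 FsC] := FC.
have /fset0Pn [a aCF] : (C `\` F)%fset != fset0.
  rewrite -cardfs_gt0 cardfsDS // subn_gt0; move: dC dF; rewrite /sdim; lia.
have c1 : #|` ((C `\` F) `\ a)%fset| == 1%N.
  have := cardfsD1 a (C `\` F)%fset; rewrite aCF cardfsDS //.
  by move: dC dF; rewrite /sdim => dC dF H; apply/eqP; lia.
have /cardfs1P [b CFa] := c1.
have : b \in ((C `\` F) `\ a)%fset by rewrite CFa inE.
rewrite !inE eq_sym => /and3P[ab bF bC].
move: aCF; rewrite !inE => /andP[aF aC].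
have CE x : x \in C -> [|| x == a, x == b | x \in F].
  move=> xC; have [//|xa] := eqVneq x a; have [|xF] := boolP (x \in F); rewrite ?orbT //.
  by have : x \in ((C `\` F) `\ a)%fset; [rewrite !inE xa xF|rewrite CFa inE orbF].
have FE : F = (C `\ a `\ b)%fset.
  apply/fsetP => x; rewrite !inE; apply/idP/and3P => [xF|[xb xa /CE]].
    split; [by apply: contraNneq bF => <-|by apply: contraNneq aF => <-|].
    exact: (fsubsetP FsC).
  by rewrite (negbTE xb) (negbTE xa).
have bA : b \in (C `\ a)%fset by rewrite !inE eq_sym ab bC.
have aB : a \in (C `\ b)%fset by rewrite !inE ab aC.
have A0 : (C `\ a)%fset != fset0 by apply/fset0Pn; exists b.
have B0 : (C `\ b)%fset != fset0 by apply/fset0Pn; exists a.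
have [pA dA] := facetI aC A0; have [pB dB] := facetI bC B0.
have FE' : F = (C `\ b `\ a)%fset by rewrite FE fsetDDl fsetUC -fsetDDl.
have pFA : psubsimplex F (C `\ a)%fset by have [] := facetI bA; rewrite -FE.
have pFB : psubsimplex F (C `\ b)%fset by have [] := facetI aB; rewrite -FE'.
have AM : (C `\ a)%fset \in M by apply: Mclosed (psubsimplexE pA).
have BM : (C `\ b)%fset \in M by apply: Mclosed (psubsimplexE pB).
have FM : F \in M by apply: Mclosed FC.
have AB : (C `\ a)%fset != (C `\ b)%fset.
  by apply: contraTneq aB => <-; rewrite !inE eqxx.
rewrite big_mkcond (bigD1_seq (C `\ a)%fset) ?fset_uniq //= big_mkcond.
rewrite (bigD1_seq (C `\ b)%fset) ?fset_uniq //= big1_seq => [|G /andP[GB _]]; last first.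
  case: ifP => // GA; case: ifP => // /and3P[/eqP dG pFG pGC].
  exfalso.
  have [|c cC GE] := facetP pGC; first by rewrite dG dC.
  have cF : c \notin F.
    apply/negP => cF; have /andP[/andP[_ /fsubsetP /(_ _ cF)]] := pFG.
    by rewrite GE !inE eqxx.
  have := CE _ cC; rewrite (negbTE cF) orbF => /orP[/eqP|/eqP] cE.
    by rewrite GE cE eqxx in GA.
  by rewrite GE cE eqxx in GB.
rewrite [(C `\ b)%fset == _]eq_sym AB dA dB dC eqxx pFA pFB pA pB /= addr0 FE.
by apply: incidence_diamond; rewrite -?FE //; apply: oM.
Qed.

End SimplexFacts.

(** * Exterior derivative and traces *)

Section Forms.
Context {R : realType} {n : nat}.
Implicit Types (C F G : simplex R n) (w e : dform R n) (k : int).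

Lemma hullS F C : (F `<=` C)%fset -> hull F `<=` hull C.
Proof.
move=> FC _ [w [w0 w1 ->]]; exists (fun v => if v \in F then w v else 0); split.
- by move=> v _; case: ifP => // /w0.
- by rewrite -sum_fsub.
- rewrite (sum_fsub _ FC); apply: eq_bigr => v _.
  by case: ifP => // _; rewrite scale0r.
Qed.

Lemma hull_vertex C u : u \in C -> hull C u.
Proof.
move=> uC; exists (fun v => (v == u)%:R); split=> //.
  rewrite (big_fsetD1 u) //= eqxx big_seq big1 ?addr0 // => x.
  by rewrite !inE => /andP[/negbTE ->].
rewrite (big_fsetD1 u) //= eqxx scale1r big_seq big1 ?addr0 // => x.
by rewrite !inE => /andP[/negbTE -> _]; rewrite scale0r.
Qed.

Lemma hull_convex C x y (h : R) : hull C x -> hull C y -> 0 <= h <= 1 ->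
  hull C (x + h *: (y - x)).
Proof.
move=> [w [w0 w1 ->]] [w' [w'0 w'1 ->]] /andP[h0 h1].
exists (fun v => h * w' v + (1 - h) * w v); split.
- by move=> v vC; rewrite addr_ge0 // mulr_ge0 ?subr_ge0 ?w0 ?w'0.
- by rewrite big_split /= -!mulr_sumr w1 w'1 !mulr1 addrC subrK.
- rewrite sum_comb; under [X in _ = _ + X]eq_bigr do rewrite -scalerA.
  by rewrite -scaler_sumr scalerBr scalerBl scale1r addrCA.
Qed.

Lemma restrict_formP C (a : R) w w' :
  restrict_form C (a *: w + w') = a *: restrict_form C w + restrict_form C w'.
Proof.
apply/funext => x; apply/funext => s; rewrite /restrict_form.
transitivity (a * restrict_form C w x s + restrict_form C w' x s) => //.
by rewrite /restrict_form; case: asboolP => // _; rewrite mulr0 addr0.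
Qed.

Lemma restrict_form0 C : restrict_form C (0 : dform R n) = 0.
Proof. by have := restrict_formP C (-1) 0 0; rewrite scaler0 addr0 scaleN1r addNr. Qed.

Lemma restrict_formZ C (a : R) w : restrict_form C (a *: w) = a *: restrict_form C w.
Proof. by rewrite -[a *: w]addr0 restrict_formP restrict_form0 addr0. Qed.

Lemma restrict_formD C w w' :
  restrict_form C (w + w') = restrict_form C w + restrict_form C w'.
Proof. by rewrite -[w]scale1r restrict_formP !scale1r. Qed.

Lemma restrict_formB C w w' :
  restrict_form C (w - w') = restrict_form C w - restrict_form C w'.
Proof. by rewrite restrict_formD -scaleN1r restrict_formZ scaleN1r. Qed.

Lemma restrict_form_sum C I (r : seq I) (P : pred I) (h : I -> dform R n) :
  restrict_form C (\sum_(i <- r | P i) h i) =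
  \sum_(i <- r | P i) restrict_form C (h i).
Proof.
by apply: big_morph; [exact: restrict_formD|exact: restrict_form0].
Qed.

Lemma restrict_form_sub F C w : (F `<=` C)%fset ->
  restrict_form F (restrict_form C w) = restrict_form F w.
Proof.
move=> FC; apply/funext => x; apply/funext => s; rewrite /restrict_form.
case: asboolP => // -[Fx sF]; case: asboolP => // -[]; split; first exact: hullS Fx.
by move=> v /sF; apply: tangent_spaceS.
Qed.

(** Even at the relative boundary, tangent vectors are combinations of vectors
    that point into the simplex, and in such directions the one-sided difference
    quotients vanish. *)
Lemma derive_vanishing_on_hull F (f : 'rV[R]_n -> R) x v :
  (forall y, differentiable f y) -> (forall y, hull F y -> f y = 0) ->
  hull F x -> tangent_space F v -> 'D_v f x = 0.
Proof.
move=> fdiff f0 Fx.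
have inward y : hull F y -> 'D_(y - x) f x = 0.
  move=> Fy; rewrite /derive cvg_at_rightE; last exact: diff_derivable.
  apply: cvg_lim => //; apply: cvg_near_cst.
  near=> h; rewrite /= f0; first by rewrite f0 // subrr scaler0.
  rewrite addrC; apply: hull_convex => //; apply/andP; split; near: h.
    by apply: nbhs_right_ge.
  by apply: nbhs_right_le.
move=> [w [w0 ->]].
have -> : \sum_(u <- F) w u *: u = \sum_(u <- F) w u *: (u - x).
  under [RHS]eq_bigr do rewrite scalerBr.
  by rewrite sumrB -scaler_suml w0 scale0r subr0.
rewrite deriveE // linear_sum big_seq big1 // => u uF.
by rewrite linearZ /= -deriveE // inward ?scaler0 //; apply: hull_vertex.
Unshelve. all: by end_near.
Qed.

Definition differentiable_form (e : dform R n) : Prop :=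
  forall s y, differentiable (fun x => e x s : R) y.

Lemma smooth_form_differentiable k e : smooth_form k e -> differentiable_form e.
Proof. by move=> [_ _ es] s y; apply: (es s [::] y). Qed.

Lemma ext_derivP (a : R) e e' : differentiable_form e -> differentiable_form e' ->
  ext_deriv (a *: e + e') = a *: ext_deriv e + ext_deriv e'.
Proof.
move=> de de'; apply/funext => x; apply/funext => s.
transitivity (a * ext_deriv e x s + ext_deriv e' x s) => //.
rewrite /ext_deriv mulr_sumr -big_split /=; apply: eq_bigr => i _.
rewrite mulrCA -mulrDr; congr (_ * _).
set t := take _ _ ++ _.
have -> : (fun y => (a *: e + e') y t : R) =
  (a \*: (fun y => e y t : R)) + (fun y => e' y t : R) by [].
have d1 := diff_derivable (de t x); have d2 := diff_derivable (de' t x).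
by rewrite deriveD ?deriveZ //; apply: derivableZ.
Qed.

Lemma differentiable_formP (a : R) e e' :
  differentiable_form e -> differentiable_form e' ->
  differentiable_form (a *: e + e').
Proof.
move=> de de' s y.
have -> : (fun y => (a *: e + e') y s : R) =
  (a \*: (fun y => e y s : R)) + (fun y => e' y s : R) by [].
by apply: differentiableD => //; apply: differentiableZ.
Qed.

Lemma ext_deriv_restrict0 F e : differentiable_form e ->
  restrict_form F e = 0 -> restrict_form F (ext_deriv e) = 0.
Proof.
move=> de eF; apply/funext => x; apply/funext => s; rewrite /restrict_form.
case: asboolP => // -[Fx sF]; rewrite /ext_deriv big1 // => i _.
rewrite (derive_vanishing_on_hull (F := F)) ?mulr0 //.
  move=> y Fy; have := congr1 (fun h => h y (take i s ++ drop i.+1 s)) eF.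
  rewrite /restrict_form asboolT // ; split => // v.
  by rewrite mem_cat => /orP[/mem_take|/mem_drop]; apply: sF.
by apply: sF; rewrite mem_nth.
Qed.

(** This makes the exterior derivative of a form on a simplex independent of the
    smooth extension by which it is computed. *)
Lemma ext_deriv_restrict F e e' : differentiable_form e -> differentiable_form e' ->
  restrict_form F e = restrict_form F e' ->
  restrict_form F (ext_deriv e) = restrict_form F (ext_deriv e').
Proof.
move=> de de' ee; apply/eqP; rewrite -subr_eq0 -restrict_formB.
have -> : ext_deriv e - ext_deriv e' = ext_deriv (e - e').
  by have := ext_derivP (-1) de' de; rewrite !scaleN1r addrC => ->; rewrite addrC.
apply/eqP; apply: ext_deriv_restrict0; last by rewrite restrict_formB ee subrr.
by have := differentiable_formP (-1) de' de; rewrite scaleN1r addrC.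
Qed.

Lemma dC_extension k F e : smooth_form k e ->
  dC k F (restrict_form F e) = restrict_form F (ext_deriv e).
Proof.
move=> es; rewrite /dC.
have [e's e'F] := @xgetI _ (0 : dform R n)
  [set e' | smooth_form k e' /\ restrict_form F e' = restrict_form F e] e
  (conj es erefl).
apply: ext_deriv_restrict e'F.
  exact: smooth_form_differentiable e's.
exact: smooth_form_differentiable es.
Qed.

Lemma smooth_forms_restrict k C w : smooth_forms k C w -> restrict_form C w = w.
Proof. by move=> [e _ <-]; rewrite restrict_form_sub. Qed.

Lemma dC_linear k C (S : set (dform R n)) :
  S `<=` smooth_forms k C -> is_subspace S -> linear_on S (dC k C).
Proof.
move=> Ssm Ssub a u v Su Sv.
have [eu us uE] := Ssm _ Su; have [ev vs vE] := Ssm _ Sv.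
have [e es eE] := Ssm _ (Ssub.2 a _ _ Su Sv).
rewrite -eE -[in RHS]uE -[in RHS]vE !dC_extension // -restrict_formP.
have du := smooth_form_differentiable us.
have dv := smooth_form_differentiable vs.
rewrite -ext_derivP //; apply: ext_deriv_restrict.
- exact: smooth_form_differentiable es.
- exact: differentiable_formP.
- by rewrite eE restrict_formP uE vE.
Qed.

(** A smooth extension of a form on [C] also extends its trace on [F], so the same
    extension computes both sides. *)
Lemma trace_dC k C F w : (F `<=` C)%fset -> smooth_forms k C w ->
  trace_form C F (dC k C w) = dC k F (trace_form C F w).
Proof.
move=> FC [e es <-]; rewrite /trace_form dC_extension //.
by rewrite !restrict_form_sub // dC_extension.
Qed.

Lemma const1_trace C F : (F `<=` C)%fset ->
  trace_form C F (const1 C) = const1 F.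
Proof. exact: restrict_form_sub. Qed.

End Forms.

(** * Relative chains and local exactness of the relative chain complexes *)

Section RelativeChains.
Context {R : realType} {n : nat}.
Implicit Types (C D E F G : simplex R n) (M N : {fset simplex R n}) (m p : int).
Variable ori : simplex R n -> seq 'rV[R]_n -> R.

Lemma simp_chains_subspace M m : is_subspace (@simp_chains R n M m).
Proof.
split=> [C|a u v uM vM C]; first by rewrite eqxx.
have [/uM //|/negPn/eqP u0] := boolP (u C != 0).
have [/vM //|/negPn/eqP v0] := boolP (v C != 0).
have -> : (a *: u + v) C = a * u C + v C by [].
by rewrite u0 v0 mulr0 addr0 eqxx.
Qed.

Lemma chain_boundary_linear M m (S : set (@rchain R n)) :
  linear_on S (chain_boundary ori M m).
Proof.
move=> a u v _ _; apply/funext => F.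
transitivity (a * chain_boundary ori M m u F + chain_boundary ori M m v F) => //.
rewrite /chain_boundary; case: ifP => _; last by rewrite mulr0 addr0.
rewrite mulr_sumr -big_split; apply: eq_bigr => C _ /=.
have -> : (a *: u + v) C = a * u C + v C by [].
by rewrite mulrDr mulrCA.
Qed.

Lemma chain_boundary_chains M m c :
  simp_chains M (m - 1) (chain_boundary ori M m c).
Proof.
move=> F; rewrite /chain_boundary.
by case: ifP => [/andP[FM /eqP dF] _|_]; rewrite ?eqxx.
Qed.

Section Relative.
Variables M N : {fset simplex R n}.
Hypothesis N_closed : forall C F, C \in N -> F \in M -> psubsimplex F C -> F \in N.

Lemma chain_boundary_sub m c :
  simp_chains N m c -> simp_chains N (m - 1) (chain_boundary ori M m c).
Proof.
move=> cN F; rewrite /chain_boundary.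
case: ifP => [/andP[FM /eqP dF]|_]; last by rewrite eqxx.
have [FN //|FN] := boolP (F \in N).
rewrite big1 ?eqxx // => C /andP[_ FC].
have [/cN [CN _]|/negPn/eqP ->] := boolP (c C != 0); last by rewrite mulr0.
by rewrite (N_closed CN FM FC) in FN.
Qed.

Lemma rel_boundary_proj m p c : p = m - 1 ->
  rel_boundary ori M N m p (proj_quot (simp_chains N m) c) =
  proj_quot (simp_chains N p) (chain_boundary ori M m c).
Proof.
move=> ->; rewrite /rel_boundary; apply/proj_quot_eq/in_vspan_subspace.
  exact: simp_chains_subspace.
have cN : simp_chains N m (lift_quot (proj_quot (simp_chains N m) c) - c).
  apply/(in_vspan_subspace (simp_chains_subspace N m)).
  by apply/proj_quot_eq; rewrite lift_quotK.
have := chain_boundary_sub cN.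
by rewrite (linear_onB (subspaceT _)) //; exact: chain_boundary_linear.
Qed.

Lemma rel_boundaries_subspace m : is_subspace (rel_boundaries ori M N m).
Proof.
have -> : rel_boundaries ori M N m =
    (fun c => proj_quot (simp_chains N m) (chain_boundary ori M (m + 1) c)) @`
      simp_chains M (m + 1).
  apply/seteqP; split=> [_ [_ [c cM <-] <-]|_ [c cM <-]].
    by exists c => //; rewrite rel_boundary_proj // addrK.
  exists (proj_quot (simp_chains N (m + 1)) c); first by exists c.
  by rewrite rel_boundary_proj // addrK.
apply: subspace_image; first exact: simp_chains_subspace.
move=> a u v _ _; rewrite (@chain_boundary_linear M (m + 1) setT) //.
exact: (@proj_quot_linear _ _ _ setT).
Qed.

(** Vanishing of a double quotient, expressed by chains only. *)
Lemma rel_homology_eq0 m c : rel_homology ori M N m = [set 0] ->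
  simp_chains M m c ->
  (forall F, F \in M -> sdim F = m - 1 -> F \notin N ->
     chain_boundary ori M m c F = 0) ->
  exists2 b, simp_chains M (m + 1) b &
    forall F, F \in M -> sdim F = m -> F \notin N ->
      c F = chain_boundary ori M (m + 1) b F.
Proof.
move=> H0 cM cycle.
have qcyc : rel_cycles ori M N m (proj_quot (simp_chains N m) c).
  split; first by exists c.
  rewrite rel_boundary_proj // proj_quot_eq0; last exact: simp_chains_subspace.
  move=> F cF0; have [FM dF] := chain_boundary_chains cF0; split=> //.
  by apply/negPn/negP => FN; case/eqP: cF0; exact: cycle.
have : rel_homology ori M N m
    (proj_quot (rel_boundaries ori M N m) (proj_quot (simp_chains N m) c)).
  by exists (proj_quot (simp_chains N m) c).
rewrite H0 => /(proj_quot_eq0 (rel_boundaries_subspace m)) [_ [b bM <-]].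
rewrite rel_boundary_proj ?addrK // => /proj_quot_eq.
move/(in_vspan_subspace (simp_chains_subspace N m)) => bc.
exists b => // F FM dF FN; apply/eqP; rewrite eq_sym -subr_eq0.
by apply: contraNT FN => /bc [].
Qed.

End Relative.

(** The linear algebra that passes from scalar to vector coefficients: exactness
    at the middle of a complex of finite matrices provides, by a pseudoinverse, a
    matrix that solves the boundary equation for coefficients in any space. *)
Lemma vector_exact (X : eqType) (s0 s1 s2 : seq X) (f : X -> X -> R)
    (V : lmodType R) (S : set V) (c : X -> V) :
  uniq s1 -> uniq s2 -> is_subspace S ->
  (forall x : X -> R, (forall y, y \in s0 -> \sum_(z <- s1) f y z * x z = 0) ->
     exists b : X -> R, forall z, z \in s1 -> x z = \sum_(w <- s2) f z w * b w) ->
  (forall z, z \in s1 -> S (c z)) ->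
  (forall y, y \in s0 -> \sum_(z <- s1) f y z *: c z = 0) ->
  exists b : X -> V, (forall w, S (b w)) /\
    forall z, z \in s1 -> c z = \sum_(w <- s2) f z w *: b w.
Proof.
move=> u1 u2 Ssub exact cS c0.
pose t0 := tnth (in_tuple s0); pose t1 := tnth (in_tuple s1).
pose t2 := tnth (in_tuple s2).
have t1s i : t1 i \in s1 by exact: mem_tnth.
pose A := \matrix_(i < size s1, j < size s0) f (t0 j) (t1 i).
pose B := \matrix_(l < size s2, i < size s1) f (t1 i) (t2 l).
have inj1 : injective t1 by apply/tuple_uniqP.
have inj2 : injective t2 by apply/tuple_uniqP.
have AB (x : 'rV_(size s1)) : x *m A = 0 -> (x <= B)%MS.
  move=> xA.
  pose y z := \sum_(i < size s1) (if t1 i == z then x 0 i else 0).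
  have yE i : y (t1 i) = x 0 i.
    rewrite /y (bigD1 i) //= eqxx big1 ?addr0 // => j ji.
    by rewrite (inj_eq inj1) (negbTE ji).
  have [z|b bE] := exact y.
    move=> /seq_tnthP [j ->]; rewrite -/(t0 j) big_tnth.
    transitivity ((x *m A) 0 j); last by rewrite xA mxE.
    rewrite mxE; apply: eq_bigr => i _.
    by rewrite -/(t1 i) yE mxE mulrC.
  apply/submxP; exists (\row_l b (t2 l)); apply/rowP => i; rewrite !mxE -yE bE //.
  by rewrite big_tnth; apply: eq_bigr => l _; rewrite -/(t2 l) !mxE mulrC.
have /submxP [H HE] : (1%:M - A *m pinvmx A <= B)%MS.
  apply/row_subP => i; apply: AB; rewrite -row_mul mulmxBl mul1mx mulmxKpV //.
  by rewrite subrr row0.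
pose b l := \sum_i H i l *: c (t1 i).
exists (fun w => \sum_(l < size s2) (if t2 l == w then b l else 0)).
have Sb l : S (b l).
  by apply: subspace_sum => // i _; apply: subspaceZ => //; apply: cS.
split=> [w|z /seq_tnthP [j ->]].
  by apply: subspace_sum => // l _; case: ifP => // _; apply: subspace0.
rewrite -/(t1 j) big_tnth.
transitivity (\sum_(l < size s2) B l j *: b l); last first.
  apply: eq_bigr => l _; rewrite -/(t2 l) !mxE; congr (_ *: _).
  rewrite (bigD1 l) //= eqxx big1 ?addr0 // => i il.
  by rewrite (inj_eq inj2) (negbTE il).
have E : 1%:M = A *m pinvmx A + H *m B by rewrite -HE addrC subrK.
transitivity (\sum_i (1%:M : 'M[R]_(size s1)) i j *: c (t1 i)).
  rewrite (bigD1 j) //= mxE eqxx scale1r big1 ?addr0 // => i ij.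
  by rewrite mxE (negbTE ij) scale0r.
rewrite E; under eq_bigr do rewrite mxE scalerDl !mxE !scaler_suml.
rewrite big_split /= exchange_big [X in _ + X]exchange_big /=.
rewrite big1 => [|l _]; first rewrite add0r; last first.
  under eq_bigr do rewrite mulrC -scalerA.
  rewrite -scaler_sumr; have := c0 (t0 l) (mem_tnth l (in_tuple s0)).
  rewrite big_tnth => c0l.
  have -> : \sum_i A i l *: c (t1 i) = 0.
    by rewrite -[RHS]c0l; apply: eq_bigr => i _; rewrite mxE.
  by rewrite scaler0.
apply: eq_bigr => l _; rewrite scaler_sumr; apply: eq_bigr => i _.
by rewrite scalerA mulrC.
Qed.

Variables T U : {fset simplex R n}.
Hypothesis T_complex : simplicial_complex T.
Hypothesis T_dim : dimensional n%:Z T.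
Hypothesis U_complex : simplicial_complex U.
Hypothesis patches : local_patch_condition ori T U.

Lemma complex_closed M C F :
  simplicial_complex M -> C \in M -> subsimplex F C -> F \in M.
Proof. by move=> [_ H _]; apply: H. Qed.

Lemma complex_neq0 M C : simplicial_complex M -> C \in M -> C != fset0.
Proof. by move=> [H _ _] /H []. Qed.

Lemma sdim_subsimplex F C : subsimplex F C -> sdim F <= sdim C.
Proof. by move=> /andP[_ /fsubset_leq_card]; rewrite /sdim => H; lia. Qed.

Lemma in_fset_sep (K : choiceType) (A : {fset K}) (P : pred K) x :
  (x \in [fset y in A | P y]%fset) = (x \in A) && P x.
Proof. by rewrite !inE. Qed.

Lemma star_patchP F G : reflect
  (G \in T /\ exists C, [/\ C \in T, sdim C = n%:Z, subsimplex F C & subsimplex G C])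
  (G \in star_patch T F).
Proof.
rewrite /star_patch in_fset_sep; apply: (iffP andP) => [[GT /existsP [C /and3P[/eqP dC FC GC]]]|].
  by split=> //; exists (val C); split => //; exact: valP.
move=> [GT [C [CT dC FC GC]]]; split=> //; apply/existsP; exists [` CT]%fset.
by rewrite /= dC eqxx FC GC.
Qed.

(** A cell of the patch of dimension below [n] lies in an [n]-cell of the patch,
    hence in a facet of it; so these cells form an [n - 1]-dimensional complex. *)
Lemma star_patch_skeletonP F G : reflect
  (G \in star_patch T F /\ sdim G <= n%:Z - 1)
  (G \in simp_skeleton (n%:Z - 1) (star_patch T F)).
Proof.
rewrite /simp_skeleton (in_fset_sep (star_patch T F)).
apply: (iffP andP) => [[GM /asboolP [K [KM Kc Kd GK]]]|[GM dG]].
  split=> //; have [C [CK <- GC]] := Kd _ GK; exact: sdim_subsimplex.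
split=> //; apply/asboolP.
exists [fset E in star_patch T F | sdim E <= n%:Z - 1]%fset; split.
- by apply/fsubsetP => E; rewrite (in_fset_sep (star_patch T F)) => /andP[].
- split=> [C|C E|C C']; rewrite !(in_fset_sep (star_patch T F)).
  + move=> /andP[/star_patchP [CT _] _].
    by case: T_complex => H _ _; apply: H.
  + move=> /andP[/star_patchP [CT [D [DT dD FD CD]]] dC] EC.
    apply/andP; split; last by apply: le_trans dC; exact: sdim_subsimplex.
    apply/star_patchP; split; first exact: complex_closed EC.
    by exists D; split => //; apply: subsimplex_trans CD.
  + move=> /andP[/star_patchP [CT _] _] /andP[/star_patchP [C'T _] _].
    by case: T_complex => _ _; apply.
- move=> E; rewrite (in_fset_sep (star_patch T F)) => /andP[/star_patchP [ET [C [CT dC FC EC]]] dE].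
  have /fset0Pn [a] : (C `\` E)%fset != fset0.
    have /andP[_ EsC] := EC; rewrite -cardfs_gt0 cardfsDS // subn_gt0.
    by move: dC dE; rewrite /sdim; lia.
  rewrite !inE => /andP[aE aC].
  have ECa : (E `<=` C `\ a)%fset.
    apply/fsubsetP => x xE; rewrite !inE; have /andP[_ /fsubsetP ->] := EC => //.
    by rewrite andbT; apply: contraNneq aE => <-.
  have E0 := complex_neq0 T_complex ET.
  have Ca0 : (C `\ a)%fset != fset0.
    by apply: contraNneq E0 => Ca; rewrite Ca fsubset0 in ECa.
  have [pCa dCa] := facetI aC Ca0.
  exists (C `\ a)%fset; split; last 2 first.
  + by rewrite dCa dC.
  + by rewrite /subsimplex E0.
  rewrite (in_fset_sep (star_patch T F)) dCa dC lexx andbT; apply/star_patchP; split.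
    exact: complex_closed (psubsimplexE pCa).
  by exists C; split => //; exact: psubsimplexE.
- by rewrite (in_fset_sep (star_patch T F)) GM.
Qed.

Definition cofaces m F : seq (simplex R n) :=
  [seq C <- enum_fset T | active T U m C && subsimplex F C].

Lemma mem_cofaces m F C : (C \in cofaces m F) = active T U m C && subsimplex F C.
Proof.
rewrite mem_filter; case: (boolP (active T U m C && subsimplex F C)) => //=.
by case/andP => /andP[].
Qed.

Definition coef G C : R := if psubsimplex G C then incidence ori G C else 0.

(** The patch condition at [F], read off for the cells outside [U] that contain
    [F]. In degree [n] the patch complex may also contain cells of [U], but the
    boundaries of these vanish relative to the patch boundary. *)
Lemma patch_exact F m (x : simplex R n -> R) : F \in T -> 0 <= m <= n%:Z - 1 ->
  (forall G, G \in cofaces (m - 1) F ->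
     \sum_(C <- cofaces m F) coef G C * x C = 0) ->
  exists b : simplex R n -> R, forall G, G \in cofaces m F ->
    x G = \sum_(C <- cofaces (m + 1) F) coef G C * b C.
Proof.
move=> FT mn cycle.
set M := star_patch T F; set N := patch_boundary T U F.
have NP G : reflect ((G \in M /\ sdim G <= n%:Z - 1) /\
    (~~ subsimplex F G || (G \in U))) (G \in N).
  by rewrite /N /patch_boundary (in_fset_sep (simp_skeleton _ _)); apply: (iffP andP) => -[/star_patch_skeletonP].
have N_closed C E : C \in N -> E \in M -> psubsimplex E C -> E \in N.
  move=> /NP [[CM dC] FCU] EM /psubsimplexE EC; apply/NP; split.
    by split=> //; apply: le_trans dC; exact: sdim_subsimplex.
  case/orP: FCU => [FC|CU].
    by rewrite (contraNN _ FC) // => FE; apply: subsimplex_trans EC.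
  by rewrite (complex_closed U_complex CU EC) orbT.
have cofM G p : G \in cofaces p F -> G \in M.
  rewrite mem_cofaces => /andP[/and3P[GT _ _] FG]; apply/star_patchP; split=> //.
  have [C [CT dC GC]] := T_dim GT; exists C; split=> //.
  exact: subsimplex_trans GC.
have cofN G p : G \in cofaces p F -> G \notin N.
  rewrite mem_cofaces => /andP[/and3P[_ GU _] FG].
  by apply/NP => -[_]; rewrite FG (negbTE GU).
have MNcof G p : G \in M -> sdim G = p -> p <= n%:Z - 1 -> G \notin N ->
    G \in cofaces p F.
  move=> GM dG pn /NP GN; have [GT _] := star_patchP _ _ GM.
  rewrite mem_cofaces /active GT dG eqxx !andbT /=; apply/andP.
  split; first by apply/negP => GU; apply: GN; split; rewrite ?dG // GU orbT.
  by apply/negPn/negP => FG; apply: GN; split; rewrite ?dG // FG.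
have MT : (M `<=` T)%fset by apply/fsubsetP => G /star_patchP [].
have bdE p G (c : @rchain R n) : G \in M -> sdim G = p - 1 -> subsimplex F G ->
    G \notin U ->
    chain_boundary ori M p c G = \sum_(C <- cofaces p F) coef G C * c C.
  move=> GM dG FG GU; rewrite /chain_boundary GM dG eqxx /= big_filter.
  rewrite big_mkcond (sum_fsub _ MT) [RHS]big_mkcond; apply: eq_big_seq => C CT.
  rewrite /active CT /= /coef; case: (boolP (psubsimplex G C)) => [GC|]; last first.
    by rewrite andbF mul0r !if_same.
  have FC := subsimplex_trans FG (psubsimplexE GC).
  have CU : C \notin U.
    by apply: contraNN GU => CU; apply: complex_closed (psubsimplexE GC).
  have -> : C \in M.
    apply/star_patchP; split=> //; have [D [DT dD CD]] := T_dim CT.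
    by exists D; split=> //; apply: subsimplex_trans CD.
  by rewrite FC CU andbT.
have /andP[m0 mn1] := mn.
pose c : @rchain R n := fun C => if C \in cofaces m F then x C else 0.
have sumc G : \sum_(C <- cofaces m F) coef G C * c C =
    \sum_(C <- cofaces m F) coef G C * x C.
  by apply: eq_big_seq => C Cm; rewrite /c Cm.
have cM : simp_chains M m c.
  move=> C; rewrite /c; case: ifP => [Cm _|_]; last by rewrite eqxx.
  split; first exact: cofM Cm.
  by move: Cm; rewrite mem_cofaces => /andP[/and3P[_ _ /eqP]].
have [|b bM bE] := rel_homology_eq0 N_closed (patches FT mn) cM.
  move=> G GM dG GN.
  have Gc : G \in cofaces (m - 1) F.
    by apply: MNcof => //; apply: le_trans mn1; rewrite gerBl.
  have := Gc; rewrite mem_cofaces => /andP[/and3P[_ GU _] FG].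
  by rewrite bdE // sumc cycle.
exists b => G Gm; have := Gm; rewrite mem_cofaces => /andP[/and3P[_ GU /eqP dG] FG].
have := bE G (cofM _ _ Gm) dG (cofN _ _ Gm); rewrite /c Gm => ->.
by rewrite bdE ?addrK //; exact: cofM Gm.
Qed.

End RelativeChains.

(** * Exactness of the complex of signed traces *)

Section TraceComplex.
Context {R : realType} {n : nat}.
Implicit Types (C D E F G : simplex R n) (k m : int) (v w : cochain R n).
Variables (T U : {fset simplex R n}).
Variable ori : simplex R n -> seq 'rV[R]_n -> R.
Variable Lam : int -> simplex R n -> set (dform R n).

Hypothesis T_complex : simplicial_complex T.
Hypothesis T_dim : dimensional n%:Z T.
Hypothesis U_complex : simplicial_complex U.
Hypothesis ori_orients : forall C, C \in T -> orients (ori C) C.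
Hypothesis Lam_spaces : admissible_spaces T Lam.

Definition live C : bool := (C \in T) && (C \notin U).

Lemma activeE m C : active T U m C = live C && (sdim C == m).
Proof. by rewrite /active /live andbA. Qed.

Lemma live_super F C : live F -> C \in T -> subsimplex F C -> live C.
Proof.
move=> /andP[_ FU] CT FC; rewrite /live CT /=.
by apply: contraNN FU => CU; apply: complex_closed FC.
Qed.

Lemma Lam_subspace k C : C \in T -> is_subspace (Lam k C).
Proof. by case: Lam_spaces => H _ _ _ CT; apply: fin_dim_subspace; case: (H k C CT). Qed.

Lemma Lam_smooth k C : C \in T -> Lam k C `<=` smooth_forms k C.
Proof. by case: Lam_spaces => H _ _ _ CT; case: (H k C CT). Qed.

Lemma Lam_trace k C F (w : dform R n) : C \in T -> subsimplex F C -> Lam k C w ->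
  Lam k F (restrict_form F w).
Proof.
by case: Lam_spaces => _ _ _ H CT FC Lw; rewrite -(H k C F CT FC); exists w.
Qed.

Lemma Lam_restrict k C (w : dform R n) : C \in T -> Lam k C w -> restrict_form C w = w.
Proof. by move=> CT /(Lam_smooth CT); apply: smooth_forms_restrict. Qed.

Definition facet_coef F C : R :=
  if [&& live C, sdim C == sdim F + 1 & psubsimplex F C]
  then incidence ori F C else 0.

Lemma facet_coef_neq0 F C : facet_coef F C != 0 ->
  [/\ live C, sdim C = sdim F + 1, psubsimplex F C
    & facet_coef F C = incidence ori F C].
Proof. by rewrite /facet_coef; case: and3P => [[? /eqP ? ?]|]; rewrite ?eqxx. Qed.

(** The coefficients of the trace operators do not depend on degrees, so a single
    operator on all cochains comprises them. *)
Definition trace_sum w : cochain R n := fun F =>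
  if live F then \sum_(C <- T) facet_coef F C *: restrict_form F (w C) else 0.

Lemma trace_sumP (a : R) v w :
  trace_sum (a *: v + w) = a *: trace_sum v + trace_sum w.
Proof.
apply/funext => F.
transitivity (a *: trace_sum v F + trace_sum w F) => //.
rewrite /trace_sum; case: ifP => _; last by rewrite scaler0 addr0.
rewrite scaler_sumr -big_split; apply: eq_bigr => C _ /=.
have -> : (a *: v + w) C = a *: v C + w C by [].
by rewrite restrict_formP scalerDr !scalerA mulrC.
Qed.

Lemma trace_sum_linear (S : set (cochain R n)) : linear_on S trace_sum.
Proof. by move=> a u v _ _; apply: trace_sumP. Qed.

Lemma facet_coef_sum0 F C : live F ->
  C \in T -> \sum_(G <- T) facet_coef F G * facet_coef G C = 0.
Proof.
move=> Fl CT.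
have Tclosed D E : D \in T -> subsimplex E D -> E \in T.
  by move=> DT; apply: complex_closed.
have [dFC|dFC] := eqVneq (sdim C) (sdim F + 1 + 1); last first.
  rewrite big1 // => G _; apply: contraNeq dFC; rewrite mulf_eq0 negb_or.
  by move=> /andP[/facet_coef_neq0 [_ <- _ _] /facet_coef_neq0 [_ <- _ _]].
rewrite -[RHS](@incidence_sum0 _ _ ori T F C (sdim C)) //; last first.
  by rewrite dFC !addrK.
rewrite [RHS]big_mkcond; apply: eq_big_seq => G GT.
rewrite dFC addrK; have [dG|dG] := eqVneq (sdim G) (sdim F + 1); last first.
  by rewrite /facet_coef (negbTE dG) andbF mul0r.
rewrite /facet_coef dG dFC !eqxx /=.
have [FG|_] := boolP (psubsimplex F G); last by rewrite !andbF mul0r.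
have Gl := live_super Fl GT (psubsimplexE FG); rewrite Gl /=.
have [GC|_] := boolP (psubsimplex G C); last by rewrite !andbF mulr0.
by rewrite (live_super Gl CT (psubsimplexE GC)).
Qed.

Lemma trace_sum_sum w : trace_sum (trace_sum w) = 0.
Proof.
apply/funext => F; rewrite {1}/trace_sum; case: ifP => // Fl.
transitivity (\sum_(G <- T) \sum_(C <- T)
   (facet_coef F G * facet_coef G C) *: restrict_form F (w C)).
  apply: eq_bigr => G _; have [->|FG] := eqVneq (facet_coef F G) 0.
    by rewrite scale0r big1 // => C _; rewrite mul0r scale0r.
  have [Gl _ FsG _] := facet_coef_neq0 FG.
  rewrite /trace_sum Gl restrict_form_sum scaler_sumr; apply: eq_bigr => C _.
  rewrite restrict_formZ restrict_form_sub ?scalerA //.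
  by have /andP[/andP[]] := FsG.
rewrite exchange_big big_seq big1 //= => C CT.
by rewrite -scaler_suml facet_coef_sum0 // scale0r.
Qed.

Lemma Lam1_subspace k m : is_subspace (Lam1 T U Lam k m).
Proof.
split=> [C|a u v uL vL C].
  by case: ifP => // /and3P[CT _ _]; apply: subspace0; apply: Lam_subspace.
have := uL C; have := vL C; case: ifP => [/and3P[CT _ _] vC uC|_ v0 u0].
  by apply: (Lam_subspace k CT).2.
by transitivity (a *: u C + v C) => //; rewrite u0 v0 scaler0 addr0.
Qed.

Lemma trace_sum_Lam1 k m w :
  Lam1 T U Lam k (m + 1) w -> Lam1 T U Lam k m (trace_sum w).
Proof.
move=> wL F; rewrite activeE /trace_sum.
case: (boolP (live F)) => [Fl|//]; have /andP[FT _] := Fl.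
have [dF|dF] /= := eqVneq (sdim F) m; last first.
  rewrite big1 // => C _; have [->|FC] := eqVneq (facet_coef F C) 0.
    by rewrite scale0r.
  have [Cl dC _ _] := facet_coef_neq0 FC.
  have := wL C; rewrite activeE Cl dC (inj_eq (addIr _)) (negbTE dF) /= => ->.
  by rewrite restrict_form0 scaler0.
have Lsub := Lam_subspace k FT.
apply: (subspace_sum Lsub) => C _; have [->|FC] := eqVneq (facet_coef F C) 0.
  by rewrite scale0r; apply: subspace0.
have [Cl dC FsC _] := facet_coef_neq0 FC; have /andP[CT _] := Cl.
apply: (subspaceZ Lsub); apply: (Lam_trace CT (psubsimplexE FsC)).
by have := wL C; rewrite activeE Cl dC dF eqxx.
Qed.

Lemma sum_cofaces m F G (h : simplex R n -> dform R n) : active T U m G ->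
  subsimplex F G ->
  \sum_(C <- T) facet_coef G C *: h C =
  \sum_(C <- cofaces T U (m + 1) F) coef ori G C *: h C.
Proof.
move=> Gm FG; rewrite big_filter [RHS]big_mkcond; apply: eq_big_seq => C CT.
move: Gm; rewrite activeE => /andP[Gl /eqP dG].
rewrite activeE /facet_coef /coef dG.
have [GC|_] := boolP (psubsimplex G C); last by rewrite !andbF scale0r if_same.
rewrite (subsimplex_trans FG (psubsimplexE GC)) !andbT.
by case: ifP => _; rewrite ?scale0r.
Qed.

Lemma Lam_ring_subspace k F : F \in T -> is_subspace (Lam_ring Lam k F).
Proof.
move=> FT; have Lsub := Lam_subspace k FT; split.
  split; first exact: subspace0.
  by move=> G _; apply: restrict_form0.
move=> a u v [Lu u0] [Lv v0]; split; first exact: Lsub.2.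
move=> G GF; rewrite /trace_form restrict_formP.
by move: (u0 G GF) (v0 G GF); rewrite /trace_form => -> ->; rewrite scaler0 addr0.
Qed.

Hypothesis decomposition : geometric_decomposition_condition T Lam.
Hypothesis patches : local_patch_condition ori T U.

(** One step of the exactness proof: the traces on [F] of a cycle [w] all of whose
    traces on proper faces of [F] vanish make up a cycle of the patch at [F]
    with coefficients in the forms on [F] with vanishing boundary traces; the
    patch condition makes it a boundary, and the extension operators turn the
    bounding chain into a correction of [w]. The correction affects only traces
    on cells that contain [F]. *)
Lemma clear_traces k m w F : F \in T -> 0 <= m <= n%:Z - 1 ->
  Lam1 T U Lam k m w -> trace_sum w = 0 ->
  (forall G C, psubsimplex G F -> active T U m C -> subsimplex F C ->
     restrict_form G (w C) = 0) ->
  exists v, [/\ Lam1 T U Lam k (m + 1) v,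
    forall C, active T U m C -> subsimplex F C ->
      restrict_form F (trace_sum v C) = restrict_form F (w C)
    & forall C E, active T U m C -> subsimplex E C -> ~~ subsimplex F E ->
      restrict_form E (trace_sum v C) = 0].
Proof.
move=> FT mn wL wT wF.
have [ext [ext1 [ext2 ext3]]] := decomposition.
have cofT p C : C \in cofaces T U p F -> [/\ C \in T, active T U p C & subsimplex F C].
  by rewrite mem_cofaces => /andP[Ca FC]; have /and3P[] := Ca.
have wring C : C \in cofaces T U m F -> Lam_ring Lam k F (restrict_form F (w C)).
  move=> /cofT [CT Ca FC]; split.
    by apply: (Lam_trace CT FC); have := wL C; rewrite Ca.
  move=> G GF; have /andP[/andP[_ GsF] _] := GF.
  by rewrite /trace_form restrict_form_sub //; apply: wF.
have uc p : uniq (cofaces T U p F) by rewrite filter_uniq ?fset_uniq.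
have [||b [bS bE]] := @vector_exact _ _ (cofaces T U (m - 1) F) _ _ (coef ori) _ _
  (fun C => restrict_form F (w C)) (uc m) (uc (m + 1)) (Lam_ring_subspace k FT) _ wring.
- by move=> x; apply: (patch_exact T_complex T_dim U_complex patches FT mn).
- move=> G /cofT [GT Ga FG].
  have := congr1 (fun h => restrict_form F (h G)) wT.
  rewrite restrict_form0 /trace_sum; move: (Ga); rewrite activeE => /andP[-> _].
  rewrite restrict_form_sum => wG; rewrite -[RHS]wG.
  have FsG : (F `<=` G)%fset by case/andP: FG.
  under [RHS]eq_bigr do rewrite restrict_formZ restrict_form_sub //.
  by rewrite (sum_cofaces _ Ga FG) subrK.
pose v C := if C \in cofaces T U (m + 1) F then ext k F C (b C) else 0.
have vL : Lam1 T U Lam k (m + 1) v.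
  move=> C; rewrite /v mem_cofaces; have [Ca|//] := boolP (active T U (m + 1) C).
  have /and3P[CT _ _] := Ca; case: ifP => /= [FC|_].
    by have [_ H _] := ext1 k F C CT FC; apply: H.
  by apply: subspace0; apply: Lam_subspace.
have vE C : active T U m C -> subsimplex F C ->
    trace_sum v C = ext k F C (restrict_form F (w C)).
  move=> Ca FC; have Cm : C \in cofaces T U m F by rewrite mem_cofaces Ca FC.
  have [CT _ _] := cofT _ _ Cm; have [extL _ _] := ext1 k F C CT FC.
  rewrite bE // (linear_on_sum (Lam_ring_subspace k FT)) //; last first.
    by move=> D _; apply: (subspaceZ (Lam_ring_subspace k FT)).
  rewrite /trace_sum; move: (Ca); rewrite activeE => /andP[-> _].
  rewrite (sum_cofaces _ Ca FC); apply: eq_big_seq => D Dm.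
  have [DT Da FD] := cofT _ _ Dm.
  rewrite (linear_onZ (Lam_ring_subspace k FT)) // /v Dm /coef.
  case: ifP => [CD|_]; last by rewrite !scale0r.
  by rewrite (ext2 k F C D DT FC (psubsimplexE CD)).
exists v; split => // [C Ca FC|C E Ca EC FE].
  rewrite vE //; have /and3P[CT _ _] := Ca.
  have [_ _ ] := ext1 k F C CT FC; apply; apply: wring.
  by rewrite mem_cofaces Ca FC.
have /and3P[CT _ _] := Ca.
have [FC|FC] := boolP (subsimplex F C).
  rewrite vE //; apply: (ext3 k F E C CT FC EC FE); apply: wring.
  by rewrite mem_cofaces Ca FC.
rewrite /trace_sum; move: (Ca); rewrite activeE => /andP[-> _].
rewrite big1 ?restrict_form0 // => D _.
have [->|/facet_coef_neq0 [_ _ CD _]] := eqVneq (facet_coef C D) 0.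
  by rewrite scale0r.
rewrite /v; case: ifP => [/cofT [DT _ FD]|_]; last by rewrite restrict_form0 scaler0.
have -> : restrict_form C (ext k F D (b D)) = 0.
  exact: (ext3 k F C D DT FD (psubsimplexE CD) FC).
by rewrite scaler0.
Qed.

(** The traces of a cycle are made to vanish one simplex at a time, in an order in
    which faces come first. When all of them vanish, so does the cycle, because
    a form on [C] is its own trace on [C]. *)
Lemma trace_sum_exact k m w : m <= n%:Z - 1 ->
  Lam1 T U Lam k m w -> trace_sum w = 0 ->
  exists2 v, Lam1 T U Lam k (m + 1) v & w = trace_sum v.
Proof.
move=> mn; have [m_lt0|m0] := ltP m 0.
  move=> wL _; exists 0; first exact: subspace0 (Lam1_subspace _ _).
  rewrite (linear_on0 (subspaceT _) (@trace_sum_linear setT)).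
  apply/funext => C; have := wL C; case: ifP => // /and3P[CT _ /eqP dC].
  have := complex_neq0 T_complex CT; rewrite -cardfs_gt0 => C0.
  by move: dC m_lt0; rewrite /sdim => <-; lia.
suff clear (N : nat) (P : {fset simplex R n}) u :
    (#|` (T `\` P)%fset| <= N)%N ->
    (forall F G, F \in P -> psubsimplex G F -> G \in P) ->
    Lam1 T U Lam k m u -> trace_sum u = 0 ->
    (forall F C, F \in P -> active T U m C -> subsimplex F C ->
       restrict_form F (u C) = 0) ->
    exists2 v, Lam1 T U Lam k (m + 1) v & u = trace_sum v.
  by move=> wL wT; apply: (clear #|` (T `\` fset0)%fset| fset0).
elim: N P u => [|N IH] P {}w szP Pclosed wL wT wP.
  exists 0; first exact: subspace0 (Lam1_subspace _ _).
  rewrite (linear_on0 (subspaceT _) (@trace_sum_linear setT)).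
  apply/funext => C; have := wL C; case: ifP => // Ca LC.
  have /and3P[CT _ _] := Ca.
  rewrite -(Lam_restrict CT LC); apply: wP => //; last first.
    by apply: subsimplex_refl; apply: complex_neq0 CT.
  apply/negPn/negP => CP; move: szP; rewrite leqn0 cardfs_eq0 => /eqP/fsetP/(_ C).
  by rewrite !inE CP CT.
have [TP0|/fset0Pn [F0 F0TP]] := eqVneq (T `\` P)%fset fset0.
  by apply: (IH P) => //; rewrite TP0 cardfs0.
pose F := val [arg min_(G < [` F0TP]%fset) #|` val G|].
have [FTP Fmin] : F \in (T `\` P)%fset /\
    forall G, G \in (T `\` P)%fset -> (#|` F| <= #|` G|)%N.
  rewrite /F; case: arg_minnP => // G _ Gmin; split; first exact: valP.
  by move=> E ETP; apply: (Gmin [` ETP]%fset).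
move: FTP; rewrite inE => /andP[FP FT].
have FfaceP G : psubsimplex G F -> G \in P.
  move=> GF; have /andP[/andP[_ GsF] GneF] := GF.
  apply/negPn/negP => GP.
  have GTP : G \in (T `\` P)%fset.
    by rewrite inE GP; apply: complex_closed (psubsimplexE GF).
  have := Fmin _ GTP; rewrite leqNgt => /negP; apply.
  have : (G `<` F)%fset by rewrite fproperEneq GneF.
  by rewrite fproperEcard => /andP[].
have [||v [vL vF vE]] := @clear_traces k m w F FT _ wL wT.
- by rewrite m0.
- move=> G C GF Ca FC; apply: wP => //; first exact: FfaceP.
  by apply: subsimplex_trans FC; apply: psubsimplexE.
have [|||||v' v'L v'E] := IH (F |` P)%fset (w - trace_sum v).
- rewrite -ltnS; apply: leq_trans szP.
  rewrite [X in (_ < X)%N](cardfsD1 F) inE FP FT add1n ltnS.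
  apply: fsubset_leq_card; apply/fsubsetP => x; rewrite !inE negb_or -!andbA.
  by move=> /and3P[-> -> ->].
- move=> E G; rewrite !inE => /orP[/eqP ->|EP] GE.
    by rewrite FfaceP ?orbT.
  by rewrite (Pclosed E) ?orbT.
- by apply: (subspaceB (Lam1_subspace k m)) => //; exact: trace_sum_Lam1.
- rewrite (linear_onB (subspaceT _) (@trace_sum_linear setT)) //.
  by rewrite trace_sum_sum wT subrr.
- move=> E C; rewrite !inE => EFP Ca EC.
  have -> : (w - trace_sum v) C = w C - trace_sum v C by [].
  rewrite restrict_formB; have [EF|EF] := eqVneq E F.
    by rewrite EF vF ?subrr // -EF.
  move: EFP; rewrite (negbTE EF) /= => EP.
  rewrite wP // vE ?subrr //; apply: contraNN FP => FE.
  by apply: (Pclosed E) => //; rewrite /psubsimplex FE eq_sym.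
exists (v' + v); first by exact: (subspaceD (Lam1_subspace k (m + 1))).
rewrite (linear_onD (@trace_sum_linear setT)) // -v'E.
by rewrite subrK.
Qed.

End TraceComplex.

(** * The total complex *)

Section TotalComplex.
Context {R : realType} {n : nat}.
Implicit Types (C D E F G : simplex R n) (k m p q lo hi : int)
  (v w : cochain R n).
Variables (T U : {fset simplex R n}).
Variable ori : simplex R n -> seq 'rV[R]_n -> R.
Variable Lam : int -> simplex R n -> set (dform R n).

Hypothesis T_complex : simplicial_complex T.
Hypothesis T_dim : dimensional n%:Z T.
Hypothesis U_complex : simplicial_complex U.
Hypothesis ori_orients : forall C, C \in T -> orients (ori C) C.
Hypothesis Lam_spaces : admissible_spaces T Lam.
Hypothesis exactness : local_exactness_condition T U Lam.

Local Notation live := (live T U).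
Local Notation trace_sum := (trace_sum T U ori).
Local Notation facet_coef := (facet_coef T U ori).

(** The distributional derivative lowers the dimension of cells or raises the
    degree of forms, so the difference [q] of these two numbers indexes the total
    complex. Distributional forms of degree [k] have [q = k - n]. *)
Definition graded q : set (cochain R n) :=
  [set w | forall C, if live C then Lam (sdim C + q) C (w C) else w C = 0].

Definition graded_in q lo hi : set (cochain R n) :=
  [set w | graded q w /\ forall C, w C != 0 -> lo <= sdim C < hi].

Lemma sdim_bounds C : C \in T -> 0 <= sdim C <= n%:Z.
Proof.
move=> CT; have [D [_ <- CD]] := T_dim CT; rewrite sdim_subsimplex // andbT.
have := complex_neq0 T_complex CT; rewrite -cardfs_gt0 /sdim => C0; lia.
Qed.

Lemma Lam0 k C : C \in T -> Lam k C 0.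
Proof. by move=> CT; apply: subspace0; apply: (Lam_subspace Lam_spaces). Qed.

Lemma graded_sub q : is_subspace (graded q).
Proof.
split=> [C|a u v uL vL C].
  by case: (boolP (live C)) => [/andP[CT _]|//]; apply: Lam0.
have := uL C; have := vL C; case: (boolP (live C)) => [/andP[CT _] vC uC|_ v0 u0].
  by apply: (Lam_subspace Lam_spaces _ CT).2.
by transitivity (a *: u C + v C) => //; rewrite u0 v0 scaler0 addr0.
Qed.

Lemma graded_in_sub q lo hi : is_subspace (graded_in q lo hi).
Proof.
split=> [|a u v [uL uS] [vL vS]].
  by split=> [|C]; [exact: subspace0 (graded_sub q)|rewrite eqxx].
split=> [|C]; first exact: (graded_sub q).2.
have -> : (a *: u + v) C = a *: u C + v C by [].
have [->|u0 _] := eqVneq (u C) 0; last exact: uS.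
by rewrite scaler0 add0r; apply: vS.
Qed.

Lemma graded_inS q lo hi lo' hi' : lo' <= lo -> hi <= hi' ->
  graded_in q lo hi `<=` graded_in q lo' hi'.
Proof.
move=> ll hh w [wL wS]; split=> // C /wS /andP[l h].
by rewrite (le_trans ll l) (lt_le_trans h hh).
Qed.

Lemma Lam1_graded k m q : k = m + q ->
  Lam1 T U Lam k m = graded_in q m (m + 1).
Proof.
move=> ->; apply/seteqP; split=> [w wL|w [wL wS] C].
  split=> C; have := wL C; rewrite activeE.
    case: (boolP (live C)) => [/andP[CT _]|//] /=.
    by case: eqVneq => [->|_ ->] //; apply: Lam0.
  by case: ifP => [/andP[_ /eqP <-] _ _|_ ->]; rewrite ?eqxx // lexx ltrDl ltr01.
rewrite activeE; have := wL C; case: (boolP (live C)) => //= Cl.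
case: eqVneq => [-> //|dC _]; apply/eqP; apply: contra_neqT dC => /wS dC.
by apply/eqP; rewrite eq_le -ltzD1 andbC.
Qed.

Definition diff_sum q w : cochain R n := fun C =>
  if live C then dC (sdim C + q) C (w C) else 0.

Lemma dC_lin k C : C \in T -> linear_on (Lam k C) (dC k C).
Proof.
move=> CT; apply: dC_linear; first exact: (Lam_smooth Lam_spaces).
exact: (Lam_subspace Lam_spaces).
Qed.

Lemma dC0 k C : C \in T -> dC k C 0 = 0.
Proof.
move=> CT; apply: (linear_on0 (Lam_subspace Lam_spaces k CT)); exact: dC_lin.
Qed.

(** By local exactness in degree [k + 1], exact forms are closed. *)
Lemma dC_dC k C (w : dform R n) : live C -> Lam k C w ->
  dC (k + 1) C (dC k C w) = 0.
Proof.
move=> /andP[CT CU] wL; have [_ Lam_out Lam_d _] := Lam_spaces.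
have dL : Lam (k + 1) C (dC k C w) by apply: Lam_d.
have [k0|k0] := ltP k 0.
  by move: wL; rewrite Lam_out //; [move=> ->; rewrite !dC0|left].
have [kC|kC] := ltP (sdim C) (k + 1).
  by move: dL; rewrite Lam_out //; [move=> ->; rewrite !dC0|right].
have [_ /(_ (k + 1))] := exactness CT CU; rewrite kC andbT addrK => H.
have : [set w' | Lam (k + 1) C w' /\ dC (k + 1) C w' = 0] (dC k C w).
  by rewrite H; [exists w|rewrite lerDr].
by case.
Qed.

Lemma dC_exact k C (w : dform R n) : live C -> 1 <= k -> Lam k C w -> dC k C w = 0 ->
  exists2 v, Lam (k - 1) C v & w = dC (k - 1) C v.
Proof.
move=> /andP[CT CU] k1 wL dw; have [_ Lam_out _ _] := Lam_spaces.
have [kC|kC] := ltP (sdim C) k.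
  move: wL; rewrite Lam_out //; last by right.
  by move=> ->; exists 0; [exact: Lam0|rewrite dC0].
have [_ /(_ k)] := exactness CT CU; rewrite k1 kC => /(_ isT) H.
have : [set w' | Lam k C w' /\ dC k C w' = 0] w by [].
by rewrite H => -[v vL <-]; exists v.
Qed.

Lemma diff_sum_linear q : linear_on (graded q) (diff_sum q).
Proof.
move=> a u v uL vL; apply/funext => C.
transitivity (a *: diff_sum q u C + diff_sum q v C) => //.
have := uL C; have := vL C; rewrite /diff_sum.
case: (boolP (live C)) => [/andP[CT _] vC uC|_ _ _]; last by rewrite scaler0 addr0.
exact: dC_lin.
Qed.

Lemma diff_sum_graded q w : graded q w -> graded (q + 1) (diff_sum q w).
Proof.
move=> wL C; have := wL C; rewrite /diff_sum.
case: (boolP (live C)) => [/andP[CT _] wC|//]; rewrite addrA.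
by have [_ _ H _] := Lam_spaces; apply: H.
Qed.

Lemma trace_sum_graded q w : graded q w -> graded (q + 1) (trace_sum w).
Proof.
move=> wL F; rewrite /trace_sum; case: (boolP (live F)) => // Fl.
have /andP[FT _] := Fl; have Lsub := Lam_subspace Lam_spaces (sdim F + (q + 1)) FT.
apply: (subspace_sum Lsub) => C _; have [->|FC] := eqVneq (facet_coef F C) 0.
  by rewrite scale0r; apply: subspace0.
have [Cl dC FsC _] := facet_coef_neq0 FC; have /andP[CT _] := Cl.
apply: (subspaceZ Lsub); apply: (Lam_trace Lam_spaces CT (psubsimplexE FsC)).
by have := wL C; rewrite Cl dC -addrA [1 + q]addrC.
Qed.

Lemma diff_sum_sum q w : graded q w -> diff_sum (q + 1) (diff_sum q w) = 0.
Proof.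
move=> wL; apply/funext => C; have := wL C; rewrite /diff_sum.
by case: (boolP (live C)) => // Cl wC; rewrite addrA dC_dC.
Qed.

Lemma diff_trace_sum q w : graded q w ->
  diff_sum (q + 1) (trace_sum w) = trace_sum (diff_sum q w).
Proof.
move=> wL; apply/funext => F; rewrite /diff_sum /trace_sum.
case: (boolP (live F)) => // Fl; have /andP[FT _] := Fl.
have Lsub := Lam_subspace Lam_spaces (sdim F + (q + 1)) FT.
have term C : Lam (sdim F + (q + 1)) F (facet_coef F C *: restrict_form F (w C)).
  have [->|FC] := eqVneq (facet_coef F C) 0.
    by rewrite scale0r; apply: subspace0.
  have [Cl dC FsC _] := facet_coef_neq0 FC; have /andP[CT _] := Cl.
  apply: (subspaceZ Lsub); apply: (Lam_trace Lam_spaces CT (psubsimplexE FsC)).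
  by have := wL C; rewrite Cl dC -addrA [1 + q]addrC.
have dlin := @dC_lin (sdim F + (q + 1)) F FT.
rewrite (linear_on_sum Lsub) //; apply: eq_bigr => C _.
have := term C; have [->|FC] := eqVneq (facet_coef F C) 0.
  by rewrite !scale0r dC0.
have [Cl dC FsC _] := facet_coef_neq0 FC; have /andP[CT _] := Cl.
have FCs : (F `<=` C)%fset by case/andP: FsC => /andP[].
have wC : Lam (sdim F + (q + 1)) C (w C).
  by have := wL C; rewrite Cl dC -addrA [1 + q]addrC.
move=> _; rewrite (linear_onZ Lsub) //; last first.
  exact: (Lam_trace Lam_spaces CT (psubsimplexE FsC)).
rewrite Cl; have -> : sdim C + q = sdim F + (q + 1) by rewrite dC -addrA [1 + q]addrC.
have := trace_dC FCs (Lam_smooth Lam_spaces CT wC).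
by rewrite /trace_form => ->.
Qed.

Definition sgn p : R := (-1) ^+ `|(n%:Z - p)%R|%N.

Lemma sgn_sq p : sgn p * sgn p = 1.
Proof. by rewrite /sgn -expr2 sqrr_sign. Qed.

Lemma sgn_neq0 p : sgn p != 0.
Proof. by rewrite signr_eq0. Qed.

Lemma sgnS p : p + 1 <= n%:Z -> sgn (p + 1) = - sgn p.
Proof.
move=> pn; rewrite /sgn; have -> : `|(n%:Z - p)%R|%N = `|(n%:Z - (p + 1))%R|%N.+1 by lia.
by rewrite exprS mulN1r opprK.
Qed.

Definition signed w : cochain R n := fun C => sgn (sdim C) *: w C.

(** The distributional exterior derivative; the alternating signs turn the
    commuting operators into anticommuting ones. *)
Definition total q w : cochain R n := signed (diff_sum q w + trace_sum w).

Lemma signedP (a : R) v w : signed (a *: v + w) = a *: signed v + signed w.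
Proof.
apply/funext => C.
transitivity (sgn (sdim C) *: (a *: v C + w C)) => //.
by rewrite scalerDr scalerA mulrC -scalerA.
Qed.

Lemma signed0 : signed 0 = 0.
Proof. by have := signedP (-1) 0 0; rewrite scaler0 addr0 scaleN1r addNr. Qed.

Lemma signed_graded q w : graded q w -> graded q (signed w).
Proof.
move=> wL C; have := wL C; rewrite /signed.
case: (boolP (live C)) => [/andP[CT _] wC|_ ->]; last by rewrite scaler0.
exact: (subspaceZ (Lam_subspace Lam_spaces _ CT)).
Qed.

Lemma total_linear q : linear_on (graded q) (total q).
Proof.
move=> a u v uL vL; rewrite /total diff_sum_linear // trace_sumP.
by rewrite addrACA -scalerDr signedP.
Qed.

Lemma total_graded q w : graded q w -> graded (q + 1) (total q w).
Proof.
move=> wL; apply: signed_graded; apply: (subspaceD (graded_sub (q + 1))).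
  exact: diff_sum_graded.
exact: trace_sum_graded.
Qed.

Lemma diff_sum_signed q w : graded q w ->
  diff_sum q (signed w) = signed (diff_sum q w).
Proof.
move=> wL; apply/funext => C; have := wL C; rewrite /diff_sum /signed.
case: (boolP (live C)) => [/andP[CT _] wC|]; last by rewrite scaler0.
by rewrite (linear_onZ (Lam_subspace Lam_spaces (sdim C + q) CT)) //; exact: dC_lin.
Qed.

Lemma trace_sum_signed w : trace_sum (signed w) = - signed (trace_sum w).
Proof.
apply/funext => F; transitivity (- (sgn (sdim F) *: trace_sum w F)) => //.
rewrite /trace_sum; case: (boolP (live F)) => Fl; last by rewrite scaler0 oppr0.
rewrite -scaleNr scaler_sumr; apply: eq_bigr => C _.
have [->|FC] := eqVneq (facet_coef F C) 0; first by rewrite !scale0r scaler0.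
have [/andP[CT _] dC _ _] := facet_coef_neq0 FC.
have /andP[_ dn] := sdim_bounds CT.
by rewrite /signed restrict_formZ dC sgnS -?dC // !scalerA mulrC.
Qed.

Lemma total_total q w : graded q w -> total (q + 1) (total q w) = 0.
Proof.
move=> wL; have dL := diff_sum_graded wL; have tL := trace_sum_graded wL.
pose u := diff_sum q w + trace_sum w.
transitivity (signed (diff_sum (q + 1) (signed u) + trace_sum (signed u))) => //.
rewrite diff_sum_signed; last by apply: (subspaceD (graded_sub (q + 1))).
rewrite trace_sum_signed /u.
rewrite (linear_onD (@diff_sum_linear (q + 1))) //.
rewrite (linear_onD (@trace_sum_linear _ _ T U ori setT)) //.
rewrite diff_sum_sum // (trace_sum_sum T_complex U_complex ori_orients).
by rewrite diff_trace_sum // addr0 add0r subrr signed0.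
Qed.

Lemma total_support q lo hi w : graded_in q lo hi w ->
  graded_in (q + 1) (lo - 1) hi (total q w).
Proof.
move=> [wL wS]; split; first exact: total_graded.
move=> F; apply: contraNT => nF; apply/eqP.
have wF : w F = 0.
  apply/eqP; apply: contraNT nF => /wS /andP[lF ->]; rewrite andbT.
  by apply: le_trans lF; rewrite gerBl.
transitivity (sgn (sdim F) *: (diff_sum q w F + trace_sum w F)) => //.
rewrite /diff_sum /trace_sum wF; case: (boolP (live F)) => [/andP[FT _]|_]; last first.
  by rewrite addr0 scaler0.
rewrite dC0 // add0r big1 ?scaler0 // => C _.
have [->|FC] := eqVneq (facet_coef F C) 0; first by rewrite scale0r.
have [_ dC _ _] := facet_coef_neq0 FC.
have [->|/wS] := eqVneq (w C) 0; first by rewrite restrict_form0 scaler0.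
by rewrite dC => wC; case/negP: nF; move: wC; lia.
Qed.

Lemma total_single q m w : graded_in q m (m + 1) w ->
  total q w = sgn m *: Dmap T U (m + q) m w + sgn (m - 1) *: Tmap T U ori (m + q) m w.
Proof.
move=> [wL wS]; apply/funext => F.
transitivity (sgn m *: Dmap T U (m + q) m w F
  + sgn (m - 1) *: Tmap T U ori (m + q) m w F) => //.
transitivity (sgn (sdim F) *: (diff_sum q w F + trace_sum w F)) => //.
have w0 C : sdim C != m -> w C = 0.
  move=> dC; apply/eqP; apply: contraNT dC => /wS.
  by rewrite ltzD1 -eq_le eq_sym.
rewrite /Dmap /Tmap !activeE /diff_sum /trace_sum.
case: (boolP (live F)) => [Fl|_] /=; last by rewrite addr0 !scaler0 addr0.
have /andP[FT _] := Fl; rewrite scalerDr; congr (_ + _).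
  by have [->|/w0 ->] := eqVneq (sdim F) m; rewrite // dC0 // !scaler0.
have [dF|dF] := eqVneq (sdim F) (m - 1); last first.
  rewrite big1 ?scaler0 // => C _.
  have [->|FC] := eqVneq (facet_coef F C) 0; first by rewrite scale0r.
  have [_ dC _ _] := facet_coef_neq0 FC.
  rewrite w0 ?restrict_form0 ?scaler0 // dC; apply: contraNneq dF => <-.
  by rewrite addrK.
rewrite dF; congr (_ *: _); rewrite [RHS]big_mkcond; apply: eq_bigr => C _.
rewrite activeE /facet_coef dF subrK -andbA.
by case: ifP => // _; rewrite scale0r.
Qed.

(** The two parts of the derivative live on cells of different dimensions. *)
Lemma total_single_eq0 q m w : graded_in q m (m + 1) w ->
  total q w = 0 <->
  Dmap T U (m + q) m w = 0 /\ Tmap T U ori (m + q) m w = 0.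
Proof.
move=> wW; rewrite (total_single wW); split=> [H|[-> ->]]; last first.
  by rewrite !scaler0 addr0.
have HC C : sgn m *: Dmap T U (m + q) m w C
    + sgn (m - 1) *: Tmap T U ori (m + q) m w C = 0 by rewrite -[RHS](congr1 (@^~ C) H).
split; apply/funext => C; have := HC C; rewrite /Dmap /Tmap !activeE.
  have [->|] := eqVneq (sdim C) m; last by rewrite andbF.
  have -> : (m == m - 1) = false by lia.
  rewrite !andbF scaler0 addr0 => /eqP; rewrite scaler_eq0 (negbTE (sgn_neq0 _)).
  by move/eqP.
have [->|] := eqVneq (sdim C) (m - 1); last by rewrite andbF.
have -> : (m - 1 == m) = false by lia.
rewrite !andbF scaler0 add0r => /eqP; rewrite scaler_eq0 (negbTE (sgn_neq0 _)).
by move/eqP.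
Qed.

Lemma ddistE k w : ddist T U ori k w = total (k - n%:Z) w.
Proof.
apply/funext => C; rewrite /ddist fct_sumE.
transitivity (sgn (sdim C) *: (diff_sum (k - n%:Z) w C + trace_sum w C)) => //.
pose Dt (i : nat) := (-1) ^+ i *: Dmap T U (k - i%:Z) (n%:Z - i%:Z)
  (comp_at T U (n%:Z - i%:Z) w) C.
pose Tt (i : nat) := (-1) ^+ i *: Tmap T U ori (k - i%:Z) (n%:Z - i%:Z)
  (comp_at T U (n%:Z - i%:Z) w) C.
transitivity (\sum_(i < n.+1) (Dt i - Tt i)) => //.
rewrite sumrB scalerDr; rewrite /diff_sum /trace_sum.
have [Cl|Cl] := boolP (live C); last first.
  rewrite !big1 ?subr0 ?scaler0 ?addr0 // => i _; rewrite /Dt /Tt /Dmap /Tmap;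
  by rewrite activeE (negbTE Cl) scaler0.
have /andP[CT _] := Cl; have /andP[d0 dn] := sdim_bounds CT.
have [i iE] : exists i : nat, sdim C = n%:Z - i%:Z.
  by exists `|(n%:Z - sdim C)%R|%N; lia.
have iltn : (i < n.+1)%N by lia.
congr (_ + _).
  rewrite (bigD1 (Ordinal iltn)) //= big1 ?addr0 => [|j ji]; last first.
    rewrite /Dt /Dmap activeE iE (inj_eq (addrI _)) eqr_opp eqz_nat.
    have -> : (i == j) = false by apply/negbTE; rewrite eq_sym.
    by rewrite andbF scaler0.
  rewrite /Dt /Dmap activeE Cl iE eqxx /comp_at activeE Cl iE eqxx /=.
  rewrite /sgn; have -> : `|(n%:Z - (n%:Z - i%:Z))%R|%N = i by lia.
  by have -> : n%:Z - i%:Z + (k - n%:Z) = k - i%:Z by ring.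
case: i iE iltn => [|i] iE iltn.
  rewrite !big1 ?oppr0 ?scaler0 // => [D _|j _].
    have [->|CD] := eqVneq (facet_coef C D) 0; first by rewrite scale0r.
    have [/andP[DT _] dD _ _] := facet_coef_neq0 CD.
    by have := sdim_bounds DT; rewrite dD iE; lia.
  rewrite /Tt /Tmap activeE; have -> : (sdim C == n%:Z - j%:Z - 1) = false.
    by apply/negbTE/eqP; rewrite iE; lia.
  by rewrite andbF scaler0.
rewrite (bigD1 (Ordinal (ltnW iltn))) //= big1 ?addr0 => [|j ji]; last first.
  rewrite /Tt /Tmap activeE; have -> : (sdim C == n%:Z - j%:Z - 1) = false.
    apply/negbTE/eqP; rewrite iE => H; case/eqP: ji; apply: val_inj => /=; lia.
  by rewrite andbF scaler0.
rewrite /Tt /Tmap activeE Cl iE.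
have -> : n%:Z - i.+1%:Z = n%:Z - i%:Z - 1 by lia.
rewrite eqxx /= -scaleNr /sgn; have -> : `|(n%:Z - (n%:Z - i%:Z - 1))%R|%N = i.+1 by lia.
rewrite exprS mulN1r; congr (_ *: _); rewrite big_mkcond; apply: eq_bigr => D _.
rewrite activeE /facet_coef iE -andbA.
have -> : n%:Z - i.+1%:Z + 1 = n%:Z - i%:Z by lia.
case: and3P => [[Dl /eqP dD CD]|_]; last by rewrite scale0r.
by rewrite /comp_at activeE Dl dD eqxx.
Qed.

End TotalComplex.

(** * The two filtrations of the total complex *)

Section Filtrations.
Context {R : realType} {n : nat}.
Implicit Types (C D E F G : simplex R n) (k m p q lo hi : int) (b : nat)
  (v w : cochain R n).
Variables (T U : {fset simplex R n}).
Variable ori : simplex R n -> seq 'rV[R]_n -> R.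
Variable Lam : int -> simplex R n -> set (dform R n).
Variable sp : int -> int -> cochain R n -> cochain R n -> R.

Hypothesis T_complex : simplicial_complex T.
Hypothesis T_dim : dimensional n%:Z T.
Hypothesis U_complex : simplicial_complex U.
Hypothesis ori_orients : forall C, C \in T -> orients (ori C) C.
Hypothesis Lam_spaces : admissible_spaces T Lam.
Hypothesis exactness : local_exactness_condition T U Lam.
Hypothesis sp_scalar :
  forall k m : int, scalar_product (Lam1 T U Lam k m) (sp k m).

Local Notation live := (live T U).
Local Notation trace_sum := (trace_sum T U ori).
Local Notation facet_coef := (facet_coef T U ori).
Local Notation graded := (graded T U Lam).
Local Notation graded_in := (graded_in T U Lam).
Local Notation diff_sum := (diff_sum T U).
Local Notation total := (total T U ori).
Local Notation comp_at := (comp_at T U).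
Local Notation sgn := (@sgn R n).

Lemma graded_in_support q lo hi w C : graded_in q lo hi w ->
  ~~ (lo <= sdim C < hi) -> w C = 0.
Proof. by move=> [_ wS] nC; apply/eqP; apply: contraNT nC => /wS. Qed.

Lemma graded_live q w C : graded q w -> w C != 0 -> live C.
Proof. by move=> /(_ C); case: ifP => // _ ->; rewrite eqxx. Qed.

Lemma comp_at_linear m (S : set (cochain R n)) : linear_on S (comp_at m).
Proof.
move=> a u v _ _; apply/funext => C.
transitivity (a *: comp_at m u C + comp_at m v C) => //.
by rewrite /comp_at; case: ifP => // _; rewrite scaler0 addr0.
Qed.

Lemma comp_at_Lam1 k m q w : k = m + q -> graded q w ->
  Lam1 T U Lam k m (comp_at m w).
Proof.
move=> -> wL C; rewrite /comp_at; have := wL C; rewrite activeE.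
case: (boolP (live C)) => //= _ wC.
by have [<-|] := eqVneq (sdim C) m.
Qed.

Lemma comp_at_id k m w : Lam1 T U Lam k m w -> comp_at m w = w.
Proof.
by move=> wL; apply/funext => C; rewrite /comp_at; have := wL C; case: ifP.
Qed.

Lemma sum_Lam1E b (mu kappa : 'I_b -> int) q lo hi :
  injective mu -> (forall j, kappa j = mu j + q) ->
  (forall p, lo <= p < hi <-> exists j, p = mu j) ->
  [set w | exists2 e : 'I_b -> cochain R n,
     forall j, Lam1 T U Lam (kappa j) (mu j) (e j) & w = \sum_j e j]
  = graded_in q lo hi.
Proof.
move=> mu_inj kE muP; apply/seteqP; split=> [_ [e eL ->]|w [wL wS]].
  apply: (subspace_sum (graded_in_sub U Lam_spaces q lo hi)) => j _.
  have := eL j; rewrite (Lam1_graded U Lam_spaces (kE j)) => -[ejL ejS].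
  split=> // C /ejS; rewrite ltzD1 -eq_le => /eqP <-.
  by apply/muP; exists j.
exists (fun j => comp_at (mu j) w) => [j|]; first exact: comp_at_Lam1.
apply/funext => C; rewrite fct_sumE.
have [w0|wC] := eqVneq (w C) 0.
  by rewrite w0 big1 // => j _; rewrite /comp_at w0 if_same.
have /muP [j jE] := wS _ wC.
rewrite (bigD1 j) //= /comp_at activeE (graded_live wL wC) jE eqxx.
rewrite big1 ?addr0 // => i ij; rewrite activeE jE (inj_eq mu_inj) eq_sym.
by rewrite (negbTE ij) andbF.
Qed.

Lemma LamE k b : Lam_ T U ori Lam k n%:Z b.+1 =
  graded_in (k - n%:Z) (n%:Z + 1 - b.+1%:Z) (n%:Z + 1).
Proof.
apply: sum_Lam1E => [i j H|j|p]; first by apply: val_inj => /=; lia.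
  by ring.
split=> [/andP[l h]|[j ->]]; last by have := ltn_ord j; lia.
have H : (`|(n%:Z - p)%R|%N < b.+1)%N by lia.
by exists (Ordinal H) => /=; lia.
Qed.

Lemma GamE k m b : Gam_ T U Lam k m b.+1 =
  graded_in (k - m) m (m + b.+1%:Z).
Proof.
apply: sum_Lam1E => [i j H|j|p]; first by apply: val_inj => /=; lia.
  by ring.
split=> [/andP[l h]|[j ->]]; last by have := ltn_ord j; lia.
have H : (`|(p - m)%R|%N < b.+1)%N by lia.
by exists (Ordinal H) => /=; lia.
Qed.

Lemma sp_sum_scalar b (mu kappa : 'I_b -> int) q lo hi :
  (forall j, kappa j = mu j + q) ->
  (forall p, lo <= p < hi -> exists j, p = mu j) ->
  scalar_product (graded_in q lo hi) (fun v w =>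
    \sum_j sp (kappa j) (mu j) (comp_at (mu j) v) (comp_at (mu j) w)).
Proof.
move=> kE muP.
have cL j w : graded_in q lo hi w -> Lam1 T U Lam (kappa j) (mu j) (comp_at (mu j) w).
  by move=> [wL _]; apply: comp_at_Lam1.
split=> [u v uW vW|a u v w uW vW wW|u uW u0].
- apply: eq_bigr => j _; have [spC _ _] := sp_scalar (kappa j) (mu j).
  by rewrite spC //; apply: cL.
- rewrite mulr_sumr -big_split; apply: eq_bigr => j _ /=.
  have [_ spL _] := sp_scalar (kappa j) (mu j).
  by rewrite (@comp_at_linear _ setT) // spL //; apply: cL.
have [C uC] : exists C, u C != 0.
  apply: contrapT => H; case/eqP: u0; apply/funext => C.
  by apply/eqP/negPn/negP => uC; apply: H; exists C.
have [uL uS] := uW; have [j jE] := muP _ (uS _ uC).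
have pos i : comp_at (mu i) u != 0 ->
    0 < sp (kappa i) (mu i) (comp_at (mu i) u) (comp_at (mu i) u).
  by have [_ _ H] := sp_scalar (kappa i) (mu i); apply: H; apply: cL.
have nneg i : 0 <= sp (kappa i) (mu i) (comp_at (mu i) u) (comp_at (mu i) u).
  have [c0|/pos/ltW //] := eqVneq (comp_at (mu i) u) 0.
  have [_ spL _] := sp_scalar (kappa i) (mu i).
  have := spL 1 _ _ _ (cL i u uW) (cL i u uW) (cL i u uW).
  by rewrite c0 scaler0 addr0 mul1r => /esym/(canRL (addrK _)); rewrite subrr => ->.
have uj : comp_at (mu j) u != 0.
  apply/eqP => /(congr1 (@^~ C)); rewrite /comp_at activeE.
  by rewrite (graded_live uL uC) jE eqxx /= => uC0; rewrite uC0 eqxx in uC.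
by rewrite (bigD1 j) //= ltr_pwDl ?sumr_ge0 //; apply: pos.
Qed.

Lemma graded_in_fin q lo hi : fin_spanned (graded_in q lo hi).
Proof.
pose embed C (u : dform R n) : cochain R n := fun D => if D == C then u else 0.
have embedL C : linear_on setT (embed C).
  move=> a u v _ _; apply/funext => D.
  transitivity (a *: embed C u D + embed C v D) => //.
  by rewrite /embed; case: ifP => // _; rewrite scaler0 addr0.
pose S C := if C \in T then embed C @` Lam (sdim C + q) C else [set 0].
have Sfin C : fin_spanned (S C).
  rewrite /S; case: ifP => CT; last by exists [::].
  apply: fin_spanned_image; first exact: embedL.
  by apply: fin_dim_spanned; have [H _ _ _] := Lam_spaces; have [] := H (sdim C + q) C CT.
apply: fin_spannedS (fin_spanned_sum (enum_fset T) Sfin) => w [wL _].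
exists (fun C => if C \in T then embed C (w C) else 0) => [C|].
  rewrite /S; case: ifP => // CT; exists (w C) => //.
  have := wL C; case: ifP => // _ ->; exact: (Lam0 Lam_spaces).
apply/funext => D; rewrite fct_sumE.
have [DT|DT] := boolP (D \in T).
  rewrite (bigD1_seq D) ?fset_uniq //= DT /embed eqxx big1 ?addr0 // => C CD.
  by case: ifP => // _; rewrite eq_sym (negbTE CD).
have -> : w D = 0.
  by have := wL D; rewrite /live (negbTE DT).
rewrite big1_seq // => C /andP[_ CT]; rewrite CT /embed; case: eqP => // DC.
by rewrite DC CT in DT.
Qed.

(** The distributional forms on the [b] highest, respectively the [b] lowest
    dimensions of cells that occur; the lowest dimension is [- q] because forms
    of degree [0] live there. *)
Definition codim_level q b := graded_in q (n%:Z + 1 - b%:Z) (n%:Z + 1).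
Definition dim_level q b := graded_in q (- q) (- q + b%:Z).

Lemma total_linear_in q lo hi : linear_on (graded_in q lo hi) (total q).
Proof. by apply: linear_on_sub (total_linear ori Lam_spaces (q := q)) => w []. Qed.

Lemma codim_level_mono q b : codim_level q b `<=` codim_level q b.+1.
Proof. by apply: graded_inS => //; lia. Qed.

Lemma dim_level_mono q b : dim_level q b `<=` dim_level q b.+1.
Proof. by apply: graded_inS => //; lia. Qed.

Lemma codim_level_total q b w : codim_level q b w ->
  codim_level (q + 1) b.+1 (total q w).
Proof. by move/(total_support ori Lam_spaces); apply: graded_inS => //; lia. Qed.

Lemma dim_level_total q b w : dim_level q b w ->
  dim_level (q + 1) b.+1 (total q w).
Proof. by move/(total_support ori Lam_spaces); apply: graded_inS => //; lia. Qed.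

Lemma total_total_in q lo hi w : graded_in q lo hi w ->
  total (q + 1) (total q w) = 0.
Proof. by move=> [wL _]; apply: (total_total T_complex T_dim U_complex ori_orients Lam_spaces exactness wL). Qed.

Hypothesis decomposition : geometric_decomposition_condition T Lam.
Hypothesis patches : local_patch_condition ori T U.

Lemma totalE q w C : total q w C = sgn (sdim C) *: (diff_sum q w C + trace_sum w C).
Proof. by []. Qed.

(** The trace complex removes the components on the cells of lowest dimension. *)
Lemma codim_level_exact q b x : codim_level q b.+2 x ->
  codim_level (q + 1) b.+2 (total q x) ->
  exists2 y, codim_level (q - 1) b.+1 y & codim_level q b.+1 (x - total (q - 1) y).
Proof.
move=> xW tW; set p := n%:Z + 1 - b.+2%:Z.
have [xL xS] := xW.
have xpL : Lam1 T U Lam (p + q) p (comp_at p x) by apply: comp_at_Lam1.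
have facet_x F C : facet_coef F C != 0 -> sdim F = p - 1 -> comp_at p x C = x C.
  move=> /facet_coef_neq0 [Cl dC _ _] dF.
  by rewrite /comp_at activeE Cl dC dF subrK eqxx.
have tx0 : trace_sum (comp_at p x) = 0.
  apply/funext => F; rewrite /trace_sum; case: (boolP (live F)) => // Fl.
  have /andP[FT _] := Fl.
  have [dF|dF] := eqVneq (sdim F) (p - 1); last first.
    rewrite big1 // => C _.
    have [->|FC] := eqVneq (facet_coef F C) 0; first by rewrite scale0r.
    have [_ dC _ _] := facet_coef_neq0 FC.
    rewrite /comp_at activeE dC; case: ifP => [/andP[_ /eqP H]|_].
      by case/eqP: dF; rewrite -H addrK.
    by rewrite restrict_form0 scaler0.
  have xF : x F = 0 by apply: (graded_in_support xW); rewrite dF /p; lia.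
  have : total q x F = 0 by apply: (graded_in_support tW); rewrite dF /p; lia.
  rewrite totalE /diff_sum Fl xF (dC0 Lam_spaces) // add0r.
  move=> /eqP; rewrite scaler_eq0 (negbTE (sgn_neq0 _)) => /eqP.
  rewrite /trace_sum Fl => H; rewrite -[RHS]H; apply: eq_bigr => C _.
  have [->|FC] := eqVneq (facet_coef F C) 0; first by rewrite !scale0r.
  by rewrite (facet_x _ _ FC dF).
have [|v vL vE] := trace_sum_exact T_complex T_dim U_complex ori_orients Lam_spaces
  decomposition patches _ xpL tx0; first by rewrite /p; lia.
have vW : graded_in (q - 1) (p + 1) (p + 1 + 1) v.
  by rewrite -(Lam1_graded U Lam_spaces (k := p + q)) //; ring.
have yW : graded_in (q - 1) (p + 1) (p + 1 + 1) (sgn p *: v).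
  exact: (subspaceZ (graded_in_sub U Lam_spaces _ _ _)).
have tyW := total_support ori Lam_spaces yW; rewrite subrK addrK in tyW.
exists (sgn p *: v); first by apply: graded_inS yW; rewrite /p; lia.
have dW : graded_in q p (n%:Z + 1) (x - total (q - 1) (sgn p *: v)).
  apply: (subspaceB (graded_in_sub U Lam_spaces _ _ _)); first exact: xW.
  by apply: graded_inS tyW => //; rewrite /p; lia.
have [dL dS] := dW; split=> // C zC; have /andP[l h] := dS _ zC.
rewrite h andbT; have [dC|dC] := eqVneq (sdim C) p; last by move: l dC; rewrite /p; lia.
case/eqP: zC; transitivity (x C - total (q - 1) (sgn p *: v) C) => //.
have y0 : (sgn p *: v) C = 0 by apply: (graded_in_support yW); rewrite dC; lia.
have xpC : comp_at p x C = x C.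
  rewrite /comp_at activeE dC eqxx andbT; case: ifP => // Cl.
  by have := xL C; rewrite Cl.
have [Cl|Cl] := boolP (live C); last first.
  rewrite totalE /diff_sum /trace_sum (negbTE Cl) addr0 scaler0 subr0.
  by have := xL C; rewrite (negbTE Cl).
have /andP[CT _] := Cl.
rewrite totalE /diff_sum Cl y0 (dC0 Lam_spaces) // add0r dC.
have -> : trace_sum (sgn p *: v) C = sgn p *: trace_sum v C.
  exact: (congr1 (@^~ C) (linear_onZ (subspaceT _) (sgn p)
    (@trace_sum_linear _ _ T U ori setT) (I : setT v))).
by rewrite -vE xpC scalerA sgn_sq scale1r subrr.
Qed.

(** Local exactness removes the components on the cells of highest dimension. *)
Lemma dim_level_exact q b x : dim_level q b.+2 x ->
  dim_level (q + 1) b.+2 (total q x) ->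
  exists2 y, dim_level (q - 1) b.+1 y & dim_level q b.+1 (x - total (q - 1) y).
Proof.
move=> xW tW; set p := - q + b.+1%:Z; have [xL xS] := xW.
have dx C : live C -> sdim C = p -> dC (sdim C + q) C (x C) = 0.
  move=> Cl dC; have tC : total q x C = 0.
    by apply: (graded_in_support tW); rewrite dC /p; lia.
  have trC : trace_sum x C = 0.
    rewrite /trace_sum Cl big1 // => D _.
    have [->|CD] := eqVneq (facet_coef C D) 0; first by rewrite scale0r.
    have [_ dD _ _] := facet_coef_neq0 CD.
    rewrite (graded_in_support xW) ?restrict_form0 ?scaler0 // dD dC /p; lia.
  move: tC; rewrite totalE /diff_sum Cl trC addr0 => /eqP.
  by rewrite scaler_eq0 (negbTE (sgn_neq0 _)) => /eqP.
pose P C := [set v | Lam (sdim C + q - 1) C v /\ x C = dC (sdim C + q - 1) C v].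
have PE C : live C -> sdim C = p -> P C (xget 0 (P C)).
  move=> Cl dC; apply: xgetPex.
  have [||v vL vE] := dC_exact Lam_spaces exactness Cl _ _ (dx C Cl dC).
  - by rewrite dC /p; lia.
  - by have := xL C; rewrite Cl.
  by exists v.
pose y C := if live C && (sdim C == p) then sgn p *: xget 0 (P C) else 0.
have yW : graded_in (q - 1) p (p + 1) y.
  split=> C; rewrite /y.
    case: (boolP (live C)) => //= Cl; have /andP[CT _] := Cl.
    case: eqP => [dC|_]; last exact: (Lam0 Lam_spaces).
    rewrite addrA; apply: (subspaceZ (Lam_subspace Lam_spaces _ CT)).
    by case: (PE C Cl dC).
  case: ifP => [/andP[_ /eqP -> _]|_]; last by rewrite eqxx.
  by rewrite lexx ltrDl ltr01.
have tyW := total_support ori Lam_spaces yW; rewrite subrK in tyW.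
exists y; first by apply: graded_inS yW; rewrite /p; lia.
have dW : graded_in q (- q) (- q + b.+2%:Z) (x - total (q - 1) y).
  apply: (subspaceB (graded_in_sub U Lam_spaces _ _ _)); first exact: xW.
  by apply: graded_inS tyW => //; rewrite /p; lia.
have [dL dS] := dW; split=> // C zC; have /andP[l h] := dS _ zC.
rewrite l /=; have [dC|dC] := eqVneq (sdim C) p; last by move: h dC; rewrite /p; lia.
case/eqP: zC; have [Cl|Cl] := boolP (live C); last first.
  by have := dL C; rewrite (negbTE Cl).
transitivity (x C - total (q - 1) y C) => //.
have /andP[CT _] := Cl; have [vL vE] := PE C Cl dC.
have trC : trace_sum y C = 0.
  rewrite /trace_sum Cl big1 // => D _.
  have [->|CD] := eqVneq (facet_coef C D) 0; first by rewrite scale0r.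
  have [_ dD _ _] := facet_coef_neq0 CD.
  rewrite (graded_in_support yW) ?restrict_form0 ?scaler0 // dD dC /p; lia.
rewrite totalE /diff_sum trC addr0 Cl {1}/y Cl dC eqxx /=.
rewrite -dC addrA (linear_onZ (Lam_subspace Lam_spaces _ CT) _ (dC_lin Lam_spaces CT)) //.
by rewrite -vE scalerA sgn_sq scale1r subrr.
Qed.

(** * Harmonic spaces of the filtrations *)

Lemma codim_level_low q m w : graded_in q m (m + 1) w ->
  graded_in (q + 1) m (m + 1) (total q w) <-> Tmap T U ori (m + q) m w = 0.
Proof.
move=> wW; have tE := total_single ori Lam_spaces wW; split=> [tW|t0].
  apply/funext => F; rewrite /Tmap; case: ifP => // Fa.
  have := graded_in_support (C := F) tW; move: (Fa); rewrite activeE => /andP[Fl /eqP dF].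
  rewrite dF => /(_ _); case: (boolP (m <= m - 1 < m + 1)) => [|_]; first by lia.
  move=> /(_ isT); rewrite tE => tF.
  have : sgn m *: Dmap T U (m + q) m w F + sgn (m - 1) *: Tmap T U ori (m + q) m w F = 0.
    by rewrite -[RHS]tF.
  rewrite {1}/Dmap activeE dF; have -> : (m - 1 == m) = false by lia.
  rewrite andbF scaler0 add0r => /eqP; rewrite scaler_eq0 (negbTE (sgn_neq0 _)).
  by rewrite /Tmap Fa => /eqP.
split; first by apply: (total_graded ori Lam_spaces); case: wW.
move=> C; rewrite tE t0 scaler0 addr0.
have -> : (sgn m *: Dmap T U (m + q) m w) C = sgn m *: Dmap T U (m + q) m w C by [].
rewrite /Dmap activeE; have [->|] := eqVneq (sdim C) m.
  by rewrite lexx ltrDl ltr01.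
by rewrite andbF scaler0 eqxx.
Qed.

Lemma dim_level_low q m w : graded_in q m (m + 1) w ->
  graded_in (q + 1) (m - 1) m (total q w) <-> Dmap T U (m + q) m w = 0.
Proof.
move=> wW; have tE := total_single ori Lam_spaces wW; split=> [tW|t0].
  apply/funext => F; rewrite /Dmap; case: ifP => // Fa.
  have := graded_in_support (C := F) tW; move: (Fa); rewrite activeE => /andP[Fl /eqP dF].
  rewrite dF => /(_ _); case: (boolP (m - 1 <= m < m)) => [|_]; first by lia.
  move=> /(_ isT); rewrite tE => tF.
  have : sgn m *: Dmap T U (m + q) m w F + sgn (m - 1) *: Tmap T U ori (m + q) m w F = 0.
    by rewrite -[RHS]tF.
  rewrite {1}/Tmap activeE dF; have -> : (m == m - 1) = false by lia.
  rewrite andbF scaler0 addr0 => /eqP; rewrite scaler_eq0 (negbTE (sgn_neq0 _)).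
  by rewrite /Dmap Fa => /eqP.
split; first by apply: (total_graded ori Lam_spaces); case: wW.
move=> C; rewrite tE t0 scaler0 add0r.
have -> : (sgn (m - 1) *: Tmap T U ori (m + q) m w) C =
  sgn (m - 1) *: Tmap T U ori (m + q) m w C by [].
rewrite /Tmap activeE; have [->|] := eqVneq (sdim C) (m - 1).
  by rewrite lexx ltrBlDr ltrDl ltr01.
by rewrite andbF scaler0 eqxx.
Qed.

Lemma codim_level1 q : codim_level q 1 = graded_in q n%:Z (n%:Z + 1).
Proof. by rewrite /codim_level addrK. Qed.

Lemma dim_level1 q m : q = - m -> dim_level q 1 = graded_in q m (m + 1).
Proof. by move=> ->; rewrite /dim_level opprK. Qed.

Lemma Lam_level k b :
  Lam_ T U ori Lam k n%:Z b = level_chains codim_level total (k - n%:Z) b.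
Proof.
case: b => [|b]; last exact: LamE.
have kE : k = n%:Z + (k - n%:Z) by ring.
rewrite /= (Lam1_graded U Lam_spaces kE) !codim_level1.
by apply/seteqP; split=> w [wW /= tw]; split=> //; have H := codim_level_low wW;
   rewrite -kE in H; apply/H.
Qed.

Lemma Gam_level m b :
  Gam_ T U Lam 0 m b = level_chains dim_level total (- m) b.
Proof.
case: b => [|b]; last by rewrite GamE sub0r /= /dim_level opprK.
have kE : 0 = m - m :> int by rewrite subrr.
rewrite /= (Lam1_graded U Lam_spaces kE) (dim_level1 (m := m)) //.
rewrite (@dim_level1 (- m + 1) (m - 1)); last by ring.
rewrite subrK.
by apply/seteqP; split=> w [wW /= tw]; split=> //; have H := dim_level_low wW;
   rewrite -kE in H; apply/H.
Qed.

Lemma harm_H_harmonic k b : harm_H T U ori Lam sp k b.+1 =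
  harmonic (sp_Lam T U sp k n%:Z b.+1) (level_cycles codim_level total (k - n%:Z) b.+1)
    (level_boundaries codim_level total (k - n%:Z) b).
Proof.
have kE : k - 1 - n%:Z = k - n%:Z - 1 by ring.
have dE v : ddist T U ori (k - 1) v = total (k - n%:Z - 1) v.
  by rewrite (ddistE U ori T_complex T_dim) kE.
have LE : Lam_ T U ori Lam (k - 1) n%:Z b =
    level_chains codim_level total (k - n%:Z - 1) b by rewrite Lam_level kE.
rewrite /harm_H (Lam_level k b.+1) LE.
apply/seteqP; split=> w; rewrite /= (ddistE U ori T_complex T_dim).
  move=> [wL tw wv]; split=> [//|_ [v vL <-]].
  by have := wv v vL; rewrite dE.
move=> [[wL tw] wv]; split=> // v vL; rewrite dE; apply: wv.
by exists v.
Qed.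

Lemma harm_C_harmonic m b : harm_C T U ori Lam sp m b.+1 =
  harmonic (sp_Gam T U sp 0 m b.+1) (level_cycles dim_level total (- m) b.+1)
    (level_boundaries dim_level total (- m) b).
Proof.
have dE v : ddist T U ori (n%:Z - m - 1) v = total (- m - 1) v.
  have e : n%:Z - m - 1 - n%:Z = - m - 1 by ring.
  by rewrite (ddistE U ori T_complex T_dim) e.
have tE w : ddist T U ori (n%:Z - m) w = total (- m) w.
  have e : n%:Z - m - n%:Z = - m by ring.
  by rewrite (ddistE U ori T_complex T_dim) e.
have mE : - (m + 1) = - m - 1 by ring.
have GE : Gam_ T U Lam 0 (m + 1) b =
    level_chains dim_level total (- m - 1) b by rewrite Gam_level mE.
rewrite /harm_C (Gam_level m b.+1) GE.
apply/seteqP; split=> w; rewrite /= tE.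
  move=> [wL tw wv]; split=> [//|_ [v vL <-]].
  by have := wv v vL; rewrite dE.
move=> [[wL tw] wv]; split=> // v vL; rewrite dE; apply: wv.
by exists v.
Qed.

Lemma sp_Lam_scalar k b :
  scalar_product (codim_level (k - n%:Z) b) (sp_Lam T U sp k n%:Z b).
Proof.
apply: sp_sum_scalar => [j|p /andP[l h]]; first by ring.
have H : (`|(n%:Z - p)%R|%N < b)%N by lia.
by exists (Ordinal H) => /=; lia.
Qed.

Lemma sp_Gam_scalar m b :
  scalar_product (dim_level (- m) b) (sp_Gam T U sp 0 m b).
Proof.
apply: sp_sum_scalar => [j|p /andP[l h]]; first by ring.
have H : (`|(p - m)%R|%N < b)%N by lia.
by exists (Ordinal H) => /=; lia.
Qed.

Let codim_level_sub q b : is_subspace (codim_level q b).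
Proof. exact: (graded_in_sub U Lam_spaces). Qed.

Let dim_level_sub q b : is_subspace (dim_level q b).
Proof. exact: (graded_in_sub U Lam_spaces). Qed.

Let codim_level_fin q b : fin_spanned (codim_level q b).
Proof. exact: graded_in_fin. Qed.

Let dim_level_fin q b : fin_spanned (dim_level q b).
Proof. exact: graded_in_fin. Qed.

Let codim_level_linear q b : linear_on (codim_level q b) (total q).
Proof. exact: total_linear_in. Qed.

Let dim_level_linear q b : linear_on (dim_level q b) (total q).
Proof. exact: total_linear_in. Qed.

Let codim_level_dd q b x : codim_level q b x -> total (q + 1) (total q x) = 0.
Proof. exact: total_total_in. Qed.

Let dim_level_dd q b x : dim_level q b x -> total (q + 1) (total q x) = 0.
Proof. exact: total_total_in. Qed.

Lemma harm_H_iso k b :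
  lin_iso (harm_H T U ori Lam sp k b.+2) (harm_H T U ori Lam sp k b.+1).
Proof.
rewrite !harm_H_harmonic; apply: lin_iso_sym.
  exact: (level_harmonic_sub codim_level_sub codim_level_linear codim_level_total
    codim_level_dd (sp_Lam_scalar k b.+1)).
exact: (level_iso codim_level_sub codim_level_fin codim_level_mono
  codim_level_linear codim_level_total codim_level_dd codim_level_exact
  (sp_Lam_scalar k b.+1) (sp_Lam_scalar k b.+2)).
Qed.

Lemma harm_C_iso m b :
  lin_iso (harm_C T U ori Lam sp m b.+1) (harm_C T U ori Lam sp m b.+2).
Proof.
rewrite !harm_C_harmonic.
exact: (level_iso dim_level_sub dim_level_fin dim_level_mono
  dim_level_linear dim_level_total dim_level_dd dim_level_exact
  (sp_Gam_scalar m b.+1) (sp_Gam_scalar m b.+2)).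
Qed.

Lemma sp_scale k m (c : R) v w : c != 0 ->
  Lam1 T U Lam k m v -> Lam1 T U Lam k m w ->
  sp k m v (c *: w) = 0 <-> sp k m v w = 0.
Proof.
move=> c0 vL wL; have [spC spL _] := sp_scalar k m.
have Lsub := Lam1_subspace U Lam_spaces k m; have L0 := subspace0 Lsub.
have sp0 : sp k m 0 v = 0.
  have := spL 1 0 0 v L0 L0 vL; rewrite scale1r addr0 mul1r.
  by move/esym/(canRL (addrK _)); rewrite subrr.
have cwL : Lam1 T U Lam k m (c *: w) by apply: (subspaceZ Lsub).
have := spL c w 0 v wL L0 vL; rewrite addr0 sp0 addr0 spC // [sp k m w v]spC // => ->.
by split=> [/eqP|->]; rewrite ?mulr0 // mulf_eq0 (negbTE c0) => /eqP.
Qed.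

(** For a form on cells of one dimension only, the distributional derivative
    vanishes if and only if its two parts do, and on conforming forms it is one
    of these parts up to sign. *)
Lemma harm_H_01 k : harm_H T U ori Lam sp k 1 = harm_H T U ori Lam sp k 0.
Proof.
have kE : k = n%:Z + (k - n%:Z) by ring.
have kE1 : k - 1 = n%:Z + (k - 1 - n%:Z) by ring.
have k1 : k - n%:Z = k - 1 - n%:Z + 1 by ring.
have L1 : Lam_ T U ori Lam k n%:Z 1 = Lam1 T U Lam k n%:Z.
  by rewrite Lam_level /= codim_level1 -(Lam1_graded U Lam_spaces kE).
have spE w v : Lam1 T U Lam k n%:Z w -> Lam1 T U Lam k n%:Z v ->
    sp_Lam T U sp k n%:Z 1 w v = sp k n%:Z w v.
  move=> wL vL; rewrite /sp_Lam big_ord1 /= !subr0.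
  by rewrite (comp_at_id wL) (comp_at_id vL).
have dE v : Lam_ T U ori Lam (k - 1) n%:Z 0 v ->
    [/\ ddist T U ori (k - 1) v = sgn n%:Z *: Dmap T U (k - 1) n%:Z v
      & Lam1 T U Lam k n%:Z (Dmap T U (k - 1) n%:Z v)].
  move=> [vL vT]; move: (vL); rewrite (Lam1_graded U Lam_spaces kE1) => vW.
  rewrite (ddistE U ori T_complex T_dim) (total_single ori Lam_spaces vW) -kE1 vT.
  rewrite scaler0 addr0; split=> //.
  move=> C; rewrite /Dmap; have [Ca|//] := boolP (active T U n%:Z C).
  have /and3P[CT CU /eqP dC] := Ca.
  have [_ _ H _] := Lam_spaces; have := H (k - 1) C (v C) CT; rewrite subrK; apply.
  by have := vL C; rewrite Ca.
have eq0 w : Lam1 T U Lam k n%:Z w -> ddist T U ori k w = 0 <->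
    Dmap T U k n%:Z w = 0 /\ Tmap T U ori k n%:Z w = 0.
  rewrite (Lam1_graded U Lam_spaces kE) (ddistE U ori T_complex T_dim) => wW.
  by rewrite (total_single_eq0 ori Lam_spaces wW) -kE.
apply/seteqP; split=> w [].
  rewrite L1 => wL /(eq0 _ wL) [wD wT] wv; split=> // v vL.
  have [vE DvL] := dE _ vL; have := wv v vL.
  rewrite vE spE //; last exact: (subspaceZ (Lam1_subspace U Lam_spaces _ _)).
  by move/(sp_scale (sgn_neq0 _) wL DvL).
move=> [wL wT] wD wv; split; first by rewrite L1.
  by apply/(eq0 _ wL).
move=> v vL; have [vE DvL] := dE _ vL.
rewrite vE spE //; last exact: (subspaceZ (Lam1_subspace U Lam_spaces _ _)).
by apply/(sp_scale (sgn_neq0 _) wL DvL); apply: wv.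
Qed.

Lemma Tmap_Lam1 m v : Lam1 T U Lam 0 (m + 1) v ->
  Lam1 T U Lam 0 m (Tmap T U ori 0 (m + 1) v).
Proof.
move=> vL F; rewrite /Tmap addrK; have [Fa|//] := boolP (active T U m F).
have /and3P[FT _ _] := Fa.
apply: (subspace_sum (Lam_subspace Lam_spaces 0 FT)) => C /andP[Ca FC].
apply: (subspaceZ (Lam_subspace Lam_spaces 0 FT)).
have /and3P[CT _ _] := Ca; apply: (Lam_trace Lam_spaces CT (psubsimplexE FC)).
by have := vL C; rewrite Ca.
Qed.

Lemma ddist_Gam0 m v : Gam_ T U Lam 0 (m + 1) 0 v ->
  total (- m - 1) v = sgn m *: Tmap T U ori 0 (m + 1) v.
Proof.
move=> [vL vD]; have mE : 0 = m + 1 + (- m - 1) :> int by ring.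
move: vL; rewrite (Lam1_graded U Lam_spaces mE) => vW.
by rewrite (total_single ori Lam_spaces vW) -mE vD scaler0 add0r addrK.
Qed.

Lemma total_eq0_Lam1 m w : Lam1 T U Lam 0 m w -> total (- m) w = 0 <->
    Dmap T U 0 m w = 0 /\ Tmap T U ori 0 m w = 0.
Proof.
have mE : 0 = m - m :> int by ring.
rewrite (Lam1_graded U Lam_spaces mE) => wW.
by rewrite (total_single_eq0 ori Lam_spaces wW) -mE.
Qed.

Lemma harm_C_01 m : harm_C T U ori Lam sp m 0 = harm_C T U ori Lam sp m 1.
Proof.
have mE : 0 = m - m :> int by ring.
have L1 : Gam_ T U Lam 0 m 1 = Lam1 T U Lam 0 m.
  by rewrite Gam_level /= (@dim_level1 _ m) // -(Lam1_graded U Lam_spaces mE).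
have spE w v : Lam1 T U Lam 0 m w -> Lam1 T U Lam 0 m v ->
    sp_Gam T U sp 0 m 1 w v = sp 0 m w v.
  move=> wL vL; rewrite /sp_Gam big_ord1 /= !addr0.
  by rewrite (comp_at_id wL) (comp_at_id vL).
have dE v : Gam_ T U Lam 0 (m + 1) 0 v ->
    ddist T U ori (n%:Z - m - 1) v = sgn m *: Tmap T U ori 0 (m + 1) v.
  have e : n%:Z - m - 1 - n%:Z = - m - 1 by ring.
  by move=> vG; rewrite (ddistE U ori T_complex T_dim) e (ddist_Gam0 vG).
have tE w : ddist T U ori (n%:Z - m) w = total (- m) w.
  have e : n%:Z - m - n%:Z = - m by ring.
  by rewrite (ddistE U ori T_complex T_dim) e.
apply/seteqP; split=> w [].
  move=> [wL wD] wT wv; split; first by rewrite L1.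
    by rewrite tE; apply/(total_eq0_Lam1 wL).
  move=> v vG; rewrite dE //; have TvL := Tmap_Lam1 vG.1.
  rewrite spE //; last exact: (subspaceZ (Lam1_subspace U Lam_spaces _ _)).
  by apply/(sp_scale (sgn_neq0 _) wL TvL); apply: wv.
rewrite L1 tE => wL /(total_eq0_Lam1 wL) [wD wT] wv; split=> // v vG.
have := wv v vG; rewrite dE //; have TvL := Tmap_Lam1 vG.1.
rewrite spE //; last exact: (subspaceZ (Lam1_subspace U Lam_spaces _ _)).
by move/(sp_scale (sgn_neq0 _) wL TvL).
Qed.

(** Either space lives on all cells of dimension [n - k] up to [n], which is the
    common top level of the two filtrations. *)
Lemma harm_C_H (k : nat) : (k <= n)%N ->
  harm_C T U ori Lam sp (n%:Z - k%:Z) k.+1 = harm_H T U ori Lam sp k%:Z k.+1.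
Proof.
move=> kn; set m := n%:Z - k%:Z.
have mE : n%:Z - m = k%:Z by rewrite /m; ring.
have E : Gam_ T U Lam 0 m k.+1 = Lam_ T U ori Lam k%:Z n%:Z k.+1.
  rewrite LamE GamE /m; have -> : 0 - (n%:Z - k%:Z) = k%:Z - n%:Z by ring.
  have -> : n%:Z - k%:Z + k.+1%:Z = n%:Z + 1 by lia.
  by have -> : n%:Z + 1 - k.+1%:Z = n%:Z - k%:Z by lia.
have E' : Gam_ T U Lam 0 (m + 1) k = Lam_ T U ori Lam (k%:Z - 1) n%:Z k.
  (* For [k = 0] both spaces are zero, one for lack of cells of dimension [n + 1]
     and the other for lack of forms of degree [-1]. *)
  case: (k) @m mE kn E => [|k'] m mE kn E; last first.
    rewrite LamE GamE /m.
    have -> : 0 - (n%:Z - k'.+1%:Z + 1) = k'.+1%:Z - 1 - n%:Z by ring.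
    have -> : n%:Z - k'.+1%:Z + 1 + k'.+1%:Z = n%:Z + 1 by ring.
    by have -> : n%:Z + 1 - k'.+1%:Z = n%:Z - k'.+1%:Z + 1 by ring.
  rewrite Lam_level Gam_level; have [_ Lam_out _ _] := Lam_spaces.
  have codim_sub : is_subspace (level_chains codim_level total (0%:Z - 1 - n%:Z) 0).
    exact: level_chains_sub.
  have dim_sub : is_subspace (level_chains dim_level total (- (m + 1)) 0).
    exact: level_chains_sub.
  have codim0 w : level_chains codim_level total (0%:Z - 1 - n%:Z) 0 w -> w = 0.
    move=> [[wL _] _]; apply/funext => C; have := wL C; case: ifP => // /andP[CT _].
    have := sdim_bounds T_complex T_dim CT => CT'.
    by rewrite Lam_out //; left; lia.
  have dim0 w : level_chains dim_level total (- (m + 1)) 0 w -> w = 0.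
    move=> [wW _]; apply/funext => C; apply/eqP/negPn/negP => wC.
    have [wL /(_ _ wC)] := wW; have /andP[CT _] := graded_live wL wC.
    by have := sdim_bounds T_complex T_dim CT; rewrite /m; lia.
  by apply/seteqP; split=> w; [move/dim0|move/codim0] => ->; exact: subspace0.
have spE w v : sp_Gam T U sp 0 m k.+1 w v = sp_Lam T U sp k%:Z n%:Z k.+1 w v.
  rewrite /sp_Gam (reindex_inj rev_ord_inj); apply: eq_bigr => j _ /=.
  have jk := ltn_ord j; have -> : (k.+1 - j.+1)%N%:Z = k%:Z - j%:Z by lia.
  have -> : 0 + (k%:Z - j%:Z) = k%:Z - j%:Z by ring.
  by have -> : m + (k%:Z - j%:Z) = n%:Z - j%:Z by rewrite /m; ring.
rewrite /harm_C /harm_H E E' mE.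
by apply/seteqP; split=> w [wL tw wv]; split=> // v vL; have := wv v vL; rewrite spE.
Qed.

(** * Comparison with simplicial homology *)

Definition vertex C : 'rV[R]_n := head 0 (enum_fset C).

Lemma const1_vertex C : C != fset0 -> const1 C (vertex C) [::] = 1.
Proof.
move=> C0; rewrite /const1 /restrict_form asboolT //; split=> //.
apply: hull_vertex; rewrite /vertex -nth0.
have : (nth 0 (enum_fset C) 0 \in enum_fset C) by rewrite mem_nth // cardfs_gt0.
by [].
Qed.

(** Closed [0]-forms are constant on each cell, so any point may serve to read
    off the constant. *)
Definition coeffs m w : @rchain R n :=
  fun C => if active T U m C then w C (vertex C) [::] else 0.

Definition constants m (c : @rchain R n) : cochain R n :=
  fun C => if active T U m C then c C *: const1 C else 0.

Lemma closed_forms C (u : dform R n) : live C ->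
  (Lam 0 C u /\ dC 0 C u = 0) <-> exists a : R, u = a *: const1 C.
Proof.
move=> /andP[CT CU]; have [H _] := exactness CT CU.
by rewrite -[X in X <-> _]/([set w | Lam 0 C w /\ dC 0 C w = 0] u) H.
Qed.

Lemma coeffsE m w C : Gam_ T U Lam 0 m 0 w -> active T U m C ->
  w C = coeffs m w C *: const1 C.
Proof.
move=> [wL wD] Ca; have := Ca; rewrite activeE => /andP[Cl _].
have /andP[CT _] := Cl.
have [|a aE] := (closed_forms (w C) Cl).1.
  split; first by have := wL C; rewrite Ca.
  by have := congr1 (@^~ C) wD; rewrite /Dmap Ca.
rewrite /coeffs Ca aE; congr (_ *: _).
transitivity (a * const1 C (vertex C) [::]) => //.
by rewrite const1_vertex ?mulr1 // (complex_neq0 T_complex CT).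
Qed.

Lemma constants_Gam m c : Gam_ T U Lam 0 m 0 (constants m c).
Proof.
have H C : active T U m C -> Lam 0 C (c C *: const1 C) /\ dC 0 C (c C *: const1 C) = 0.
  by rewrite activeE => /andP[Cl _]; apply/(closed_forms _ Cl); exists (c C).
split=> [C|]; first by rewrite /constants; have [/H []|] := boolP (active T U m C).
apply/funext => C; rewrite /Dmap /constants.
by have [/H []|] := boolP (active T U m C).
Qed.

Lemma coeffs_constants m c C : active T U m C -> coeffs m (constants m c) C = c C.
Proof.
move=> Ca; rewrite /coeffs /constants Ca; have /and3P[CT _ _] := Ca.
transitivity (c C * const1 C (vertex C) [::]) => //.
by rewrite const1_vertex ?mulr1 // (complex_neq0 T_complex CT).
Qed.

(** On locally constant forms, the trace operator is the relative simplicial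
    boundary operator. *)
Lemma Tmap_constant m w (c : @rchain R n) F :
  (forall C, active T U m C -> w C = c C *: const1 C) ->
  active T U (m - 1) F ->
  Tmap T U ori 0 m w F = chain_boundary ori T m c F *: const1 F.
Proof.
move=> wE Fa; have := Fa; rewrite activeE => /andP[Fl /eqP dF].
have /andP[FT FU] := Fl.
rewrite /Tmap Fa /chain_boundary FT dF eqxx /= scaler_suml big_mkcond.
rewrite [RHS]big_mkcond; apply: eq_big_seq => C CT.
have [FC|] := boolP (psubsimplex F C); last by rewrite !andbF.
rewrite activeE (live_super U_complex Fl CT (psubsimplexE FC)) /= !andbT.
case: (boolP (sdim C == m)) => // dC.
rewrite wE; last by rewrite activeE (live_super U_complex Fl CT (psubsimplexE FC)).
rewrite /trace_form restrict_formZ scalerA; congr (_ *: _).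
by apply: const1_trace; case/andP: FC => /andP[].
Qed.

Lemma const1_scale_eq0 C (a : R) : C \in T -> a *: const1 C = 0 -> a = 0.
Proof.
move=> CT /(congr1 (fun u => u (vertex C) [::])) H.
have : a * const1 C (vertex C) [::] = 0 by exact: H.
by rewrite const1_vertex ?mulr1 // (complex_neq0 T_complex CT).
Qed.

(** Passing to coefficients identifies the closed [0]-forms without signed traces
    with the relative cycles: chains in [U] are as invisible to the forms as they
    are to the quotient. *)
Lemma homology_iso m :
  lin_iso (rel_homology ori T U m) (harm_C T U ori Lam sp m 0).
Proof.
have mE : 0 = m - m :> int by ring.
have mE1 : - (m + 1) = - m - 1 by ring.
have U_closed C F : C \in U -> F \in T -> psubsimplex F C -> F \in U.
  by move=> CU _ FC; apply: (complex_closed U_complex CU (psubsimplexE FC)).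
set K := level_cycles dim_level total (- m) 1.
set B := level_boundaries dim_level total (- m) 0.
have Ksub : is_subspace K by apply: level_cycles_sub.
have Bsub : is_subspace B by apply: level_boundaries_sub.
have BK : B `<=` K.
  exact: (level_boundaries_cycles dim_level_total dim_level_dd).
have KS : K `<=` dim_level (- m) 1 by move=> w [].
have Bfin : fin_spanned B by apply: fin_spannedS (dim_level_fin (- m) 1) => w /BK /KS.
have KP w : K w <-> Gam_ T U Lam 0 m 0 w /\ Tmap T U ori 0 m w = 0.
  rewrite /K /level_cycles /= (@dim_level1 _ m) // -(Lam1_graded U Lam_spaces mE).
  split=> [[wL]|[[wL wD] wT]]; first by move/(total_eq0_Lam1 wL) => [].
  by split=> //; apply/(total_eq0_Lam1 wL).
have BP u : B u <-> exists2 v, Gam_ T U Lam 0 (m + 1) 0 v & u = Tmap T U ori 0 (m + 1) v.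
  have GE : Gam_ T U Lam 0 (m + 1) 0 = level_chains dim_level total (- m - 1) 0.
    by rewrite Gam_level mE1.
  have Gsub : is_subspace (Gam_ T U Lam 0 (m + 1) 0).
    by rewrite GE; apply: level_chains_sub.
  have TZ v : Gam_ T U Lam 0 (m + 1) 0 v ->
      sgn m *: Tmap T U ori 0 (m + 1) v = total (- m - 1) v.
    by move/ddist_Gam0.
  have tZ v : Gam_ T U Lam 0 (m + 1) 0 v ->
      total (- m - 1) (sgn m *: v) = sgn m *: total (- m - 1) v.
    rewrite GE => vL; rewrite (linear_onZ _ (sgn m) _ vL) //; first exact: level_chains_sub.
    exact: level_chains_linear.
  split=> [[v vL <-]|[v vG ->]].
    have vG : Gam_ T U Lam 0 (m + 1) 0 v by rewrite GE.
    have svG : Gam_ T U Lam 0 (m + 1) 0 (sgn m *: v) by apply: (subspaceZ Gsub).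
    exists (sgn m *: v) => //.
    by rewrite -[RHS]scale1r -(sgn_sq (n := n) m) -scalerA TZ // tZ // scalerA sgn_sq scale1r.
  have svG : Gam_ T U Lam 0 (m + 1) 0 (sgn m *: v) by apply: (subspaceZ Gsub).
  exists (sgn m *: v); first by rewrite GE in svG.
  by rewrite tZ // -TZ // scalerA sgn_sq scale1r.
pose phi w := proj_quot (rel_boundaries ori T U m)
  (proj_quot (simp_chains U m) (coeffs m w)).
have coeffs_lin : linear_on K (coeffs m).
  move=> a u v _ _; apply/funext => C.
  transitivity (a * coeffs m u C + coeffs m v C) => //.
  by rewrite /coeffs; case: ifP => // _; rewrite mulr0 addr0.
have phi_lin : linear_on K phi.
  move=> a u v Ku Kv; rewrite /phi coeffs_lin //.
  by rewrite (@proj_quot_linear _ _ _ setT) // (@proj_quot_linear _ _ _ setT).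
have coeffs_chain p w : simp_chains T p (coeffs p w).
  move=> C; rewrite /coeffs; case: ifP => [/and3P[CT _ /eqP dC] _|_]; last by rewrite eqxx.
  by split.
have bdsub := rel_boundaries_subspace ori U_closed m.
have chsub p := @simp_chains_subspace R n U p.
have phi_ker w : K w -> phi w = 0 <-> B w.
  move=> /KP [wG wT]; rewrite proj_quot_eq0 // BP; split.
    move=> [_ [b bT <-]]; rewrite (rel_boundary_proj ori U_closed); last by rewrite addrK.
    move/proj_quot_eq/(in_vspan_subspace (chsub m)) => bw.
    exists (constants (m + 1) b); first exact: constants_Gam.
    apply/funext => F; have [Fa|Fa] := boolP (active T U m F); last first.
      rewrite /Tmap addrK (negbTE Fa).
      by have := wG.1 F; rewrite (negbTE Fa).
    rewrite (@Tmap_constant _ _ b); first last.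
    - by rewrite addrK.
    - by move=> C Ca; rewrite /constants Ca.
    rewrite (coeffsE wG Fa); congr (_ *: _).
    have /and3P[_ FU _] := Fa.
    apply/eqP; rewrite eq_sym -subr_eq0; apply: contraNT FU => H.
    by have [] := bw F H.
  move=> [v vG wE]; exists (proj_quot (simp_chains U (m + 1)) (coeffs (m + 1) v)).
    by exists (coeffs (m + 1) v) => //; exact: coeffs_chain.
  rewrite (rel_boundary_proj ori U_closed); last by rewrite addrK.
  apply/proj_quot_eq/(in_vspan_subspace (chsub m)) => F.
  have [Fa|Fa] := boolP (active T U m F).
    have -> : (chain_boundary ori T (m + 1) (coeffs (m + 1) v) - coeffs m w) F =
      chain_boundary ori T (m + 1) (coeffs (m + 1) v) F - coeffs m w F by [].
    have /and3P[FT _ _] := Fa.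
    have -> : chain_boundary ori T (m + 1) (coeffs (m + 1) v) F = coeffs m w F.
      apply/eqP; rewrite -subr_eq0; apply/eqP; apply: (const1_scale_eq0 FT).
      rewrite scalerBl -(coeffsE wG Fa) wE (@Tmap_constant _ _ (coeffs (m + 1) v)) ?addrK ?subrr //.
      by move=> C Ca; apply: coeffsE.
    by rewrite subrr eqxx.
  have -> : (chain_boundary ori T (m + 1) (coeffs (m + 1) v) - coeffs m w) F =
    chain_boundary ori T (m + 1) (coeffs (m + 1) v) F - coeffs m w F by [].
  rewrite [coeffs m w F]/coeffs (negbTE Fa) subr0 => /chain_boundary_chains [FT].
  rewrite addrK => dF; split=> //; apply: contraNT Fa => FU.
  by rewrite /active FT FU dF eqxx.
have phi_im : phi @` K = rel_homology ori T U m.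
  apply/seteqP; split=> [_ [w Kw <-]|_ [_ [[c cT <-] cB] <-]].
    have [wG wT] := (KP w).1 Kw.
    exists (proj_quot (simp_chains U m) (coeffs m w)) => //; split.
      by exists (coeffs m w).
    rewrite (rel_boundary_proj ori U_closed) // proj_quot_eq0 //.
    move=> F H; have [FT dF] := chain_boundary_chains H; split=> //.
    apply: contraNT H => FU; apply/eqP; apply: (const1_scale_eq0 FT).
    have Fa : active T U (m - 1) F by rewrite /active FT FU dF eqxx.
    rewrite -(@Tmap_constant m w) ?wT // => C Ca; exact: coeffsE.
  exists (constants m c).
    apply/KP; split; first exact: constants_Gam.
    apply/funext => F; have [Fa|Fa] := boolP (active T U (m - 1) F); last first.
      by rewrite /Tmap (negbTE Fa).
    rewrite (@Tmap_constant _ _ c) //; last by move=> C Ca; rewrite /constants Ca.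
    move: cB; rewrite (rel_boundary_proj ori U_closed) // proj_quot_eq0 // => cB.
    have /and3P[_ FU _] := Fa.
    have -> : chain_boundary ori T m c F = 0.
      by apply/eqP; apply: contraNT FU => /cB [].
    by rewrite scale0r.
  congr (proj_quot _ _); apply/proj_quot_eq/(in_vspan_subspace (chsub m)) => C.
  have -> : (coeffs m (constants m c) - c) C = coeffs m (constants m c) C - c C by [].
  have [Ca|Ca] := boolP (active T U m C); first by rewrite coeffs_constants // subrr eqxx.
  rewrite /coeffs (negbTE Ca) sub0r oppr_eq0 => /cT [CT dC]; split=> //.
  by apply: contraNT Ca => CU; rewrite /active CT CU dC eqxx.
rewrite harm_C_01 harm_C_harmonic; apply: lin_iso_sym.
  by apply: (level_harmonic_sub dim_level_sub dim_level_linear dim_level_total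
    dim_level_dd (sp_Gam_scalar m 1)).
rewrite -phi_im; exact: (harmonic_iso_image (sp_Gam_scalar m 1) (dim_level_sub _ _)
  Ksub Bsub BK KS Bfin phi_lin phi_ker).
Qed.

End Filtrations.

Theorem theorem5p11 (R : realType) (n : nat)
    (T U : {fset simplex R n})
    (ori : simplex R n -> seq 'rV[R]_n -> R)
    (Lam : int -> simplex R n -> set (dform R n))
    (sp : int -> int -> cochain R n -> cochain R n -> R)
    (T_complex : simplicial_complex T)
    (T_dim : dimensional n%:Z T)
    (U_sub : (U `<=` T)%fset)
    (U_complex : simplicial_complex U)
    (ori_orients : forall C, C \in T -> orients (ori C) C)
    (ori_euclidean : forall C, C \in T -> sdim C = n%:Z ->
       same_orientation C (ori C) euclidean_orientation)
    (Lam_spaces : admissible_spaces T Lam)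
    (sp_scalar : forall k m : int, scalar_product (Lam1 T U Lam k m) (sp k m))
    (exactness : local_exactness_condition T U Lam)
    (decomposition : geometric_decomposition_condition T Lam)
    (patches : local_patch_condition ori T U)
    (k : nat) (k_le_n : (k <= n)%N) :
  let m : int := n%:Z - k%:Z in
  let HH (b : nat) := harm_H T U ori Lam sp k%:Z b in
  let CC (b : nat) := harm_C T U ori Lam sp m b in
  lin_iso (rel_homology ori T U m) (CC 0%N) /\
  CC 0%N = CC 1%N /\
  (forall b : nat, (1 <= b <= k)%N -> lin_iso (CC b) (CC b.+1)) /\
  CC k.+1 = HH k.+1 /\
  (forall b : nat, (1 <= b <= k)%N -> lin_iso (HH b.+1) (HH b)) /\
  HH 1%N = HH 0%N.
Proof.
move=> m HH CC; split; first exact: homology_iso.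
split; first exact: harm_C_01.
split; first by case=> [//|b] _; exact: harm_C_iso.
split; first exact: harm_C_H.
split; first by case=> [//|b] _; exact: harm_H_iso.
exact: harm_H_01.
Qed.
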